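(* Suppose Assumptions A and B (stated in the context) hold. Let $\kappa\in(0,1)$ be a constant. For any $T\in\mathbb{N}_+$, let $\boldsymbol{x}_T=(x_1,\dots,x_T)$ be the sequence generated by Algorithm 2 (described in the context) with, for all $i\in[n]$ and $t\in\mathbb{N}_+$, $$\alpha_{i,t}=\frac{1}{t^{\kappa}},\quad \beta_{i,t}=\frac{1}{t^{\kappa}},\quad \gamma_{i,t}=\frac{1}{t^{1-\kappa}},\quad \xi_{i,t}=\frac{1}{t+1},\quad \delta_{i,t}=\frac{r_i}{t+1}.$$ Then, for any comparator sequence $\boldsymbol{y}_T\in\mathcal{X}_T$, $$\mathbf{E}[\mathrm{Reg}(\boldsymbol{x}_T,\boldsymbol{y}_T)]\le C_3T^{\max\{\kappa,1-\kappa\}}+2R_{\max}T^{\kappa}V(\boldsymbol{y}_T),$$ $$\mathbf{E}\Big[\Big\|\Big[\sum_{t=1}^Tg_t(x_t)\Big]_+\Big\|\Big]\le\sqrt{C_4}\,T^{1-\kappa/2},$$ where $$V(\boldsymbol{y}_T)=\sum_{t=1}^{T-1}\sum_{i=1}^n\|y_{i,t+1}-y_{i,t}\|,$$ $$C_3=\sum_{i=1}^n\Big(2G_{f_i}(r_i+R_i)+8R_i^2+\frac{2\sqrt m B_1G_{g_i}R_i}{\kappa}+\frac{p_i^2G_{f_i}^2}{1-\kappa}\Big)+\frac{\hat C_0}{\kappa},$$ $$C_4=C_{4,1}\Big(2\sum_{i=1}^nF_{f_i}+C_3\Big),\qquad C_{4,1}=\sum_{i=1}^n2\Big(\frac{2mp_i^2G_{g_i}^2+1}{1-\kappa}+1\Big),$$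 $$\hat C_0=\frac{6n^2\sqrt m\,\tau B_1F_g}{1-\lambda}+2nB_1^2,\qquad B_1=\sqrt mF_g+\sqrt m\,pG_gR_{\max},$$ $p=\sum_{i=1}^np_i$, $R_{\max}=\max_{i\in[n]}R_i$, $F_g=\max_{i\in[n]}F_{g_i}$, $G_g=\max_{i\in[n]}G_{g_i}$, $\tau=(1-\frac{w}{2n^2})^{-2}$ and $\lambda=(1-\frac{w}{2n^2})^{1/\iota}$.
   Context: Notation. $[n]=\{1,\dots,n\}$; $\mathbb{N}_+$ is the set of positive integers; $\|\cdot\|$ is the Euclidean norm; $\mathbb{B}^p,\mathbb{S}^p$ are the unit ball and unit sphere of $\mathbb{R}^p$; $\mathcal{P}_{\mathbb{K}}$ is Euclidean projection on $\mathbb{K}$; $[\cdot]_+=\mathcal{P}_{\mathbb{R}^m_+}$; vector inequalities are componentwise; $(1-\xi)\mathbb{K}=\{(1-\xi)x:x\in\mathbb{K}\}$. Problem. There are $n$ learners and an adversary. Learner $i$ has a decision set $\mathbb{X}_i\subseteq\mathbb{R}^{p_i}$; $\mathbb{X}=\mathbb{X}_1\times\cdots\times\mathbb{X}_n$. At the beginning of each round $t$ the adversary chooses $f_{i,t}:\mathbb{X}_i\to\mathbb{R}$ and $g_{i,t}:\mathbb{X}_i\to\mathbb{R}^m$, $i\in[n]$, possibly depending on the past decisions $x_1,\dots,x_{t-1}$ but not on the current decision; then learners choose $x_{i,t}\in\mathbb{X}_i$. Write $x_t=(x_{1,t},\dots,x_{n,t})$, $f_t(x_t)=\sum_{i=1}^nf_{i,t}(x_{i,t})$,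 $g_t(x_t)=\sum_{i=1}^ng_{i,t}(x_{i,t})$. For sequences $\boldsymbol{x}_T=(x_1,\dots,x_T)$, $\boldsymbol{y}_T=(y_1,\dots,y_T)$ with $y_t=(y_{1,t},\dots,y_{n,t})$, $\mathrm{Reg}(\boldsymbol{x}_T,\boldsymbol{y}_T)=\sum_{t=1}^Tf_t(x_t)-\sum_{t=1}^Tf_t(y_t)$. Let $\mathcal{X}_T=\{(x_1,\dots,x_T):x_t\in\mathbb{X},\ g_t(x_t)\le\mathbf{0}_m,\ t\in[T]\}$ and $\check{\mathcal{X}}_T=\{(x,\dots,x):x\in\mathbb{X},\ g_t(x)\le\mathbf{0}_m,\ t\in[T]\}\subseteq\mathcal{X}_T$; both are assumed nonempty for every $T\in\mathbb{N}_+$. Graph. $\mathcal{G}_t=(\mathcal{V},\mathcal{E}_t)$ is a time-varying directed graph on $\mathcal{V}=[n]$; the mixing matrix $W_t\in\mathbb{R}^{n\times n}$ satisfies $[W_t]_{ij}>0$ if $(j,i)\in\mathcal{E}_t$ or $i=j$, and $[W_t]_{ij}=0$ otherwise. Assumption A. For every $t\in\mathbb{N}_+$: (a) there is a constant $w\in(0,1)$ (independent of $t$) with $[W_t]_{ij}\ge w$ whenever $[W_t]_{ij}>0$; (b) $W_t$ is doubly stochastic; (c) there is an integer $\iota>0$ (independent of $t$) such that $(\mathcal{V},\cup_{l=0}^{\iota-1}\mathcal{E}_{t+l})$ is strongly connected. Assumption B. For each $i\in[n]$: (a) $\mathbb{X}_i$ is convex and closed and $r_i\mathbb{B}^{p_i}\subseteq\mathbb{X}_i\subseteq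 R_i\mathbb{B}^{p_i}$ for some $r_i,R_i>0$; (b) $f_{i,t}$ and all components $[g_{i,t}]_j$, $j\in[m]$, are convex with $|f_{i,t}(x)|\le F_{f_i}$ and $|[g_{i,t}(x)]_j|\le F_{g_i}$ for all $t$, $j$, $x\in\mathbb{X}_i$, where $F_{f_i},F_{g_i}>0$ are constants; (c) $f_{i,t},g_{i,t}$ are differentiable with $\|\nabla f_{i,t}(x)\|\le G_{f_i}$ and $\|\nabla[g_{i,t}(x)]_j\|\le G_{g_i}$ for all $t$, $j$, $x\in\mathbb{X}_i$, where $G_{f_i},G_{g_i}>0$ are constants. Algorithm 2 (two-point bandit feedback), with sequences $\alpha_{i,t},\beta_{i,t},\gamma_{i,t},\xi_{i,t},\delta_{i,t}$. The vectors $u_{i,t}$, $i\in[n]$, $t\ge1$, are drawn independently and uniformly from $\mathbb{S}^{p_i}$. Initialize $x_{i,1}\in(1-\xi_{i,1})\mathbb{X}_i$, $q_{i,1}=\mathbf{0}_m$. For $t\ge2$ and each $i\in[n]$: $\tilde q_{i,t}=\sum_{j=1}^n[W_{t-1}]_{ij}q_{j,t-1}$; $x_{i,t}=\mathcal{P}_{(1-\xi_{i,t})\mathbb{X}_i}(x_{i,t-1}-\alpha_{i,t}b_{i,t})$; $q_{i,t}=[(1-\gamma_{i,t}\beta_{i,t})\tilde q_{i,t}+\gamma_{i,t}c_{i,t}]_+$; where $b_{i,t}=\hat\nabla_2f_{i,t-1}(x_{i,t-1})+(\hat\nabla_2g_{i,t-1}(x_{i,t-1}))^\top\tilde q_{i,t}$,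 $c_{i,t}=\hat\nabla_2g_{i,t-1}(x_{i,t-1})(x_{i,t}-x_{i,t-1})+g_{i,t-1}(x_{i,t-1})$, $\hat\nabla_2f_{i,t}(x_{i,t})=\frac{p_i}{\delta_{i,t}}\big(f_{i,t}(x_{i,t}+\delta_{i,t}u_{i,t})-f_{i,t}(x_{i,t})\big)u_{i,t}$ and $\hat\nabla_2g_{i,t}(x_{i,t})=\frac{p_i}{\delta_{i,t}}\big(g_{i,t}(x_{i,t}+\delta_{i,t}u_{i,t})-g_{i,t}(x_{i,t})\big)u_{i,t}^\top\in\mathbb{R}^{m\times p_i}$. Expectations $\mathbf{E}$ are over the random vectors $u_{i,t}$. *)

(* Defs.v *)
From HB Require Import structures.
From mathcomp Require Import all_boot all_order all_algebra.
From mathcomp Require Import all_classical all_reals all_analysis.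

Set Implicit Arguments.
Unset Strict Implicit.
Unset Printing Implicit Defensive.

Import Order.TTheory GRing.Theory Num.Theory.
Import numFieldNormedType.Exports.

Local Open Scope classical_set_scope.
Local Open Scope ring_scope.

Section Euclidean.
Context {R : realType}.

(* The library norm on matrices is the sup norm, hence this separate one. *)
Definition enorm {k} (v : 'cV[R]_k) : R := Num.sqrt (\sum_j v j 0 ^+ 2).

Definition dotv {k} (u v : 'cV[R]_k) : R := \sum_j u j 0 * v j 0.

(* A nearest point of K to z; it is the Euclidean projection when K is
   nonempty, closed and convex. *)
Definition euclid_proj {k} (K : set 'cV[R]_k) (z : 'cV[R]_k) : 'cV[R]_k :=
  xget 0 [set y | K y /\ forall y', K y' -> enorm (z - y) <= enorm (z - y')].

Definition pospart {k} (z : 'cV[R]_k) : 'cV[R]_k :=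
  euclid_proj [set y | forall j, 0 <= y j 0] z.

Definition scale_set {k} (c : R) (K : set 'cV[R]_k) : set 'cV[R]_k :=
  [set c *: x | x in K].

(* phi only matters on K, so that at boundary points of K increments are taken
   inside K.  If K is convex with nonempty interior then v is unique. *)
Definition is_gradient {k} (K : set 'cV[R]_k) (phi : 'cV[R]_k -> R)
    (x v : 'cV[R]_k) : Prop :=
  forall e : R, 0 < e -> \forall y \near within K (nbhs x),
    `|phi y - phi x - dotv v (y - x)| <= e * enorm (y - x).

Definition differentiable_on {k} (K : set 'cV[R]_k) (phi : 'cV[R]_k -> R) :=
  forall x, K x -> exists v, is_gradient K phi x v.

Definition gradient_bounded {k} (K : set 'cV[R]_k) (phi : 'cV[R]_k -> R)
    (G : R) :=
  forall x v, K x -> is_gradient K phi x v -> enorm v <= G.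

End Euclidean.

Section RandomVectors.
Context {R : realType} {d : measure_display} {Om : measurableType d}.
Variable P : probability Om R.

Definition borel {k} : set (set 'cV[R]_k) := <<s [set A | open A] >>.

Definition random_vector {k} (U : Om -> 'cV[R]_k) : Prop :=
  forall A, borel A -> measurable (U @^-1` A).

(* The uniform law on the sphere is the rotation-invariant probability
   carried by it; for k = 1 it is the symmetric law on {-1, 1}. *)
Definition uniform_on_sphere {k} (U : Om -> 'cV[R]_k) : Prop :=
  [/\ random_vector U,
      forall w, enorm (U w) = 1
    & forall Q : 'M[R]_k, Q^T *m Q = 1%:M -> forall A, borel A ->
        P ((fun w => Q *m U w) @^-1` A) = P (U @^-1` A)].

(* Mutual independence of the vectors u _ t i over all i and all t >= 1. *)
Definition mutually_independent {n} {p : 'I_n -> nat}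
    (u : Om -> nat -> forall i, 'cV[R]_(p i)) : Prop :=
  forall (F : seq ('I_n * nat)) (A : forall k : 'I_n * nat, set 'cV[R]_(p k.1)),
    uniq F -> {in F, forall k, (0 < k.2)%N} ->
    (forall k, k \in F -> borel (A k)) ->
    P [set w | forall k, k \in F -> A k (u w k.2 k.1)] =
    (\prod_(k <- F) P [set w | A k (u w k.2 k.1)])%E.

End RandomVectors.

Section Problem.
Context {R : realType} {n m : nat} {p : 'I_n -> nat}.

Definition decision := forall i : 'I_n, 'cV[R]_(p i).

(* s |-> x_s; only the values at s >= 1 are meaningful. *)
Definition trajectory := nat -> decision.

(* An adversary strategy: round, trajectory and point of the decision set of
   learner i to the value of the function revealed to learner i. *)
Definition strategy (V : Type) :=
  forall i : 'I_n, nat -> trajectory -> 'cV[R]_(p i) -> V.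

Variable X : forall i : 'I_n, set 'cV[R]_(p i).

Definition feasible_traj : set trajectory :=
  [set h | forall s i, (0 < s)%N -> X (h s i)].

Definition non_anticipating {V : Type} (phi : strategy V) : Prop :=
  forall i t (h h' : trajectory), feasible_traj h -> feasible_traj h' ->
    (forall s, (0 < s < t)%N -> h s = h' s) ->
    forall x, X x -> phi i t h x = phi i t h' x.

Definition traj_sigma : set (set trajectory) :=
  <<s [set C | exists s i (B : set 'cV[R]_(p i)),
        borel B /\ C = [set h | B (h s i)]] >>.

(* Needed for the random functions of each round to be measurable. *)
Definition measurable_strategy (phi : strategy R) : Prop :=
  forall i t x, (0 < t)%N -> X x -> forall B : set R, measurable B ->
    traj_sigma (feasible_traj `&` [set h | B (phi i t h x)]).

Definition constr_component (g : strategy 'cV[R]_m) (j : 'I_m) : strategy R :=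
  fun i t h x => g i t h x j 0.

Definition admissible_adversary (f : strategy R) (g : strategy 'cV[R]_m) :=
  [/\ non_anticipating f, measurable_strategy f,
      non_anticipating g & forall j, measurable_strategy (constr_component g j)].

(* phi is the scalar cost of learner i, or one component of its constraint. *)
Record regular_for (i : 'I_n) (phi : strategy R) (F G : R) : Prop := {
  regular_convex : forall t h, (0 < t)%N -> feasible_traj h ->
    convex_function (@X i) (phi i t h) ;
  regular_bounded : forall t h x, (0 < t)%N -> feasible_traj h -> X x ->
    `|phi i t h x| <= F ;
  regular_diff : forall t h, (0 < t)%N -> feasible_traj h ->
    differentiable_on (@X i) (phi i t h) ;
  regular_grad : forall t h, (0 < t)%N -> feasible_traj h ->
    gradient_bounded (@X i) (phi i t h) G
}.

Record assumptionB (f : strategy R) (g : strategy 'cV[R]_m)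
    (r Rd Ff Fg Gf Gg : 'I_n -> R) : Prop := {
  B_pos : forall i, [/\ 0 < r i, 0 < Rd i, 0 < Ff i & 0 < Fg i] ;
  B_gpos : forall i, 0 < Gf i /\ 0 < Gg i ;
  B_convex : forall i, convex_set (@X i : set (convex_lmodType 'cV[R]_(p i))) ;
  B_closed : forall i, closed (@X i) ;
  B_inner : forall i, [set x | enorm x <= r i] `<=` @X i ;
  B_outer : forall i, @X i `<=` [set x | enorm x <= Rd i] ;
  B_f : forall i, regular_for i f (Ff i) (Gf i) ;
  B_g : forall i j, regular_for i (constr_component g j) (Fg i) (Gg i)
}.

(* f_t(z), resp. g_t(z), for the functions chosen along the trajectory x. *)
Definition round_sum {V : nmodType} (phi : strategy V) (t : nat) (x : trajectory)
    (z : decision) : V :=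
  \sum_(i < n) phi i t x (z i).

Definition regret (f : strategy R) (T : nat) (x y : trajectory) : R :=
  \sum_(1 <= t < T.+1) round_sum f t x (x t) -
  \sum_(1 <= t < T.+1) round_sum f t x (y t).

Definition path_length (T : nat) (y : trajectory) : R :=
  \sum_(1 <= t < T) \sum_(i < n) enorm (y t.+1 i - y t i).

Section Algorithm.
Variables (W : nat -> 'M[R]_n) (f : strategy R) (g : strategy 'cV[R]_m).
Variables alpha beta gamma xi delta : 'I_n -> nat -> R.
Variables (u x : trajectory) (q : nat -> 'I_n -> 'cV[R]_m).

Definition grad2f (i : 'I_n) (t : nat) : 'cV[R]_(p i) :=
  ((p i)%:R / delta i t *
   (@f i t x (x t i + delta i t *: u t i) - @f i t x (x t i))) *: u t i.

Definition grad2g (i : 'I_n) (t : nat) : 'M[R]_(m, p i) :=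
  ((p i)%:R / delta i t) *:
  ((@g i t x (x t i + delta i t *: u t i) - @g i t x (x t i)) *m (u t i)^T).

Definition qtilde (t : nat) (i : 'I_n) : 'cV[R]_m :=
  \sum_(j < n) W t.-1 i j *: q t.-1 j.

Definition bvec (t : nat) (i : 'I_n) : 'cV[R]_(p i) :=
  grad2f i t.-1 + (grad2g i t.-1)^T *m qtilde t i.

Definition cvec (t : nat) (i : 'I_n) : 'cV[R]_m :=
  grad2g i t.-1 *m (x t i - x t.-1 i) + @g i t.-1 x (x t.-1 i).

(* One run, for the realization u of the random directions, from x1. *)
Record bandit_run (x1 : decision) : Prop := {
  run_x1 : forall i, x 1%N i = x1 i ;
  run_q1 : forall i, q 1%N i = 0 ;
  run_x : forall t i, (1 < t)%N ->
    x t i = euclid_proj (scale_set (1 - xi i t) (@X i))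
                 (x t.-1 i - alpha i t *: bvec t i) ;
  run_q : forall t i, (1 < t)%N ->
    q t i = pospart ((1 - gamma i t * beta i t) *: qtilde t i +
                     gamma i t *: cvec t i)
}.

End Algorithm.

Section Comparators.
Context {d : measure_display} {Om : measurableType d}.
Variables (P : probability Om R) (g : strategy 'cV[R]_m) (x : Om -> trajectory).

(* The constraints depend on the random trajectory x; a comparator is a fixed
   sequence which satisfies them almost surely. *)
Definition comparators (T : nat) : set trajectory :=
  [set y | (forall t i, (0 < t <= T)%N -> X (y t i)) /\
    {ae P, forall w, forall t j, (0 < t <= T)%N ->
             round_sum g t (x w) (y t) j 0 <= 0}].

Definition static_comparators (T : nat) : set trajectory :=
  [set y | comparators T y /\ exists z : decision,
             forall t, (0 < t <= T)%N -> y t = z].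

End Comparators.

End Problem.

Arguments decision R {n} p.
Arguments trajectory R {n} p.
Arguments strategy R {n} p V.

Section Network.
Context {R : realType} {n : nat}.
Variables (E : nat -> rel 'I_n) (W : nat -> 'M[R]_n).

Definition mixing_matrices : Prop :=
  forall t i j, (0 < t)%N ->
    (E t j i || (i == j) -> 0 < W t i j) /\
    (~~ (E t j i || (i == j)) -> W t i j = 0).

Definition doubly_stochastic (A : 'M[R]_n) : Prop :=
  [/\ forall i j, 0 <= A i j, forall i, \sum_j A i j = 1
    & forall j, \sum_i A i j = 1].

Record assumptionA (w : R) (iota : nat) : Prop := {
  A_w : 0 < w < 1 ;
  A_lower : forall t i j, (0 < t)%N -> 0 < W t i j -> w <= W t i j ;
  A_stoch : forall t, (0 < t)%N -> doubly_stochastic (W t) ;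
  A_iota : (0 < iota)%N ;
  A_connected : forall t, (0 < t)%N -> forall i j,
    connect (fun a b => [exists l : 'I_iota, E (t + l)%N a b]) i j
}.

End Network.

(* Main.v *)
Require Import Defs.
From HB Require Import structures.
From mathcomp Require Import all_boot all_order all_algebra.
From mathcomp Require Import all_classical all_reals all_analysis.
From mathcomp Require Import measurable_realfun.
From mathcomp Require Import ring lra.
Set Implicit Arguments.
Unset Strict Implicit.
Unset Printing Implicit Defensive.
Import Order.TTheory GRing.Theory Num.Theory.
Import numFieldNormedType.Exports.
Local Open Scope classical_set_scope.
Local Open Scope ring_scope.

(** Fix the directions first. Along the run, the squared distance of each
    decision to the comparator, and that of the multipliers to an arbitrary
    [qq >= 0], change in a controlled way: the first by the projection inequality,
    the second because the positive part is nonexpansive. Added up, the two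
    estimates lose the bilinear term that couples decision and multiplier
    ([one_step]), and summation over rounds and learners gives [pathwise]:
      [gaps + regret + dotv qq S <= A * enorm qq ^+ 2 + C3 * T `^ max + path term],
    where [S] is the accumulated constraint, [A = C41 / 4 * T `^ (1 - kappa)], and
    the gaps compare the two-point estimates with the function values for which
    they stand. The comparator satisfies only the sum of the constraints of the
    learners, while each learner has its own multiplier. This costs the
    disagreement among the multipliers, which doubly stochastic mixing contracts
    geometrically over windows of [iota] rounds ([perturbed_consensus]).

    The gaps have nonnegative expectation ([total_gap_ge0]). The direction of a
    round is independent of what happened before ([history_independent]), so past
    quantities may be treated as constants ([freezing_ge0]), and what remains is a
    statement about one convex function and one uniform direction
    ([two_point_estimate]). It is usually obtained by recognizing the expected
    estimate as the gradient of a smoothed function, through the divergence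
    theorem. Here only the invariance of the law under rotations is used:
    differentiating the constant function
    [Q |-> Ex ((Q U)_l * phi (x + s Q U))] at the identity, in each coordinate
    plane, yields a differential inequality in [s] for
    [psi s = Ex (dotv U (x - z) * phi (x + s U))], and integrating it from 0 to the
    exploration radius gives the estimate.

    The choice [qq = 0] gives the bound on the regret. For the violation take a
    constant comparator, whose path term vanishes, and
    [qq = (2 * A)^-1 *: pospart S]: then the terms in [qq] leave
    [enorm (pospart S) ^+ 2 / (4 * A)] on the left, the regret is at least
    [- 2 * T * \sum_i Ff i], and the second moment of the violation is at most
    [C4 * T `^ (2 - kappa)]. *)

Local Notation borel_space R k := (g_sigma_algebraType [set A : set 'cV[R]_k | open A]).

(** * Inner product and Euclidean norm *)

Section EuclideanSpace.
Context {R : realType}.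

Lemma dotvC k (u v : 'cV[R]_k) : dotv u v = dotv v u.
Proof. by apply: eq_bigr => j _; rewrite mulrC. Qed.

Lemma dotvDl k (u u' v : 'cV[R]_k) : dotv (u + u') v = dotv u v + dotv u' v.
Proof. by rewrite /dotv -big_split; apply: eq_bigr => j _; rewrite mxE mulrDl. Qed.

Lemma dotvDr k (u v v' : 'cV[R]_k) : dotv u (v + v') = dotv u v + dotv u v'.
Proof. by rewrite dotvC dotvDl !(dotvC u). Qed.

Lemma dotvZl k (a : R) (u v : 'cV[R]_k) : dotv (a *: u) v = a * dotv u v.
Proof. by rewrite /dotv mulr_sumr; apply: eq_bigr => j _; rewrite mxE mulrA. Qed.

Lemma dotvZr k (a : R) (u v : 'cV[R]_k) : dotv u (a *: v) = a * dotv u v.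
Proof. by rewrite dotvC dotvZl dotvC. Qed.

Lemma dotvNl k (u v : 'cV[R]_k) : dotv (- u) v = - dotv u v.
Proof. by rewrite -scaleN1r dotvZl mulN1r. Qed.

Lemma dotvNr k (u v : 'cV[R]_k) : dotv u (- v) = - dotv u v.
Proof. by rewrite dotvC dotvNl dotvC. Qed.

Lemma dotvBl k (u u' v : 'cV[R]_k) : dotv (u - u') v = dotv u v - dotv u' v.
Proof. by rewrite dotvDl dotvNl. Qed.

Lemma dotvBr k (u v v' : 'cV[R]_k) : dotv u (v - v') = dotv u v - dotv u v'.
Proof. by rewrite dotvDr dotvNr. Qed.

Lemma dotv0l k (v : 'cV[R]_k) : dotv 0 v = 0.
Proof. by rewrite -(scale0r 0) dotvZl mul0r. Qed.

Lemma dotv0r k (v : 'cV[R]_k) : dotv v 0 = 0.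
Proof. by rewrite dotvC dotv0l. Qed.

Definition dotvE := (dotvDl, dotvDr, dotvNl, dotvNr, dotvZl, dotvZr).

Lemma dotv_sqrB k (u v : 'cV[R]_k) (s : R) :
  dotv (u - s *: v) (u - s *: v) = dotv u u - 2 * s * dotv u v + s ^+ 2 * dotv v v.
Proof. by rewrite !dotvE (dotvC v u); ring. Qed.

Lemma dotv_suml k (I : Type) (s : seq I) (Q : pred I) (F : I -> 'cV[R]_k) v :
  dotv (\sum_(i <- s | Q i) F i) v = \sum_(i <- s | Q i) dotv (F i) v.
Proof.
by elim/big_rec2: _ => [|i y z _ <-]; rewrite ?dotv0l ?dotvDl.
Qed.

Lemma dotv_sumr k (I : Type) (s : seq I) (Q : pred I) (F : I -> 'cV[R]_k) v :
  dotv v (\sum_(i <- s | Q i) F i) = \sum_(i <- s | Q i) dotv v (F i).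
Proof. by rewrite dotvC dotv_suml; apply: eq_bigr => i _; rewrite dotvC. Qed.

Lemma dotv_ge0 k (v : 'cV[R]_k) : 0 <= dotv v v.
Proof. by apply: sumr_ge0 => j _; rewrite -expr2 sqr_ge0. Qed.

Lemma enormE k (v : 'cV[R]_k) : enorm v = Num.sqrt (dotv v v).
Proof. by congr Num.sqrt; apply: eq_bigr => j _; rewrite expr2. Qed.

Lemma enorm_ge0 k (v : 'cV[R]_k) : 0 <= enorm v.
Proof. exact: sqrtr_ge0. Qed.
Hint Resolve enorm_ge0 : core.

Lemma sqr_enorm k (v : 'cV[R]_k) : enorm v ^+ 2 = dotv v v.
Proof. by rewrite enormE sqr_sqrtr // dotv_ge0. Qed.

Lemma enorm0 k : enorm (0 : 'cV[R]_k) = 0.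
Proof. by rewrite enormE dotv0l sqrtr0. Qed.

Lemma enormZ k (a : R) (v : 'cV[R]_k) : enorm (a *: v) = `|a| * enorm v.
Proof.
by rewrite !enormE dotvZl dotvZr mulrA -expr2 sqrtrM ?sqr_ge0 // sqrtr_sqr.
Qed.

Lemma enormN k (v : 'cV[R]_k) : enorm (- v) = enorm v.
Proof. by rewrite -scaleN1r enormZ normrN1 mul1r. Qed.

Lemma enormBC k (u v : 'cV[R]_k) : enorm (u - v) = enorm (v - u).
Proof. by rewrite -enormN opprB. Qed.

Lemma enorm_le k (v : 'cV[R]_k) (c : R) :
  0 <= c -> dotv v v <= c ^+ 2 -> enorm v <= c.
Proof. by move=> c0 h; rewrite -(ler_pXn2r (n := 2)) ?nnegrE // sqr_enorm. Qed.

Lemma coord_le_enorm k (v : 'cV[R]_k) j : `|v j 0| <= enorm v.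
Proof.
rewrite -sqrtr_sqr enormE ler_wsqrtr // expr2 /dotv (bigD1 j) //= lerDl.
by apply: sumr_ge0 => i _; rewrite -expr2 sqr_ge0.
Qed.

Lemma enorm_eq0 k (v : 'cV[R]_k) : enorm v = 0 -> v = 0.
Proof.
move=> v0; apply/colP => j; rewrite mxE; apply/eqP.
by rewrite -normr_le0 -v0 coord_le_enorm.
Qed.

Lemma cauchy_schwarz k (u v : 'cV[R]_k) : `|dotv u v| <= enorm u * enorm v.
Proof.
have [v0|/eqP v0] := eqVneq (enorm v) 0.
  by rewrite (enorm_eq0 v0) dotv0r normr0 mulr_ge0.
have vp : 0 < dotv v v by rewrite -sqr_enorm exprn_even_gt0 //; apply/eqP.
rewrite -(ler_pXn2r (n := 2)) ?nnegrE ?mulr_ge0 // exprMn !sqr_enorm real_normK ?num_real //.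
have := dotv_ge0 (dotv v v *: u - dotv u v *: v).
rewrite !dotvE (dotvC v u).
set a := dotv u u; set b := dotv u v; set c := dotv v v => h.
have : 0 <= c * (a * c - b ^+ 2) by move: h; lra.
by rewrite pmulr_rge0 // subr_ge0.
Qed.

Lemma dotv_le k (u v : 'cV[R]_k) : dotv u v <= enorm u * enorm v.
Proof. exact: le_trans (ler_norm _) (cauchy_schwarz _ _). Qed.

Lemma enormD k (u v : 'cV[R]_k) : enorm (u + v) <= enorm u + enorm v.
Proof.
apply: enorm_le; first by rewrite addr_ge0.
rewrite !dotvE (dotvC v u) sqrrD !sqr_enorm.
by have := dotv_le u v; lra.
Qed.

Lemma enormB k (u v : 'cV[R]_k) : enorm (u - v) <= enorm u + enorm v.
Proof. by rewrite -(enormN v) enormD. Qed.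

Lemma enorm_triangle k (u v w : 'cV[R]_k) :
  enorm (u - w) <= enorm (u - v) + enorm (v - w).
Proof. by rewrite -[u - w](_ : u - v + (v - w) = _) ?enormD // addrA subrK. Qed.

Lemma enorm_sum k (I : Type) (s : seq I) (Q : pred I) (F : I -> 'cV[R]_k) :
  enorm (\sum_(i <- s | Q i) F i) <= \sum_(i <- s | Q i) enorm (F i).
Proof.
elim/big_rec2: _ => [|i y z _ h]; first by rewrite enorm0.
by apply: le_trans (enormD _ _) _; rewrite lerD2l.
Qed.

Lemma enorm_bounded_coord k (v : 'cV[R]_k) (c : R) : 0 <= c ->
  (forall j, `|v j 0| <= c) -> enorm v <= Num.sqrt k%:R * c.
Proof.
move=> c0 h; apply: enorm_le; first by rewrite mulr_ge0 ?sqrtr_ge0.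
rewrite exprMn sqr_sqrtr ?ler0n //.
rewrite -[k in k%:R]card_ord -sum1_card natr_sum mulr_suml.
by apply: ler_sum => j _; rewrite mul1r -expr2 -real_normK ?num_real // ler_pXn2r ?nnegrE.
Qed.

Lemma dotv_abs_sum_le k (v : 'cV[R]_k) : \sum_j `|v j 0| <= Num.sqrt k%:R * enorm v.
Proof.
have -> : \sum_j `|v j 0| = dotv (\col_j 1) (\col_j `|v j 0|).
  by apply: eq_bigr => j _; rewrite !mxE mul1r.
apply: le_trans (dotv_le _ _) _; apply: ler_pM => //.
  rewrite -[leRHS]mulr1; apply: enorm_bounded_coord => // j.
  by rewrite mxE normr1.
rewrite /enorm le_eqVlt; apply/orP; left; apply/eqP; congr Num.sqrt.
by apply: eq_bigr => j _; rewrite mxE real_normK ?num_real.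
Qed.

Lemma mxnorm_le_enorm k (v : 'cV[R]_k) : `|v| <= enorm v.
Proof.
rewrite [leLHS]/Num.Def.normr /= mx_normrE; apply/bigmax_leP; split=> // -[i j] _ /=.
by rewrite (ord1 j) coord_le_enorm.
Qed.

Lemma coord_le_mxnorm k (v : 'cV[R]_k) j : `|v j 0| <= `|v|.
Proof. by rewrite [leRHS]/Num.Def.normr /= mx_normrE; apply/bigmax_geP; right; exists (j, 0). Qed.

Lemma enorm_le_mxnorm k (v : 'cV[R]_k) : enorm v <= Num.sqrt k%:R * `|v|.
Proof. by apply: enorm_bounded_coord => // j; exact: coord_le_mxnorm. Qed.

End EuclideanSpace.
#[export] Hint Extern 0 (is_true (0 <= enorm _)) => solve [apply: enorm_ge0] : core.

(** * Nearest points of convex sets *)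

Section ConvexSets.
Context {R : realType}.

Lemma convex_setE k (K : set 'cV[R]_k) (x y : 'cV[R]_k) (a : R) :
  convex_set (K : set (convex_lmodType 'cV[R]_k)) ->
  0 <= a -> a <= 1 -> K x -> K y -> K (a *: x + (1 - a) *: y).
Proof.
move=> cK a0 a1 Kx Ky.
have := cK x y (Itv01 a0 a1); rewrite !inE => /(_ Kx Ky).
by [].
Qed.

Lemma convex_functionE k (K : set 'cV[R]_k) (phi : 'cV[R]_k -> R) (x y : 'cV[R]_k) (a : R) :
  convex_function (K : set (convex_lmodType 'cV[R]_k)) phi ->
  0 <= a -> a <= 1 -> K x -> K y ->
  phi (a *: x + (1 - a) *: y) <= a * phi x + (1 - a) * phi y.
Proof.
move=> cphi a0 a1 Kx Ky.
have := cphi (Itv01 a0 a1) x y; rewrite !inE => /(_ Kx Ky).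
by [].
Qed.

(** The topology of matrices comes from the sup norm, which the Euclidean norm
    dominates up to the factor [Num.sqrt k%:R]. *)
Lemma enorm_lipschitz_continuous k (phi : 'cV[R]_k -> R) (G : R) :
  (forall x y, `|phi x - phi y| <= G * enorm (x - y)) -> continuous phi.
Proof.
move=> lip x s /(nbhs_ballP (phi x))[e /= e0 es].
have c0 : 0 < `|G| * Num.sqrt k%:R + 1 by rewrite ltr_wpDl // mulr_ge0 ?sqrtr_ge0.
apply/nbhs_ballP; exists (e / (`|G| * Num.sqrt k%:R + 1)) => /=; first by rewrite divr_gt0.
move=> y; rewrite mx_norm_ball /= => xy; apply: es => /=.
rewrite -ball_normE /=; apply: le_lt_trans (lip x y) _.
apply: (@le_lt_trans _ _ (`|G| * (Num.sqrt k%:R * `|x - y|))).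
  apply: (@le_trans _ _ (`|G| * enorm (x - y))); first by apply: ler_wpM2r; [exact: enorm_ge0|exact: ler_norm].
  by apply: ler_wpM2l => //; exact: enorm_le_mxnorm.
move: xy; rewrite ltr_pdivlMr // => h; rewrite mulrA.
by apply: le_lt_trans h; rewrite mulrC ler_wpM2l // lerDl.
Qed.

Lemma bounded_closed_compact_cV k (K : set 'cV[R]_k) (M : R) :
  (forall x, K x -> enorm x <= M) -> closed K -> compact K.
Proof.
move=> bK cK.
have ctr : continuous (@trmx R 1 k).
  move=> x s /= /nbhs_ballP[e e0 es]; apply/nbhs_ballP; exists e => //= y [_ xy].
  by apply: es; split => // i j; rewrite !mxE.
have ctr' : continuous (@trmx R k 1).
  move=> x s /= /nbhs_ballP[e e0 es]; apply/nbhs_ballP; exists e => //= y [_ xy].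
  by apply: es; split => // i j; rewrite !mxE.
have -> : K = trmx @` [set v : 'rV[R]_k | K v^T].
  apply/seteqP; split => [x Kx|_ [v Kv <-] //].
  by exists x^T => /=; rewrite ?trmxK.
apply: continuous_compact; first exact: continuous_subspaceT.
apply: bounded_closed_compact; last first.
  by apply: closed_comp => // x _; exact: ctr.
exists M; split; rewrite ?num_real // => x Mx v /= Kv.
apply: le_trans (ltW Mx); apply: le_trans (bK _ Kv).
apply: le_trans (mxnorm_le_enorm _).
rewrite [leLHS]/Num.Def.normr [leRHS]/Num.Def.normr /= !mx_normrE.
apply/bigmax_leP; split=> [|[i j] _]; first by apply/bigmax_geP; left.
by apply/bigmax_geP; right; exists (j, i) => //; rewrite mxE.
Qed.

Lemma enorm_dist_lipschitz k (z x y : 'cV[R]_k) :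
  `|enorm (z - x) - enorm (z - y)| <= 1 * enorm (x - y).
Proof.
rewrite mul1r ler_norml; apply/andP; split.
  by rewrite lerNl opprB lerBlDr [leRHS]addrC enorm_triangle.
by rewrite lerBlDr [leRHS]addrC (enormBC x y) enorm_triangle.
Qed.

Lemma nearest_point_exists k (K : set 'cV[R]_k) (M : R) (z : 'cV[R]_k) :
  K !=set0 -> (forall x, K x -> enorm x <= M) -> closed K ->
  exists y : 'cV[R]_k, K y /\ forall y', K y' -> enorm (z - y) <= enorm (z - y').
Proof.
move=> K0 bK cK.
have [|y] := compact_EVT_min K0 (bounded_closed_compact_cV bK cK) (f := fun y : 'cV[R]_k => enorm (z - y)).
  apply: continuous_subspaceT.
  by apply: enorm_lipschitz_continuous => x y; exact: enorm_dist_lipschitz.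
by rewrite inE => Ky hy; exists y; split => // y' Ky'; apply: hy; rewrite inE.
Qed.

Definition nearest k (K : set 'cV[R]_k) (z y : 'cV[R]_k) :=
  K y /\ forall y', K y' -> enorm (z - y) <= enorm (z - y').

Lemma euclid_proj_nearest k (K : set 'cV[R]_k) (z : 'cV[R]_k) :
  (exists y, nearest K z y) -> nearest K z (euclid_proj K z).
Proof. by move=> [y hy]; exact: (@xgetI _ 0 _ y hy). Qed.

(** First-order optimality: moving from the nearest point towards any other
    point of a convex set cannot decrease the squared distance, so the
    derivative of that quadratic function at 0 is nonnegative. *)
Lemma nearest_variational k (K : set 'cV[R]_k) (z y v : 'cV[R]_k) :
  convex_set (K : set (convex_lmodType 'cV[R]_k)) ->
  nearest K z y -> K v -> dotv (z - y) (v - y) <= 0.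
Proof.
move=> cK [Ky hy] Kv; rewrite leNgt; apply/negP => h.
set a := dotv (z - y) (v - y) in h; set b := dotv (v - y) (v - y).
have b0 : 0 <= b by exact: dotv_ge0.
(* A step at which the gain of first order outweighs the quadratic term. *)
pose s := a / (a + b).
have ab : 0 < a + b by rewrite ltr_wpDr.
have s0 : 0 < s by rewrite divr_gt0.
have s1 : s <= 1 by rewrite ler_pdivrMr // mul1r lerDl.
have hle : enorm (z - y) ^+ 2 <= enorm (z - (s *: v + (1 - s) *: y)) ^+ 2.
  by rewrite ler_pXn2r ?nnegrE //; exact: hy _ (convex_setE cK (ltW s0) s1 Kv Ky).
move: hle; rewrite !sqr_enorm.
have -> : z - (s *: v + (1 - s) *: y) = (z - y) - s *: (v - y).
  by apply/colP => j; rewrite !mxE; ring.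
rewrite dotv_sqrB -/a -/b.
have sab : s * (a + b) = a by rewrite divfK // gt_eqF.
have : 0 < s * a by rewrite mulr_gt0.
by nra.
Qed.

Lemma nearest_unique k (K : set 'cV[R]_k) (z y y' : 'cV[R]_k) :
  convex_set (K : set (convex_lmodType 'cV[R]_k)) ->
  nearest K z y -> nearest K z y' -> y = y'.
Proof.
move=> cK hy hy'; apply/subr0_eq/enorm_eq0/eqP.
rewrite -sqrf_eq0 eq_le sqr_ge0 sqr_enorm andbT.
have := nearest_variational cK hy hy'.1; have := nearest_variational cK hy' hy.1.
by rewrite !dotvE !(dotvC y' y); lra.
Qed.

Lemma nearest_nonexpansive k (K : set 'cV[R]_k) (z z' y y' : 'cV[R]_k) :
  convex_set (K : set (convex_lmodType 'cV[R]_k)) ->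
  nearest K z y -> nearest K z' y' -> enorm (y - y') <= enorm (z - z').
Proof.
move=> cK hy hy'.
have h1 := nearest_variational cK hy hy'.1; have h2 := nearest_variational cK hy' hy.1.
have h : enorm (y - y') ^+ 2 <= enorm (z - z') * enorm (y - y').
  apply: le_trans (dotv_le _ _); rewrite sqr_enorm.
  by move: h1 h2; rewrite !dotvE !(dotvC y' y); lra.
have := enorm_ge0 (y - y'); rewrite le_eqVlt => /orP[/eqP <- //|y0].
by rewrite -(ler_pM2r y0) -expr2.
Qed.

Lemma convex_orthant k :
  convex_set ([set y : 'cV[R]_k | forall j, 0 <= y j 0] : set (convex_lmodType 'cV[R]_k)).
Proof.
move=> x y t; rewrite !inE => hx hy j.
rewrite !mxE; apply: addr_ge0; apply: mulr_ge0 => //.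
by rewrite subr_ge0.
Qed.

Lemma nearest_orthant k (z : 'cV[R]_k) :
  nearest [set y : 'cV[R]_k | forall j, 0 <= y j 0] z (\col_j Num.max 0 (z j 0)).
Proof.
split=> [j|y hy]; first by rewrite mxE le_max lexx.
rewrite /enorm ler_wsqrtr //; apply: ler_sum => j _.
rewrite !mxE -[leLHS]real_normK ?num_real // -[leRHS]real_normK ?num_real //.
rewrite ler_pXn2r ?nnegrE //; have := hy j.
case: (leP 0 (z j 0)) => zj yj; first by rewrite subrr normr0.
have -> : `|z j 0 - 0| = - z j 0 by rewrite subr0 ltr0_norm.
have -> : `|z j 0 - y j 0| = - (z j 0 - y j 0) by rewrite ltr0_norm //; lra.
by lra.
Qed.

Lemma pospartE k (z : 'cV[R]_k) : pospart z = \col_j Num.max 0 (z j 0).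
Proof.
apply: nearest_unique (nearest_orthant z); first exact: convex_orthant.
by apply: euclid_proj_nearest; exists (\col_j Num.max 0 (z j 0)); exact: nearest_orthant.
Qed.

Lemma nearest_pospart k (z : 'cV[R]_k) :
  nearest [set y : 'cV[R]_k | forall j, 0 <= y j 0] z (pospart z).
Proof. by rewrite pospartE; exact: nearest_orthant. Qed.

Lemma pospart_ge0 k (z : 'cV[R]_k) j : 0 <= pospart z j 0.
Proof. by rewrite pospartE mxE le_max lexx. Qed.

Lemma pospart_id k (z : 'cV[R]_k) : (forall j, 0 <= z j 0) -> pospart z = z.
Proof. by move=> h; apply/colP => j; rewrite pospartE mxE; apply/max_idPr. Qed.

Lemma pospart_lipschitz k (z z' : 'cV[R]_k) :
  enorm (pospart z - pospart z') <= enorm (z - z').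
Proof.
by apply: (nearest_nonexpansive (@convex_orthant k)); exact: nearest_pospart.
Qed.

Lemma enorm_pospart_le k (z : 'cV[R]_k) : enorm (pospart z) <= enorm z.
Proof.
have := pospart_lipschitz z 0; rewrite (@pospart_id _ 0) ?subr0 // => j.
by rewrite mxE.
Qed.

Lemma dotv_pospart k (z : 'cV[R]_k) : dotv (pospart z) z = enorm (pospart z) ^+ 2.
Proof.
rewrite sqr_enorm; apply: eq_bigr => j _; rewrite pospartE mxE.
by case: (leP 0 (z j 0)) => // _; rewrite !mul0r.
Qed.

Lemma convex_scale_set k (K : set 'cV[R]_k) (c : R) :
  convex_set (K : set (convex_lmodType 'cV[R]_k)) ->
  convex_set (scale_set c K : set (convex_lmodType 'cV[R]_k)).
Proof.
move=> cK x y t; rewrite !inE => -[x' Kx' <-] [y' Ky' <-].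
exists (t%:num *: x' + (1 - t%:num) *: y'); first exact: convex_setE.
apply: (@etrans _ _ (t%:num *: (c *: x') + (1 - t%:num) *: (c *: y'))); last by [].
by rewrite scalerDr !scalerA !(mulrC c).
Qed.

Lemma closed_scale_set k (K : set 'cV[R]_k) (c : R) :
  0 < c -> closed K -> closed (scale_set c K).
Proof.
move=> c0 clK.
have -> : scale_set c K = [set x | K (c^-1 *: x)].
  apply/seteqP; split => [_ [x Kx <-]/=|x /= Kx].
    by rewrite scalerA mulVf ?scale1r // gt_eqF.
  by exists (c^-1 *: x) => //; rewrite scalerA divff ?scale1r // gt_eqF.
by apply: closed_comp => // x _; exact: scaler_continuous.
Qed.

End ConvexSets.

(** * Sums of powers *)

Section PowerSums.
Context {R : realType}.

(** From [ln z <= z - 1] at [z = y / M] and at [z = M^-1], with [M] the right-hand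
    side: weighted by [e] and [1 - e], the two bounds add up to 0. *)
Lemma powR_bernoulli (y e : R) : 0 < y -> 0 < e -> e <= 1 -> y `^ e <= 1 + e * (y - 1).
Proof.
move=> y0 e0 e1; set M := 1 + e * (y - 1).
have M0 : 0 < M.
  have : 0 < e * y by rewrite mulr_gt0.
  by rewrite /M; lra.
have lnle (z : R) : 0 < z -> ln z <= z - 1.
  move=> z0; have := @le_ln1Dx R (z - 1); rewrite [1 + _]addrC subrK; apply.
  by lra.
rewrite -[leRHS](lnK (x := M)) ?posrE // /powR gt_eqF // ler_expR.
have h1 := lnle (y / M) (divr_gt0 y0 M0).
have h2 := lnle M^-1; rewrite invr_gt0 in h2; have {}h2 := h2 M0.
rewrite ln_div ?posrE // in h1; rewrite lnV ?posrE // in h2.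
have h3 : e * (y / M - 1) + (1 - e) * (M^-1 - 1) = 0.
  by rewrite /M; field; rewrite -/M gt_eqF.
have : e * (ln y - ln M) <= e * (y / M - 1) by rewrite ler_wpM2l // ltW.
have : (1 - e) * (- ln M) <= (1 - e) * (M^-1 - 1) by rewrite ler_wpM2l // subr_ge0.
by lra.
Qed.

(** Mean value bound for the concave power: each term of the sum is at most the
    increment of [s `^ e / e]. *)
Lemma powR_increment (t : nat) (e : R) : 0 < e -> e <= 1 ->
  e * (t.+1%:R `^ (e - 1)) <= t.+1%:R `^ e - t%:R `^ e.
Proof.
move=> e0 e1.
have T0 : 0 < t.+1%:R :> R by rewrite ltr0n.
have hp : t.+1%:R `^ e = t.+1%:R `^ (e - 1) * t.+1%:R :> R.
  have := @powRD R t.+1%:R (e - 1) 1; rewrite subrK powRr1 ?ler0n // => -> //.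
  by rewrite pnatr_eq0 implybT.
case: t T0 hp => [_ _|t T0 hp].
  by rewrite powR0 ?gt_eqF // !powR1 subr0 mulr1.
set T := t.+2%:R in T0 hp *.
have hT : t.+1%:R = T * (t.+1%:R / T) :> R by rewrite mulrC divfK ?gt_eqF.
have q0 : 0 < t.+1%:R / T by rewrite divr_gt0 // ltr0n.
have h := powR_bernoulli q0 e0 e1.
have hTe : t.+1%:R `^ e = T `^ e * (t.+1%:R / T) `^ e by rewrite {1}hT powRM // ltW.
have : T `^ e * (t.+1%:R / T) `^ e <= T `^ e * (1 + e * (t.+1%:R / T - 1)).
  by rewrite ler_wpM2l // powR_ge0.
have -> : T `^ e * (1 + e * (t.+1%:R / T - 1)) = T `^ e - e * T `^ (e - 1).
  have -> : t.+1%:R = T - 1 by rewrite /T -[t.+2]addn1 natrD addrK.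
  by rewrite hp; field.
by lra.
Qed.

Lemma sum_powR (e : R) (T : nat) : 0 < e -> e <= 1 ->
  \sum_(1 <= t < T.+1) (t%:R `^ (e - 1)) <= T%:R `^ e / e.
Proof.
move=> e0 e1; elim: T => [|T IH].
  by rewrite big_nil divr_ge0 ?powR_ge0 // ltW.
rewrite big_nat_recr //=.
have h := powR_increment T e0 e1.
have : T.+1%:R `^ (e - 1) <= (T.+1%:R `^ e - T%:R `^ e) / e by rewrite ler_pdivlMr // mulrC.
by rewrite mulrBl; move: IH; lra.
Qed.

Lemma powRS_le (t : nat) (e : R) : (0 < t)%N -> e <= 0 -> t.+1%:R `^ e <= t%:R `^ e.
Proof.
move=> t0 e0; have -> : e = - (- e) by rewrite opprK.
rewrite !(powRN _ (- e)) lef_pV2 ?posrE ?powR_gt0 ?ltr0n //.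
by rewrite ge0_ler_powR ?nnegrE ?ler0n ?ler_nat // oppr_ge0.
Qed.

Lemma sum_powRS (e : R) (T : nat) : 0 < e -> e <= 1 ->
  \sum_(1 <= t < T.+1) (t.+1%:R `^ (e - 1)) <= T%:R `^ e / e.
Proof.
move=> e0 e1; apply: le_trans (sum_powR T e0 e1).
rewrite !big_nat; apply: ler_sum => t /andP[t0 _]; apply: powRS_le => //.
by rewrite subr_le0.
Qed.

(** From the third term on, the factor [3 / t] is at most 1; the second term,
    the only larger one, is paid for by the first one, which is 0 here. *)
Lemma sum_powRS_div (e : R) (T : nat) : 0 < e -> e <= 1 ->
  \sum_(1 <= t < T.+1) (if t == 1%N then 0 else 3 * t.+1%:R `^ (e - 1) / t%:R)
    <= T%:R `^ e / e.
Proof.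
move=> e0 e1; apply: le_trans (sum_powR T e0 e1).
pose w t : R := if t == 1%N then 0 else 3 * t.+1%:R `^ (e - 1) / t%:R.
rewrite -/w; case: T => [|[|T]]; first by rewrite !big_nil.
  by rewrite !big_nat1 /w eqxx powR_ge0.
rewrite (big_nat_recl T.+2) // (big_nat_recl T.+1) // [leRHS](big_nat_recl T.+2) // [X in _ <= _ + X](big_nat_recl T.+1) // !addrA.
apply: lerD.
  rewrite /w /= add0r powR1.
  have h := @powRS_le 2 (e - 1) isT; have {}h := h ltac:(by lra).
  have h2 : 2 `^ (e - 1) <= 1 :> R.
    by have := @powRS_le 1 (e - 1) isT; rewrite powR1; apply; lra.
  by lra.
rewrite !big_nat; apply: ler_sum => t /andP[t1 _]; rewrite /w /=.
have t3 : 3 <= t.+2%:R :> R by rewrite ler_nat !ltnS.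
rewrite ler_pdivrMr ?ltr0n // [leRHS]mulrC; apply: ler_pM; [by rewrite ler0n|exact: powR_ge0|exact: t3|].
by apply: powRS_le => //; rewrite subr_le0.
Qed.

End PowerSums.

(** * Disagreement under doubly stochastic averaging *)

Lemma sum_cst_ord {R : realType} (n : nat) (c : R) : \sum_(i < n) c = n%:R * c.
Proof. by rewrite sumr_const card_ord mulr_natl. Qed.

Section Disagreement.
Context {R : realType} {n : nat}.
Implicit Types (v : 'I_n -> R) (A : 'M[R]_n).

Definition mean v : R := (\sum_i v i) / n%:R.
Definition dev2 v : R := \sum_i (v i - mean v) ^+ 2.
Definition mix A v : 'I_n -> R := fun i => \sum_j A i j * v j.

Lemma dev2_ge0 v : 0 <= dev2 v.
Proof. by apply: sumr_ge0 => i _; exact: sqr_ge0. Qed.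

(** The parallel axis identity: the mean minimizes the sum of squared distances. *)
Lemma sum_sqr_shift (v : 'I_n -> R) (c : R) : (0 < n)%N ->
  \sum_i (v i - c) ^+ 2 = dev2 v + n%:R * (mean v - c) ^+ 2.
Proof.
move=> n0; have nn0 : n%:R != 0 :> R by rewrite pnatr_eq0 -lt0n.
have hm : \sum_i v i = n%:R * mean v by rewrite mulrC divfK.
have key d : \sum_i (v i - d) ^+ 2 = \sum_i v i ^+ 2 - 2 * d * (n%:R * mean v) + n%:R * d ^+ 2.
  rewrite -hm mulr_sumr -(sum_cst_ord n) -sumrB -big_split.
  by apply: eq_bigr => i _ /=; ring.
by rewrite /dev2 !key; ring.
Qed.

Lemma dev2_le_range v (lo hi : R) : (0 < n)%N -> (forall i, lo <= v i <= hi) ->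
  dev2 v <= n%:R * ((hi - lo) / 2) ^+ 2.
Proof.
move=> n0 h; pose c := (lo + hi) / 2.
have hs := sum_sqr_shift v c n0.
have : 0 <= n%:R * (mean v - c) ^+ 2 by rewrite mulr_ge0 // sqr_ge0.
have : \sum_i (v i - c) ^+ 2 <= n%:R * ((hi - lo) / 2) ^+ 2.
  rewrite -(sum_cst_ord n); apply: ler_sum => i _.
  by have /andP[h1 h2] := h i; rewrite /c; nra.
by lra.
Qed.

Lemma mean_mix A v : doubly_stochastic A -> mean (mix A v) = mean v.
Proof.
move=> [_ _ hc]; rewrite /mean /mix; congr (_ / _); rewrite exchange_big /=.
by apply: eq_bigr => j _; rewrite -mulr_suml hc mul1r.
Qed.

(** Averaging with a doubly stochastic matrix lowers the disagreement by the
    sum over the rows of the variance of [v] under the weights of that row. *)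
Lemma dev2_mix A v : doubly_stochastic A ->
  dev2 (mix A v) = dev2 v - \sum_i \sum_j A i j * (v j - mix A v i) ^+ 2.
Proof.
move=> dA; have [n0|n0] := posnP n.
  by rewrite /dev2 !big1 ?subr0 // => -[i hi]; exfalso; move: hi; rewrite n0.
have [_ hr hc] := dA.
have hvar i : \sum_j A i j * (v j - mix A v i) ^+ 2 = \sum_j A i j * v j ^+ 2 - mix A v i ^+ 2.
  set mu := mix A v i.
  have -> : \sum_j A i j * (v j - mu) ^+ 2 =
      \sum_j A i j * v j ^+ 2 - 2 * mu * (\sum_j A i j * v j) + (\sum_j A i j) * mu ^+ 2.
    rewrite mulr_sumr mulr_suml -sumrB -big_split; apply: eq_bigr => j _ /=; ring.
  by rewrite hr -/(mix A v i) -/mu; ring.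
rewrite (eq_bigr _ (fun i _ => hvar i)) sumrB exchange_big /=.
under [X in _ - (X - _)]eq_bigr do rewrite -mulr_suml hc mul1r.
have h1 := sum_sqr_shift v 0 n0; have h2 := sum_sqr_shift (mix A v) 0 n0.
rewrite mean_mix // in h2.
rewrite (eq_bigr (fun i => v i ^+ 2)) in h1; last by move=> i _; rewrite subr0.
rewrite (eq_bigr (fun i => mix A v i ^+ 2)) in h2; last by move=> i _; rewrite subr0.
by rewrite h1 h2; ring.
Qed.

Lemma dev2_mix_le A v : doubly_stochastic A -> dev2 (mix A v) <= dev2 v.
Proof.
move=> dA; rewrite dev2_mix // gerBl; have [h0 _ _] := dA.
by apply: sumr_ge0 => i _; apply: sumr_ge0 => j _; rewrite mulr_ge0 ?sqr_ge0.
Qed.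

(** If one row puts weight at least [w] on two values at distance [g], then
    wherever its average lies, these two values contribute [w * g ^+ 2 / 2] to
    the variance of that row. *)
Lemma dev2_mix_gap A v (w g : R) (i j : 'I_n) : doubly_stochastic A ->
  i != j -> 0 <= w -> w <= A i i -> w <= A i j -> 0 <= g -> g <= `|v i - v j| ->
  dev2 (mix A v) <= dev2 v - w / 2 * g ^+ 2.
Proof.
move=> dA ij w0 wi wj g0 gv; rewrite dev2_mix // lerD2l lerN2.
have [h0 _ _] := dA.
have hnn k l : 0 <= A k l * (v l - mix A v k) ^+ 2 by rewrite mulr_ge0 ?sqr_ge0.
rewrite (bigD1 i) //= (bigD1 i) //= (bigD1 j) 1?eq_sym //=.
set mu := mix A v i; set S := \sum_(_ | _) _; set S' := \sum_(_ | _) _.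
have S0 : 0 <= S by apply: sumr_ge0.
have S0' : 0 <= S' by apply: sumr_ge0 => k _; apply: sumr_ge0.
have gsq : g ^+ 2 <= (v i - v j) ^+ 2.
  by rewrite -[leRHS]real_normK ?num_real // ler_pXn2r ?nnegrE.
have h1 : w * (v i - mu) ^+ 2 <= A i i * (v i - mu) ^+ 2 by rewrite ler_wpM2r ?sqr_ge0.
have h2 : w * (v j - mu) ^+ 2 <= A i j * (v j - mu) ^+ 2 by rewrite ler_wpM2r ?sqr_ge0.
have h3 : w * ((v i - v j) ^+ 2 / 2) <= w * ((v i - mu) ^+ 2 + (v j - mu) ^+ 2).
  rewrite ler_wpM2l //; have := sqr_ge0 (v i + v j - 2 * mu); lra.
have h4 : w * g ^+ 2 <= w * (v i - v j) ^+ 2 by rewrite ler_wpM2l.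
by lra.
Qed.

Definition separated (S : pred 'I_n) (th g : R) v :=
  forall i, if S i then th + g <= v i else v i <= th.

(** Pigeonhole: the [n] half-open intervals of length [range / n] cannot each
    contain a value, since the smallest value lies in none of them. *)
Lemma gap_exists v (i0 i1 : 'I_n) : (forall i, v i0 <= v i <= v i1) -> v i0 < v i1 ->
  exists S th, [/\ separated S th ((v i1 - v i0) / n%:R) v, ~~ S i0 & S i1].
Proof.
move=> h lt01; have n0 : (0 < n)%N by apply: leq_ltn_trans (ltn_ord i0).
have nn0 : 0 < n%:R :> R by rewrite ltr0n.
set g := (v i1 - v i0) / n%:R.
have g0 : 0 < g by rewrite divr_gt0 // subr_gt0.
pose hit (k i : 'I_n) := (v i0 + k%:R * g < v i) && (v i <= v i0 + k.+1%:R * g).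
have [|] := boolP [forall k, exists i, hit k i].
  move=> /forallP hall.
  pose f k := xchoose (existsP (hall k)).
  have fP k : hit k (f k) := xchooseP (existsP (hall k)).
  have finj : injective f.
    suff main (k l : 'I_n) : (k < l)%N -> f k != f l.
      move=> k l /eqP; apply: contraTeq; rewrite neq_ltn => /orP[/main //|/main].
      by rewrite eq_sym.
    move=> kl; apply/eqP => fkl; have /andP[_ h1] := fP k; have /andP[h2 _] := fP l.
    move: h2; rewrite -fkl ltNge => /negP; apply; apply: le_trans h1 _.
    by rewrite lerD2l ler_pM2r // ler_nat.
  have [f' _ ff'] := injF_bij finj.
  have := fP (f' i0); rewrite /hit ff' => /andP[+ _].
  by rewrite ltNge lerDl mulr_ge0 ?ler0n ?ltW.
rewrite negb_forall => /existsP[k]; rewrite negb_exists => /forallP hk.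
exists (fun i => v i0 + k%:R * g < v i), (v i0 + k%:R * g).
have sep : separated (fun i => v i0 + k%:R * g < v i) (v i0 + k%:R * g) g v.
  move=> i; case: ltP => // hi; have := hk i; rewrite /hit hi /= -ltNge => /ltW.
  by rewrite -[k.+1]addn1 natrD mulrDl mul1r addrA.
split => //; first by rewrite -leNgt lerDl mulr_ge0 ?ler0n ?ltW.
rewrite -ltrBrDl -[ltRHS](divfK (lt0r_neq0 nn0)) -/g mulrC ltr_pM2l // ltr_nat.
exact: ltn_ord.
Qed.

(** Rows on one side of the gap average values of that side only. *)
Lemma separated_mix S th g A v : doubly_stochastic A ->
  (forall i j, S i != S j -> A i j = 0) -> separated S th g v -> separated S th g (mix A v).
Proof.
move=> [h0 hr _] hS sep i; rewrite /mix.
have hsum c : \sum_j A i j * c = c by rewrite -mulr_suml hr mul1r.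
case Si : (S i); [rewrite -[leLHS]hsum|rewrite -[leRHS]hsum]; apply: ler_sum => j _.
  have [Sj|/negPf Sj] := boolP (S j); last by rewrite hS ?mul0r ?Si ?Sj.
  by rewrite ler_wpM2l //; have := sep j; rewrite Sj.
have [Sj|/negPf Sj] := boolP (S j); first by rewrite hS ?mul0r ?Si ?Sj.
by rewrite ler_wpM2l //; have := sep j; rewrite Sj.
Qed.

End Disagreement.

(** * Contraction over a window of rounds *)

Section Consensus.
Context {R : realType} {n : nat}.
Variables (E : nat -> rel 'I_n) (W : nat -> 'M[R]_n) (w : R) (iota : nat).
Hypotheses (n_gt0 : (0 < n)%N) (mixW : mixing_matrices E W) (assA : assumptionA E W w iota).

Fixpoint mix_iter (t k : nat) (v : 'I_n -> R) : 'I_n -> R :=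
  if k is k'.+1 then mix_iter t.+1 k' (mix (W t) v) else v.

Lemma dev2_mix_iter_le t k v : (0 < t)%N -> dev2 (mix_iter t k v) <= dev2 v.
Proof.
elim: k t v => //= k IH t v t0; apply: le_trans (IH _ _ _) _ => //.
exact/dev2_mix_le/(A_stoch assA).
Qed.

Lemma weight_ge t i j : (0 < t)%N -> W t i j != 0 -> w <= W t i j.
Proof.
move=> t0 nz; apply: (A_lower assA) => //.
by have [h0 _ _] := A_stoch assA t0; rewrite lt0r nz h0.
Qed.

Lemma weight_diag t i : (0 < t)%N -> w <= W t i i.
Proof.
move=> t0; apply: (A_lower assA) => //; apply (mixW i i t0).1.
by rewrite eqxx orbT.
Qed.

(** As long as no weight joins [S] to its complement, both sides stay on their
    side of the gap; the first weight that joins them averages two values at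
    distance at least [g]. *)
Lemma dev2_crossing S th g t k v : (0 < t)%N -> 0 <= g -> separated S th g v ->
  (exists l i j, [/\ (l < k)%N, S i != S j & W (t + l)%N i j != 0]) ->
  dev2 (mix_iter t k v) <= dev2 v - w / 2 * g ^+ 2.
Proof.
move=> + g0; elim: k t v => [|k IH] t v t0 sep [l [i [j [lk Sij Wij]]]] //=.
have dW := A_stoch assA t0.
have [/existsP[a /existsP[b /andP[Sab Wab]]]|nocross] :=
    boolP [exists a, exists b, (S a != S b) && (W t a b != 0)].
  apply: le_trans (dev2_mix_iter_le _ _ _) _ => //.
  apply: (dev2_mix_gap (i := a) (j := b)) => //.
  - by apply: contraNneq Sab => ->.
  - by have /andP[/ltW] := A_w assA.
  - exact: weight_diag.
  - exact: weight_ge.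
  have := sep a; have := sep b; move: Sab; case: (S a); case: (S b) => // _.
    by move=> h1 h2; rewrite ger0_norm; lra.
  by move=> h1 h2; rewrite ler0_norm; lra.
have hS a b : S a != S b -> W t a b = 0.
  move=> Sab; apply/eqP; apply: contraNT nocross => Wab.
  by apply/existsP; exists a; apply/existsP; exists b; rewrite Sab.
case: l lk Wij => [|l] lk Wij; first by rewrite addn0 hS ?eqxx in Wij.
apply: le_trans (IH _ _ _ (separated_mix dW hS sep) _) _ => //.
  by exists l, i, j; rewrite addSnnS.
by rewrite lerD2r; exact: dev2_mix_le.
Qed.

Lemma connect_crossing (e : rel 'I_n) (S : pred 'I_n) i j :
  connect e i j -> S i -> ~~ S j -> exists a b, [/\ S a, ~~ S b & e a b].
Proof.
move=> /connectP[s]; elim: s i => [|a s IH] i /=; first by move=> _ -> ->.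
move=> /andP[eia pas] ej Si Sj.
have [Sa|Sa] := boolP (S a); first exact: IH pas ej Sa Sj.
by exists i, a.
Qed.

(** The factor per window for the norm of the disagreement; its square is at least
    [1 - 2 * w / n ^ 3], the factor for the squared norm. *)
Definition contraction : R := 1 - w / n%:R ^+ 3.

Lemma w_bounds : 0 < w < 1. Proof. exact: A_w assA. Qed.

Lemma contraction_bounds : 0 <= contraction < 1.
Proof.
have /andP[w0 w1] := w_bounds; have n3 : 1 <= n%:R ^+ 3 :> R.
  by rewrite exprn_ege1 // ler1n.
have h0 : 0 < w / n%:R ^+ 3 by rewrite divr_gt0 // (lt_le_trans ltr01).
have h1 : w / n%:R ^+ 3 <= 1 by rewrite ler_pdivrMr ?mul1r ?(lt_le_trans ltr01) //; lra.
by rewrite /contraction; apply/andP; split; lra.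
Qed.

(** The values leave a gap of at least [range / n] somewhere. Since the graph over
    the window is strongly connected, some weight of the window crosses this gap
    and takes away [w / 2 * (range / n) ^+ 2], while [dev2 v] is at most
    [n * (range / 2) ^+ 2]. *)
Lemma dev2_window t v : (0 < t)%N ->
  dev2 (mix_iter t iota v) <= contraction ^+ 2 * dev2 v.
Proof.
move=> t0; have /andP[w0 w1] := w_bounds.
have nR : 0 < n%:R :> R by rewrite ltr0n.
have hrho : (1 - 2 * (w / n%:R ^+ 3)) * dev2 v <= contraction ^+ 2 * dev2 v.
  by rewrite ler_wpM2r ?dev2_ge0 // /contraction; have := sqr_ge0 (w / n%:R ^+ 3); lra.
apply: le_trans hrho.
pose i00 : 'I_n := Ordinal n_gt0.
have [i0 _ hi0] := @arg_minP _ _ _ i00 xpredT v isT.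
have [i1 _ hi1] := @arg_maxP _ _ _ i00 xpredT v isT.
have hv i : v i0 <= v i <= v i1 by apply/andP; split; [exact: hi0|exact: hi1].
have := dev2_le_range n_gt0 hv; set rg := v i1 - v i0 => hd.
have [lt01|le10] := ltP (v i0) (v i1); last first.
  have rg0 : rg = 0 by apply/eqP; rewrite subr_eq0 eq_le le10; have /andP[-> ] := hv i1.
  have d0 : dev2 v = 0.
    by apply/eqP; rewrite eq_le dev2_ge0 andbT (le_trans hd) // rg0 mul0r expr0n mulr0.
  by rewrite d0 mulr0 -d0; exact: dev2_mix_iter_le.
have [S [th [sep Si0 Si1]]] := gap_exists hv lt01.
have rg0 : 0 <= rg / n%:R by rewrite divr_ge0 ?ltW // subr_gt0.
apply: le_trans (dev2_crossing t0 rg0 sep _) _.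
  have [a [b [Sa Sb /existsP[l Eab]]]] := connect_crossing (A_connected assA t0 i1 i0) Si1 Si0.
  exists l, b, a; split; rewrite ?ltn_ord //; first by rewrite Sa (negPf Sb).
  have tl0 : (0 < t + l)%N by rewrite addn_gt0 t0.
  by rewrite gt_eqF //; apply (mixW b a tl0).1; rewrite Eab.
have : w / 2 * (4 * (dev2 v / n%:R)) / n%:R ^+ 2 <= w / 2 * (rg / n%:R) ^+ 2.
  have -> : w / 2 * (rg / n%:R) ^+ 2 = w / 2 * rg ^+ 2 / n%:R ^+ 2 by rewrite expr_div_n mulrA.
  apply: ler_wpM2r; first by rewrite invr_ge0 exprn_ge0.
  apply: ler_wpM2l; first by rewrite divr_ge0 ?ltW.
  have : dev2 v / n%:R <= (rg / 2) ^+ 2 by rewrite ler_pdivrMr // mulrC.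
  by lra.
have -> : w / 2 * (4 * (dev2 v / n%:R)) / n%:R ^+ 2 = 2 * (w / n%:R ^+ 3) * dev2 v.
  by field; exact: lt0r_neq0.
by lra.
Qed.

End Consensus.

(** * Consensus of perturbed vectors *)

Lemma minkowski {R : realType} (I : finType) (f g : I -> R) :
  Num.sqrt (\sum_i (f i + g i) ^+ 2) <=
  Num.sqrt (\sum_i f i ^+ 2) + Num.sqrt (\sum_i g i ^+ 2).
Proof.
pose vec (h : I -> R) : 'cV[R]_#|I| := \col_j h (enum_val j).
have hE h : Num.sqrt (\sum_i h i ^+ 2) = enorm (vec h).
  rewrite /enorm; congr Num.sqrt; rewrite [LHS](reindex (fun j : 'I_#|I| => enum_val j)) /=.
    by apply: eq_bigr => j _; rewrite mxE.
  exact/onW_bij/enum_val_bij.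
rewrite (hE (fun i => f i + g i)) (hE f) (hE g); apply: le_trans (enormD _ _).
by rewrite (_ : vec _ = vec f + vec g) //; apply/colP => j; rewrite !mxE.
Qed.

Section VectorDisagreement.
Context {R : realType} {n m : nat}.
Implicit Types q : 'I_n -> 'cV[R]_m.

Definition vmean q : 'cV[R]_m := n%:R^-1 *: \sum_i q i.
Definition vmix (A : 'M[R]_n) q : 'I_n -> 'cV[R]_m := fun i => \sum_j A i j *: q j.
Definition vdev q : R := Num.sqrt (\sum_i enorm (q i - vmean q) ^+ 2).

Lemma vdevE q : vdev q = Num.sqrt (\sum_k dev2 (fun i => q i k 0)).
Proof.
congr Num.sqrt; rewrite exchange_big /=; apply: eq_bigr => i _.
rewrite sqr_enorm; apply: eq_bigr => k _.
by rewrite !mxE summxE -expr2 /mean mulrC.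
Qed.

Lemma vdev_ge0 q : 0 <= vdev q. Proof. exact: sqrtr_ge0. Qed.

Lemma vdevD q q' : vdev (fun i => q i + q' i) <= vdev q + vdev q'.
Proof.
have hE p : vdev p = Num.sqrt (\sum_(ik : 'I_n * 'I_m) ((p ik.1 - vmean p) ik.2 0) ^+ 2).
  congr Num.sqrt; rewrite -(pair_bigA _ (fun i k => ((p i - vmean p) k 0) ^+ 2)) /=.
  by apply: eq_bigr => i _; rewrite sqr_enorm; apply: eq_bigr => k _; rewrite expr2.
rewrite !hE; apply: le_trans (minkowski _ _); rewrite ler_wsqrtr //.
apply: ler_sum => ik _; rewrite le_eqVlt; apply/orP; left; apply/eqP; congr (_ ^+ 2).
by rewrite /vmean big_split /= scalerDr !mxE; ring.
Qed.

Lemma vdev0 : vdev (fun=> 0) = 0.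
Proof.
rewrite /vdev (_ : vmean _ = 0); last by rewrite /vmean big1 ?scaler0.
by rewrite big1 ?sqrtr0 // => i _; rewrite subr0 enorm0 expr0n.
Qed.

Lemma vdev_le q (e : R) : (0 < n)%N -> 0 <= e -> (forall i, enorm (q i) <= e) ->
  vdev q <= Num.sqrt n%:R * e.
Proof.
move=> n0 e0 h; rewrite -(ger0_norm e0) -sqrtr_sqr -sqrtrM ?ler0n // ler_wsqrtr //.
apply: (@le_trans _ _ (\sum_i enorm (q i) ^+ 2)); last first.
  by rewrite -(sum_cst_ord n); apply: ler_sum => i _; rewrite ler_pXn2r ?nnegrE.
have hq (p : 'I_n -> 'cV[R]_m) : \sum_i enorm (p i) ^+ 2 = \sum_k \sum_i (p i k 0) ^+ 2.
  rewrite exchange_big /=; apply: eq_bigr => i _; rewrite sqr_enorm.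
  by apply: eq_bigr => k _; rewrite expr2.
rewrite !hq; apply: ler_sum => k _.
have := sum_sqr_shift (fun i => q i k 0) 0 n0.
under eq_bigr do rewrite subr0; move=> ->.
have -> : \sum_i ((q i - vmean q) k 0) ^+ 2 = dev2 (fun i => q i k 0).
  by apply: eq_bigr => i _; rewrite !mxE summxE /mean mulrC.
by rewrite lerDl mulr_ge0 // sqr_ge0.
Qed.

Lemma sum_dist_vmean_le q : \sum_i enorm (q i - vmean q) <= Num.sqrt n%:R * vdev q.
Proof.
have := @dotv_abs_sum_le R n (\col_i enorm (q i - vmean q)).
rewrite [in leRHS]/enorm; under eq_bigr do rewrite mxE ger0_norm //.
by under [X in _ <= _ * Num.sqrt X]eq_bigr do rewrite mxE.
Qed.

Lemma vmean_vmix A q : doubly_stochastic A -> vmean (vmix A q) = vmean q.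
Proof.
move=> [_ _ hc]; rewrite /vmean /vmix exchange_big /=; congr (_ *: _).
by apply: eq_bigr => j _; rewrite -scaler_suml hc scale1r.
Qed.

Lemma vmix_coord A q k : (fun i => vmix A q i k 0) = mix A (fun i => q i k 0).
Proof. by apply/funext => i; rewrite summxE; apply: eq_bigr => j _; rewrite mxE. Qed.

End VectorDisagreement.

Section PerturbedConsensus.
Context {R : realType} {n m : nat}.
Variables (E : nat -> rel 'I_n) (W : nat -> 'M[R]_n) (w : R) (iota : nat).
Hypotheses (n_gt0 : (0 < n)%N) (mixW : mixing_matrices E W) (assA : assumptionA E W w iota).
Implicit Types q : 'I_n -> 'cV[R]_m.

Fixpoint vmix_iter (t k : nat) q := if k is k'.+1 then vmix_iter t.+1 k' (vmix (W t) q) else q.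

Lemma vmix_iter_coord t k q j :
  (fun i => vmix_iter t k q i j 0) = mix_iter W t k (fun i => q i j 0).
Proof. by elim: k t q => //= k IH t q; rewrite IH vmix_coord. Qed.

Lemma vdev_iter_le t k q : (0 < t)%N -> vdev (vmix_iter t k q) <= vdev q.
Proof.
move=> t0; rewrite !vdevE ler_wsqrtr //; apply: ler_sum => j _.
by rewrite vmix_iter_coord; exact: (dev2_mix_iter_le assA).
Qed.

Lemma vdev_window t q : (0 < t)%N ->
  vdev (vmix_iter t iota q) <= contraction (n := n) w * vdev q.
Proof.
move=> t0; have /andP[r0 _] := contraction_bounds n_gt0 assA.
rewrite !vdevE -(ger0_norm r0) -sqrtr_sqr -sqrtrM ?sqr_ge0 // ler_wsqrtr //.
rewrite mulr_sumr; apply: ler_sum => j _.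
by rewrite vmix_iter_coord; exact: (dev2_window n_gt0 mixW assA).
Qed.

(** The total disagreement over the next [N] mixing steps; a seminorm in [q], so
    that the effect of perturbations injected at each step can be telescoped. *)
Fixpoint future_dev (N t : nat) q : R :=
  if N is N'.+1 then vdev (vmix (W t) q) + future_dev N' t.+1 (vmix (W t) q) else 0.

Lemma future_devD N t q q' :
  future_dev N t (fun i => q i + q' i) <= future_dev N t q + future_dev N t q'.
Proof.
elim: N t q q' => [|N IH] t q q' /=; first by rewrite addr0.
have -> : vmix (W t) (fun i => q i + q' i) = fun i => vmix (W t) q i + vmix (W t) q' i.
  by apply/funext => i; rewrite /vmix -big_split; apply: eq_bigr => j _; rewrite scalerDr.
have := vdevD (vmix (W t) q) (vmix (W t) q').
by have := IH t.+1 (vmix (W t) q) (vmix (W t) q'); lra.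
Qed.

Lemma future_dev_ge0 N t q : 0 <= future_dev N t q.
Proof. by elim: N t q => //= N IH t q; rewrite addr_ge0 ?vdev_ge0. Qed.

Lemma future_dev_split k N t q : (0 < t)%N ->
  future_dev N t q <= k%:R * vdev q + future_dev (N - k) (t + k) (vmix_iter t k q).
Proof.
elim: k N t q => [|k IH] N t q t0; first by rewrite mul0r add0r subn0 addn0.
case: N => [|N] /=; first by rewrite addr_ge0 // mulr_ge0 ?vdev_ge0.
have := IH N t.+1 (vmix (W t) q) isT; rewrite subSS addnS addSn.
have h1 : vdev (vmix (W t) q) <= vdev q := @vdev_iter_le t 1 q t0.
have : k%:R * vdev (vmix (W t) q) <= k%:R * vdev q by rewrite ler_wpM2l.
by rewrite -[k.+1]addn1 natrD mulrDl mul1r; lra.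
Qed.

(** Each window of [iota] steps contributes at most [iota] times the disagreement at
    its start, and these decrease geometrically with ratio [1 - w / n ^ 3]. *)
Lemma future_dev_le N t q : (0 < t)%N ->
  future_dev N t q <= iota%:R * (n%:R ^+ 3 / w) * vdev q.
Proof.
have /andP[w0 w1] := w_bounds assA.
have n3 : 0 < n%:R ^+ 3 :> R by rewrite exprn_gt0 // ltr0n.
set C := iota%:R * _; have C0 : 0 <= C by rewrite mulr_ge0 ?divr_ge0 ?ler0n // ltW.
elim/ltn_ind: N t q => N IH t q t0.
have [->|N0] := posnP N; first by rewrite /= mulr_ge0 ?vdev_ge0.
apply: le_trans (future_dev_split iota N q t0) _.
have lt : (N - iota < N)%N by rewrite ltn_subrL N0 (A_iota assA).
have := IH _ lt (t + iota)%N (vmix_iter t iota q); rewrite addn_gt0 t0 => /(_ isT).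
have : C * vdev (vmix_iter t iota q) <= C * (contraction (n := n) w * vdev q).
  by rewrite ler_wpM2l // vdev_window.
have -> : C * (contraction (n := n) w * vdev q) = C * vdev q - iota%:R * vdev q.
  by rewrite /C /contraction; field; rewrite !gt_eqF // ltr0n.
by lra.
Qed.

(** The potential [future_dev] pays for all the later disagreement that a state
    causes. Each perturbation raises the potential by at most its own future
    disagreement, so that the sum is linear in the sizes of the perturbations. *)
Lemma perturbed_consensus (q : nat -> 'I_n -> 'cV[R]_m) (e : nat -> R) (T : nat) :
  (forall i, q 1%N i = 0) -> (forall t, 0 <= e t) ->
  (forall t i, (0 < t)%N -> enorm (q t.+1 i - vmix (W t) (q t) i) <= e t.+1) ->
  \sum_(1 <= t < T.+1) \sum_i enorm (vmix (W t) (q t) i - vmean (q t)) <=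
  n%:R * (iota%:R * (n%:R ^+ 3 / w)) * \sum_(1 <= t < T.+1) e t.+1.
Proof.
move=> q1 e0 he; have /andP[w0 w1] := w_bounds assA.
set C := iota%:R * _.
have C0 : 0 <= C by rewrite mulr_ge0 ?divr_ge0 ?exprn_ge0 ?ler0n // ltW.
have nn0 : 0 <= Num.sqrt n%:R :> R by exact: sqrtr_ge0.
suff main N t0 : (0 < t0)%N ->
    \sum_(t0 <= t < t0 + N) vdev (vmix (W t) (q t)) <=
    future_dev N t0 (q t0) + C * (Num.sqrt n%:R * \sum_(t0 <= t < t0 + N) e t.+1).
  have := main T 1%N isT; rewrite add1n.
  have -> : q 1%N = fun=> 0 by apply/funext => i; rewrite q1.
  have -> : future_dev T 1 (fun=> 0) = 0.
    apply/eqP; rewrite eq_le future_dev_ge0 andbT.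
    by apply: le_trans (future_dev_le _ _ _) _; rewrite // vdev0 mulr0.
  rewrite add0r => h.
  apply: (@le_trans _ _ (Num.sqrt n%:R * \sum_(1 <= t < T.+1) vdev (vmix (W t) (q t)))).
    rewrite mulr_sumr !big_nat; apply: ler_sum => t /andP[t1 _].
    by rewrite -(vmean_vmix (q t) (A_stoch assA t1)); exact: sum_dist_vmean_le.
  apply: le_trans (ler_wpM2l nn0 h) _.
  rewrite le_eqVlt; apply/orP; left; apply/eqP.
  by rewrite -[n%:R in RHS](sqr_sqrtr (ler0n _ _)); ring.
elim: N t0 => [|N IH] t0 t00.
  by rewrite addn0 big_geq //= add0r mulr_ge0 // mulr_ge0 // big_geq.
rewrite addnS -addSn big_ltn ?addSn ?ltnS ?leq_addr // [X in _ <= _ + _ * (_ * X)]big_ltn ?ltnS ?leq_addr //.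
rewrite -addSn /= -!addrA lerD2l; apply: le_trans (IH t0.+1 isT) _.
pose eps i := q t0.+1 i - vmix (W t0) (q t0) i.
have -> : q t0.+1 = fun i => vmix (W t0) (q t0) i + eps i.
  by apply/funext => i; rewrite /eps addrC subrK.
have h1 := future_devD N t0.+1 (vmix (W t0) (q t0)) eps.
have h2 := @future_dev_le N t0.+1 eps isT; rewrite -/C in h2.
have h3 : C * vdev eps <= C * (Num.sqrt n%:R * e t0.+1).
  by rewrite ler_wpM2l // vdev_le // => i; exact: he.
by lra.
Qed.

End PerturbedConsensus.

(** * Gradients of convex functions *)

Section ConvexGradient.
Context {R : realType} {k : nat}.
Variables (K : set 'cV[R]_k) (phi : 'cV[R]_k -> R).

Lemma is_gradientE x v : is_gradient K phi x v -> forall e, 0 < e ->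
  exists2 s, 0 < s & forall y, K y -> enorm (y - x) < s ->
    `|phi y - phi x - dotv v (y - x)| <= e * enorm (y - x).
Proof.
move=> gr e e0; have /nbhs_ballP[s /= s0 hs] := gr e e0.
exists s => // y Ky yx; apply: (hs y) => //; rewrite mx_norm_ball /=.
apply: le_lt_trans yx; rewrite enormBC; exact: mxnorm_le_enorm.
Qed.

Hypotheses (cK : convex_set (K : set (convex_lmodType 'cV[R]_k)))
  (cphi : convex_function (K : set (convex_lmodType 'cV[R]_k)) phi).

(** The gradient controls [phi] near [x] only; convexity along the segment to [y]
    carries the bound over to [y]. *)
Lemma gradient_ineq x v y : K x -> K y -> is_gradient K phi x v ->
  phi x + dotv v (y - x) <= phi y.
Proof.
move=> Kx Ky gr; apply/ler_addgt0Pr => d d0.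
have [yx0|yx0] := eqVneq (enorm (y - x)) 0.
  by rewrite (enorm_eq0 yx0) dotv0r addr0 (subr0_eq (enorm_eq0 yx0)) lerDl ltW.
have yxp : 0 < enorm (y - x) by rewrite lt0r yx0 /=.
have [s s0 hs] := is_gradientE gr (divr_gt0 d0 yxp).
(* Close enough to [x] for the gradient estimate to hold with precision
   [d / enorm (y - x)]. *)
pose c := Num.min 1 (s / 2 / enorm (y - x)).
have c0 : 0 < c by rewrite lt_min ltr01 !divr_gt0.
have c1 : c <= 1 by rewrite ge_min lexx.
have Kz : K (c *: y + (1 - c) *: x) by exact: convex_setE (ltW c0) _ _ _.
have zx : c *: y + (1 - c) *: x - x = c *: (y - x).
  by apply/colP => j; rewrite !mxE; ring.
have nz : enorm (c *: (y - x)) = c * enorm (y - x) by rewrite enormZ gtr0_norm.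
have := hs _ Kz; rewrite zx nz => /(_ _)/wrap[].
  have : c * enorm (y - x) <= s / 2 / enorm (y - x) * enorm (y - x).
    by rewrite ler_pM2r // ge_min lexx orbT.
  by rewrite divfK //; lra.
rewrite dotvZr mulrCA divfK // ler_norml => /andP[h1 _].
have h2 := convex_functionE cphi (ltW c0) c1 Ky Kx.
have : c * (phi x + dotv v (y - x)) <= c * (phi y + d) by lra.
by rewrite ler_pM2l.
Qed.

Lemma convex_lipschitz (G : R) : differentiable_on K phi -> gradient_bounded K phi G ->
  forall x y, K x -> K y -> `|phi x - phi y| <= G * enorm (x - y).
Proof.
move=> dphi bphi.
suff main x y : K x -> K y -> phi x - phi y <= G * enorm (x - y).
  by move=> x y Kx Ky; rewrite ler_norml lerNl opprB main // (enormBC x y) main.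
move=> Kx Ky; have [v gv] := dphi x Kx.
have := gradient_ineq Kx Ky gv; rewrite -opprB dotvNr => h.
apply: le_trans (_ : dotv v (x - y) <= _); first by lra.
by apply: le_trans (dotv_le _ _) _; rewrite ler_wpM2r // (bphi x).
Qed.

End ConvexGradient.

(** * One primal-dual step *)

Section OneStep.
Context {R : realType} {k m : nat}.

Lemma dotv_mulmx (A : 'M[R]_(m, k)) (q : 'cV[R]_m) (v : 'cV[R]_k) :
  dotv q (A *m v) = dotv (A^T *m q) v.
Proof.
rewrite /dotv; under eq_bigr do rewrite mxE mulr_sumr.
rewrite exchange_big /=; apply: eq_bigr => j _; rewrite mxE mulr_suml.
by apply: eq_bigr => i _; rewrite mxE; ring.
Qed.

(** The variational inequality of the projection, with the scalar products expanded
    into squared distances. *)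
Lemma primal_step (K : set 'cV[R]_k) (x x' z b : 'cV[R]_k) (al : R) :
  0 < al -> convex_set (K : set (convex_lmodType 'cV[R]_k)) ->
  nearest K (x - al *: b) x' -> K z ->
  dotv b (x' - z) <=
    (enorm (x - z) ^+ 2 - enorm (x' - z) ^+ 2 - enorm (x' - x) ^+ 2) / (2 * al).
Proof.
move=> al0 cK nx Kz; have := nearest_variational cK nx Kz.
rewrite ler_pdivlMr ?mulr_gt0 // !sqr_enorm !dotvE.
by rewrite (dotvC z x) (dotvC z x') (dotvC x' x); lra.
Qed.

Lemma dual_step (q' qt q c : 'cV[R]_m) (be ga a : R) :
  0 < ga -> a = 1 - ga * be ->
  q' = pospart (a *: qt + ga *: c) -> (forall j, 0 <= q j 0) ->
  enorm (q' - q) ^+ 2 / (2 * ga) <=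
    a / (2 * ga) * enorm (qt - q) ^+ 2 + dotv (qt - q) c + be / 2 * enorm q ^+ 2
    + (- (a * be / 2) * enorm qt ^+ 2 - ga * be * dotv qt c + ga / 2 * enorm c ^+ 2).
Proof.
move=> ga0 aE q'E q0.
have hd : enorm (q' - q) ^+ 2 <= enorm (a *: qt + ga *: c - q) ^+ 2.
  rewrite ler_pXn2r ?nnegrE // q'E -{1}(pospart_id q0); exact: pospart_lipschitz.
apply: (@le_trans _ _ (enorm (a *: qt + ga *: c - q) ^+ 2 / (2 * ga))).
  by rewrite ler_pM2r // invr_gt0 mulr_gt0.
rewrite le_eqVlt; apply/orP; left; apply/eqP.
rewrite !sqr_enorm !dotvE (dotvC q qt) (dotvC c qt) (dotvC c q) aE.
by field; rewrite gt_eqF.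
Qed.

(** The descent of the primal distance and of the dual distance, added up: the
    term [dotv qt (A *m (x' - x))], which neither step controls alone, cancels. *)
Lemma one_step (K : set 'cV[R]_k) (x x' z gf : 'cV[R]_k) (A : 'M[R]_(m, k))
    (gx qt q' q c : 'cV[R]_m) (al be ga a : R) :
  0 < al -> 0 < ga -> a = 1 - ga * be ->
  convex_set (K : set (convex_lmodType 'cV[R]_k)) ->
  nearest K (x - al *: (gf + A^T *m qt)) x' -> K z ->
  c = A *m (x' - x) + gx ->
  q' = pospart (a *: qt + ga *: c) -> (forall j, 0 <= q j 0) ->
  enorm (q' - q) ^+ 2 / (2 * ga) + dotv gf (x - z) + dotv qt (A *m (x - z) - gx) + dotv q gx
  <= a / (2 * ga) * enorm (qt - q) ^+ 2
     + (enorm (x - z) ^+ 2 - enorm (x' - z) ^+ 2) / (2 * al)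
     + al * (enorm gf ^+ 2 + enorm (A^T *m q) ^+ 2)
     + be / 2 * enorm q ^+ 2
     + (- (a * be / 2) * enorm qt ^+ 2 - ga * be * dotv qt c + ga / 2 * enorm c ^+ 2).
Proof.
move=> al0 ga0 aE cK nx Kz cE q'E q0.
have hdual := dual_step ga0 aE q'E q0.
have hprim := primal_step al0 cK nx Kz.
set rest := (X in _ <= _ + X); rewrite -/rest in hdual.
have split (b : 'cV[R]_k) : dotv b (x' - z) = dotv b (x' - x) + dotv b (x - z).
  by rewrite -dotvDr addrA subrK.
(* Young's inequality spends the displacement term left by [primal_step]. *)
have hyoung : - dotv (gf + A^T *m q) (x' - x) - enorm (x' - x) ^+ 2 / (2 * al)
    <= al * (enorm gf ^+ 2 + enorm (A^T *m q) ^+ 2).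
  have h2 : enorm (gf + A^T *m q) ^+ 2 <= 2 * (enorm gf ^+ 2 + enorm (A^T *m q) ^+ 2).
    have := exprn_ge0 2 (enorm_ge0 (gf - A^T *m q)).
    by rewrite !sqr_enorm !dotvE (dotvC (A^T *m q) gf); lra.
  have h1 := dotv_ge0 (x' - x - (- al) *: (gf + A^T *m q)).
  rewrite dotv_sqrB (dotvC (x' - x)) -!sqr_enorm in h1.
  set d := dotv _ _ in h1 *; set e := enorm (gf + _) ^+ 2 in h1 h2 *.
  set v := enorm (x' - x) ^+ 2 in h1 *.
  have : al * e <= al * (2 * (enorm gf ^+ 2 + enorm (A^T *m q) ^+ 2)) by rewrite ler_pM2l.
  have h3 : - d - v / (2 * al) <= al * e / 2.
    rewrite -subr_ge0 (_ : al * e / 2 - _ = (v - 2 * (- al) * d + (- al) ^+ 2 * e) / (2 * al)).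
      by rewrite divr_ge0 // mulr_ge0 // ltW.
    by field; rewrite gt_eqF.
  by lra.
have hc1 : dotv qt c = dotv (A^T *m qt) (x' - x) + dotv qt gx.
  by rewrite cE (dotvDr _ (A *m _)) dotv_mulmx.
have hc2 : dotv q c = dotv (A^T *m q) (x' - x) + dotv q gx.
  by rewrite cE (dotvDr _ (A *m _)) dotv_mulmx.
have hA : dotv qt (A *m (x - z) - gx) = dotv (A^T *m qt) (x - z) - dotv qt gx.
  by rewrite (dotvBr _ (A *m _)) dotv_mulmx.
rewrite split !(dotvDl gf) in hprim.
rewrite (dotvDl gf) in hyoung.
rewrite (dotvBl qt) hc1 hc2 in hdual.
rewrite hA.
by lra.
Qed.

(** Completing the square in [Q]. The bound on [C] is slightly below [2 * B]
    because decisions lie in shrunk sets; this margin absorbs the excess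
    [C * Q / N] left by the completion. *)
Lemma rest_bound (t : nat) (N ga be a B S Q C L : R) :
  (0 < t)%N -> N = t.+1%:R -> 0 < ga -> ga * be = N^-1 -> a = 1 - ga * be ->
  0 <= S -> S <= B -> 0 <= Q -> 0 <= C -> C <= 2 * B * (N / (N + 1)) -> L <= 2 * S / N ->
  (t = 1%N -> Q = 0) ->
  - (a * be / 2) * Q ^+ 2 + ga * be * (Q * C) + ga / 2 * C ^+ 2 + L * Q <=
  2 * ga * B ^+ 2 + 2 * B * S * (if t == 1%N then 0 else 3 * ga / t%:R).
Proof.
move=> t0 NE ga0 gabe aE S0 SB Q0 C0 CB LS tQ.
have B0 : 0 <= B := le_trans S0 SB.
have tp : 1 <= t%:R :> R by rewrite ler1n.
have Nt : N = t%:R + 1 by rewrite NE -addn1 natrD.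
have N0 : 0 < N by rewrite Nt; lra.
have CB2 : C <= 2 * B.
  apply: le_trans CB _; rewrite -[leRHS]mulr1 ler_wpM2l ?mulr_ge0 //.
  by rewrite ler_pdivrMr; lra.
case: eqP => [/tQ ->|_].
  rewrite mul0r !mulr0 expr0n /= !(mulr0, add0r, addr0).
  have : C ^+ 2 <= (2 * B) ^+ 2 by rewrite ler_pXn2r ?nnegrE // mulr_ge0.
  rewrite -(ler_pM2l (divr_gt0 ga0 (ltr0n R 2))) /=; lra.
have tn0 : t%:R != 0 :> R by apply: lt0r_neq0; lra.
(* After scaling by [ga] all terms carry the same factor [ga]. *)
pose Q' := Q / ga; have QE : Q = ga * Q' by rewrite mulrC divfK // gt_eqF.
have beE : be = N^-1 / ga by rewrite -gabe mulrAC mulfV ?mul1r // gt_eqF.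
have aE' : a = t%:R / N by rewrite aE gabe Nt; field; lra.
have LQ : L * Q <= 2 * S / N * Q by rewrite ler_wpM2r.
have main : - (t%:R / N ^+ 2 / 2) * Q' ^+ 2 + Q' * (C + 2 * S) / N + C ^+ 2 / 2 <=
    2 * B ^+ 2 + 6 * B * S / t%:R.
  have sq : - (t%:R / N ^+ 2 / 2) * Q' ^+ 2 + Q' * (C + 2 * S) / N <= (C + 2 * S) ^+ 2 / (2 * t%:R).
    rewrite -subr_ge0 (_ : (C + 2 * S) ^+ 2 / (2 * t%:R) - _ = (t%:R * Q' / N - (C + 2 * S)) ^+ 2 / (2 * t%:R)).
      by rewrite divr_ge0 ?sqr_ge0.
    by field; rewrite tn0 gt_eqF.
  have c2 : C ^+ 2 * (1 + t%:R^-1) <= 4 * B ^+ 2.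
    have : C ^+ 2 <= (2 * B * (N / (N + 1))) ^+ 2.
      have NN : 0 <= N / (N + 1) by apply: divr_ge0; lra.
      by rewrite ler_pXn2r ?nnegrE // mulr_ge0 // mulr_ge0.
    have t1 : 0 <= 1 + t%:R^-1 :> R by rewrite addr_ge0 ?invr_ge0.
    move=> /(ler_wpM2r t1) /le_trans; apply.
    have -> : (2 * B * (N / (N + 1))) ^+ 2 * (1 + t%:R^-1) =
        4 * B ^+ 2 * (N ^+ 3 / (t%:R * (N + 1) ^+ 2)).
      by rewrite Nt; field; rewrite tn0 /=; lra.
    rewrite -[leRHS]mulr1 ler_wpM2l ?mulr_ge0 ?sqr_ge0 // ler_pdivrMr; last first.
      by rewrite mulr_gt0 ?exprn_gt0 //; lra.
    rewrite Nt; nra.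
  have c3 : (2 * C * S + 2 * S ^+ 2) / t%:R <= 6 * B * S / t%:R.
    rewrite ler_wpM2r ?invr_ge0 //.
    have : C * S <= 2 * B * S by rewrite ler_wpM2r.
    have : S * S <= B * S by rewrite ler_wpM2r.
    by lra.
  have c4 : (C + 2 * S) ^+ 2 / (2 * t%:R) = C ^+ 2 * t%:R^-1 / 2 + (2 * C * S + 2 * S ^+ 2) / t%:R.
    by field.
  by move: sq c2 c3; rewrite c4; lra.
apply: le_trans (lerD (lexx _) LQ) _.
have := ler_wpM2l (ltW ga0) main; congr (_ <= _).
  by rewrite beE aE' QE; field; rewrite !gt_eqF.
by field.
Qed.

End OneStep.

(** * Shrunk decision sets *)

Section ShrunkSets.
Context {R : realType} {k : nat}.
Variables (K : set 'cV[R]_k) (r M : R).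
Hypotheses (cK : convex_set (K : set (convex_lmodType 'cV[R]_k))) (clK : closed K)
  (r_ge0 : 0 <= r) (inK : [set x | enorm x <= r] `<=` K) (outK : K `<=` [set x | enorm x <= M]).

Lemma zero_in_inner : K 0.
Proof. by apply: inK; rewrite /= enorm0. Qed.

Lemma scale_set_mono (c c' : R) x : 0 <= c -> c <= c' -> scale_set c K x -> scale_set c' K x.
Proof.
move=> c0 cc' [y Ky <-]; have [c'0|c'0] := eqVneq c' 0.
  by exists 0; [exact: zero_in_inner|]; rewrite (_ : c = 0) ?scale0r ?scaler0 //; lra.
have c'p : 0 < c' by rewrite lt0r c'0 (le_trans c0).
exists ((c / c') *: y); last by rewrite scalerA mulrC divfK.
have := convex_setE cK (divr_ge0 c0 (ltW c'p)) _ Ky zero_in_inner.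
by rewrite scaler0 addr0; apply; rewrite ler_pdivrMr // mul1r.
Qed.

Lemma scale_set_sub (c : R) x : 0 <= c -> c <= 1 -> scale_set c K x -> K x.
Proof.
by move=> c0 c1 /(scale_set_mono c0 c1)[y Ky <-]; rewrite scale1r.
Qed.

Lemma scale_set_norm (c : R) x : 0 <= c -> scale_set c K x -> enorm x <= c * M.
Proof.
by move=> c0 [y Ky <-]; rewrite enormZ ger0_norm // ler_wpM2l //; exact: outK.
Qed.

(** A point of the shrunk set plus a small vector is a convex combination of a
    point of [K] and a point of the inner ball. *)
Lemma scale_set_ball (c : R) x v : 0 < c -> c < 1 -> scale_set (1 - c) K x ->
  enorm v <= c * r -> K (x + v).
Proof.
move=> c0 c1 [y Ky <-] hv.
have -> : (1 - c) *: y + v = c *: (c^-1 *: v) + (1 - c) *: y.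
  by rewrite scalerA mulfV ?scale1r 1?addrC // gt_eqF.
apply: convex_setE => //; [exact: ltW|exact: ltW|].
by apply: inK; rewrite /= enormZ gtr0_norm ?invr_gt0 // mulrC ler_pdivrMr // mulrC.
Qed.

Lemma nearest_scale_set (c : R) z : 0 < c ->
  nearest (scale_set c K) z (euclid_proj (scale_set c K) z).
Proof.
move=> c0; apply: euclid_proj_nearest.
apply: (@nearest_point_exists _ _ _ (c * M)).
- by exists (c *: 0); exists 0 => //; exact: zero_in_inner.
- by move=> x; apply: scale_set_norm; exact: ltW.
- exact: closed_scale_set.
Qed.

End ShrunkSets.

(** * Telescoping against increasing weights *)

Section Telescoping.
Context {R : realType}.

Lemma sum_dist_mix_le (n m : nat) (A : 'M[R]_n) (v : 'I_n -> 'cV[R]_m) (c : 'cV[R]_m) :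
  (0 < n)%N -> doubly_stochastic A ->
  \sum_i enorm (vmix A v i - c) ^+ 2 <= \sum_i enorm (v i - c) ^+ 2.
Proof.
move=> n0 dA.
have hq (s : 'I_n -> 'cV[R]_m) :
    \sum_i enorm (s i - c) ^+ 2 = \sum_k \sum_i (s i k 0 - c k 0) ^+ 2.
  rewrite exchange_big /=; apply: eq_bigr => i _; rewrite sqr_enorm.
  by apply: eq_bigr => k _; rewrite !mxE expr2.
rewrite !hq; apply: ler_sum => k _.
rewrite (sum_sqr_shift (fun i => v i k 0)) // (sum_sqr_shift (fun i => vmix A v i k 0)) //.
by rewrite vmix_coord mean_mix // lerD2r dev2_mix_le.
Qed.

(** Summation by parts against nondecreasing weights: each weight increment
    multiplies a squared distance of at most [(2 * M) ^+ 2], and replacing [z t] by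
    [z t.+1] changes a squared distance by at most [4 * M] times their distance. *)
Lemma primal_telescope k (x z : nat -> 'cV[R]_k) (w : nat -> R) (M : R) (T : nat) :
  (0 < T)%N -> (forall t, (0 < t)%N -> enorm (x t) <= M) ->
  (forall t, (0 < t <= T)%N -> enorm (z t) <= M) ->
  (forall t, 0 <= w t) -> (forall t, w t <= w t.+1) ->
  \sum_(1 <= t < T.+1) w t * (enorm (x t - z t) ^+ 2 - enorm (x t.+1 - z t) ^+ 2)
  <= w T * (4 * M ^+ 2) + \sum_(1 <= t < T) 4 * M * (w t * enorm (z t.+1 - z t)).
Proof.
move=> T0 hx + w0 wS.
have M0 : 0 <= M by apply: le_trans (enorm_ge0 (x 1%N)) (hx _ _).
have d2 (a b : 'cV[R]_k) : enorm a <= M -> enorm b <= M -> enorm (a - b) <= 2 * M.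
  by move=> ha hb; apply: le_trans (enormB _ _) _; lra.
have sq2 (a b : 'cV[R]_k) : enorm a <= M -> enorm b <= M -> enorm (a - b) ^+ 2 <= 4 * M ^+ 2.
  move=> ha hb; have -> : 4 * M ^+ 2 = (2 * M) ^+ 2 by ring.
  by rewrite ler_pXn2r ?nnegrE ?d2 // mulr_ge0.
move=> hz.
suff main N : (0 < N <= T)%N ->
    \sum_(1 <= t < N.+1) w t * (enorm (x t - z t) ^+ 2 - enorm (x t.+1 - z t) ^+ 2)
    <= w N * (4 * M ^+ 2 - enorm (x N.+1 - z N) ^+ 2)
       + \sum_(1 <= t < N) 4 * M * (w t * enorm (z t.+1 - z t)).
  have := main T; rewrite T0 leqnn => /(_ isT) h; apply: le_trans h _; rewrite lerD2r.
  by rewrite ler_wpM2l // gerBl sqr_ge0.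
elim: N => // -[|N] IH /andP[_ NT].
  rewrite big_nat1 big_geq // addr0 ler_wpM2l // lerD2r sq2 ?hx ?hz //.
rewrite big_nat_recr //= [X in _ <= _ + X]big_nat_recr //=.
have {}IH := IH (ltnW NT).
set S := \sum_(_ <= _ < _) _ in IH *; set S' := \sum_(_ <= _ < _) _ in IH *.
set X := x N.+2; set z1 := z N.+1 in IH *; set z2 := z N.+2.
have z1M : enorm z1 <= M by apply: hz; rewrite /= ltnW.
have z2M : enorm z2 <= M by apply: hz.
have XM : enorm X <= M by apply: hx.
have h1 : enorm (X - z2) ^+ 2 - enorm (X - z1) ^+ 2 <= 4 * M * enorm (z2 - z1).
  have a1 := d2 _ _ XM z1M; have a2 := d2 _ _ XM z2M.
  have ab : enorm (X - z2) - enorm (X - z1) <= enorm (z2 - z1).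
    by rewrite lerBlDr [leRHS]addrC (enormBC z2) enorm_triangle.
  rewrite subr_sqr; apply: (@le_trans _ _ (enorm (z2 - z1) * (enorm (X - z2) + enorm (X - z1)))).
    by rewrite ler_wpM2r // addr_ge0.
  by rewrite mulrC ler_wpM2r //; lra.
have h2 := ler_wpM2l (w0 N.+1) h1.
have h3 : (w N.+2 - w N.+1) * enorm (X - z2) ^+ 2 <= (w N.+2 - w N.+1) * (4 * M ^+ 2).
  by rewrite ler_wpM2l ?sq2 // subr_ge0.
rewrite -/X in IH.
by lra.
Qed.

End Telescoping.

(** * One run, for fixed directions *)

Section Run.
Context {R : realType} {n m : nat} {p : 'I_n -> nat}.
Variables (X : forall i : 'I_n, set 'cV[R]_(p i)) (f : strategy R p R) (g : strategy R p 'cV[R]_m).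
Arguments X : clear implicits. Arguments f : clear implicits. Arguments g : clear implicits.
Variables (W : nat -> 'M[R]_n) (r Rd Ff Fg Gf Gg : 'I_n -> R) (kappa : R).
Variables (u x : trajectory R p) (q : nat -> 'I_n -> 'cV[R]_m) (x1 : decision R p).

Let alpha := fun (i : 'I_n) (t : nat) => 1 / t%:R `^ kappa : R.
Let beta := fun (i : 'I_n) (t : nat) => 1 / t%:R `^ kappa : R.
Let gamma := fun (i : 'I_n) (t : nat) => 1 / t%:R `^ (1 - kappa) : R.
Let xi := fun (i : 'I_n) (t : nat) => 1 / (t%:R + 1) : R.
Let delta := fun (i : 'I_n) (t : nat) => r i / (t%:R + 1) : R.

Hypotheses (kappa01 : 0 < kappa < 1) (assB : assumptionB X f g r Rd Ff Fg Gf Gg).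
Hypothesis unit_u : forall t i, (0 < t)%N -> enorm (u t i) = 1.
Hypothesis x1_in : forall i, scale_set (1 - xi i 1%N) (X i) (x1 i).
Hypothesis run : bandit_run X W f g alpha beta gamma xi delta u x q x1.
Hypothesis stochW : forall t, (0 < t)%N -> doubly_stochastic (W t).

Lemma xi_bounds i t : (0 < t)%N -> 0 < xi i t <= 2^-1.
Proof.
move=> t0; have t1 : 1 <= t%:R :> R by rewrite ler1n.
rewrite /xi div1r invr_gt0 lef_pV2 ?posrE; try lra.
Qed.

Lemma r_gt0 i : 0 < r i. Proof. by have [] := B_pos assB i. Qed.
Lemma Rd_gt0 i : 0 < Rd i. Proof. by have [] := B_pos assB i. Qed.
Lemma Fg_gt0 i : 0 < Fg i. Proof. by have [] := B_pos assB i. Qed.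
Lemma Ff_gt0 i : 0 < Ff i. Proof. by have [] := B_pos assB i. Qed.
Lemma Gg_gt0 i : 0 < Gg i. Proof. by have [] := B_gpos assB i. Qed.
Lemma Gf_gt0 i : 0 < Gf i. Proof. by have [] := B_gpos assB i. Qed.

(** In dimension 0 no vector has norm 1. *)
Lemma dim_gt0 i : (0 < p i)%N.
Proof.
have := @unit_u 1%N i isT; case: posnP => // pi0.
rewrite /enorm big1 ?sqrtr0; first by move/eqP; rewrite eq_sym oner_eq0.
by move=> [j hj]; exfalso; move: hj; rewrite pi0.
Qed.

Lemma r_le_Rd i : r i <= Rd i.
Proof.
have h : enorm (r i *: u 1 i) = r i by rewrite enormZ unit_u // mulr1 gtr0_norm // r_gt0.
by rewrite -h; apply: (B_outer assB); apply: (B_inner assB); rewrite /= h.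
Qed.

Lemma zero_in_X i : X i 0.
Proof. exact: zero_in_inner (ltW (r_gt0 i)) (B_inner assB (i := i)). Qed.

Lemma X_norm i z : X i z -> enorm z <= Rd i.
Proof. exact: (B_outer assB). Qed.

Lemma shrunk_sub i t z : (0 < t)%N -> scale_set (1 - xi i t) (X i) z -> X i z.
Proof.
move=> t0 hz; have /andP[h1 h2] := xi_bounds i t0.
by apply: (scale_set_sub (B_convex assB (i := i)) (ltW (r_gt0 i)) (B_inner assB (i := i)) _ _ hz); lra.
Qed.

Lemma nearest_x i t : (1 < t)%N ->
  nearest (scale_set (1 - xi i t) (X i))
    (x t.-1 i - alpha i t *: bvec W f g delta u x q t i) (x t i).
Proof.
move=> t1; rewrite [X in nearest _ _ X](run_x run i t1).
apply: (nearest_scale_set (B_closed assB (i := i)) (ltW (r_gt0 i)) (B_inner assB (i := i)) (B_outer assB (i := i))).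
by have /andP[h1 h2] := xi_bounds i (ltnW t1); lra.
Qed.

Lemma x_shrunk i t : (0 < t)%N -> scale_set (1 - xi i t) (X i) (x t i).
Proof.
case: t => [|[|t]] // _; first by rewrite (run_x1 run); exact: x1_in.
exact: (nearest_x i (t := t.+2) isT).1.
Qed.

Lemma x_in i t : (0 < t)%N -> X i (x t i).
Proof. by move=> t0; apply: shrunk_sub t0 (x_shrunk i t0). Qed.

Lemma x_feasible : feasible_traj X x.
Proof. by move=> s i s0; exact: x_in. Qed.

Lemma shrunk_perturb i t z v : (0 < t)%N -> scale_set (1 - xi i t) (X i) z ->
  enorm v <= delta i t -> X i (z + v).
Proof.
move=> t0 hz hv; have /andP[h1 h2] := xi_bounds i t0.
apply: (scale_set_ball (B_convex assB (i := i)) (B_inner assB (i := i)) h1 _ hz); first by lra.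
by rewrite /xi mulrAC mul1r.
Qed.

Lemma delta_gt0 i t : 0 < delta i t.
Proof. by rewrite /delta divr_gt0 ?r_gt0 // ltr_wpDl. Qed.

Lemma delta_unit i t (v : 'cV[R]_(p i)) : enorm v = 1 -> enorm (delta i t *: v) = delta i t.
Proof. by move=> h; rewrite enormZ h mulr1 gtr0_norm // delta_gt0. Qed.

Lemma x_perturb_in i t : (0 < t)%N -> X i (x t i + delta i t *: u t i).
Proof.
move=> t0; apply: shrunk_perturb (x_shrunk i t0) _ => //.
by rewrite delta_unit // unit_u.
Qed.

Lemma regular_lipschitz i (phi : strategy R p R) (F G : R) t h y y' :
  regular_for X i phi F G -> (0 < t)%N -> feasible_traj X h -> X i y -> X i y' ->
  `|phi i t h y - phi i t h y'| <= G * enorm (y - y').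
Proof.
move=> reg t0 fh.
exact: (convex_lipschitz (B_convex assB (i := i)) (regular_convex reg t0 fh) (regular_diff reg t0 fh) (regular_grad reg t0 fh)).
Qed.

(** The scalar factor of the two-point estimate: the estimate is [slope] times the
    direction. *)
Definition slope (phi : strategy R p R) (i : 'I_n) (t : nat) : R :=
  (p i)%:R / delta i t * (phi i t x (x t i + delta i t *: u t i) - phi i t x (x t i)).

(** The increment of [phi] over a step of length [delta] is at most [G * delta], so
    the division by [delta] does no harm. *)
Lemma slope_le phi F G i t : regular_for X i phi F G -> (0 < t)%N ->
  `|slope phi i t| <= (p i)%:R * G.
Proof.
move=> reg t0; rewrite /slope normrM ger0_norm; last by rewrite divr_ge0 // ltW // delta_gt0.
rewrite -[leRHS](_ : (p i)%:R / delta i t * (G * delta i t) = _); last first.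
  by field; rewrite gt_eqF // delta_gt0.
apply: ler_wpM2l; first by apply: divr_ge0 => //; exact/ltW/delta_gt0.
apply: le_trans (regular_lipschitz reg t0 x_feasible (x_perturb_in i t0) (x_in i t0)) _.
by rewrite addrAC subrr add0r delta_unit // unit_u.
Qed.

Lemma grad2fE i t : grad2f f delta u x i t = slope f i t *: u t i.
Proof. by []. Qed.

Definition slopes i t : 'cV[R]_m := \col_j slope (constr_component g j) i t.

Lemma grad2g_mulmx i t v : grad2g g delta u x i t *m v = dotv (u t i) v *: slopes i t.
Proof.
apply/colP => j; rewrite /grad2g -scalemxAl -mulmxA !mxE big_ord1 !mxE.
rewrite mulrA mulrC; congr (_ * _).
by apply: eq_bigr => l _; rewrite mxE.
Qed.

Lemma grad2g_tr_mulmx i t v : (grad2g g delta u x i t)^T *m v = dotv (slopes i t) v *: u t i.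
Proof.
apply/colP => j; rewrite !mxE mulrC /dotv mulr_sumr; apply: eq_bigr => l _.
by rewrite /grad2g !mxE big_ord1 !mxE /slope /constr_component; ring.
Qed.

Lemma x_next i t : (0 < t)%N ->
  x t.+1 i = euclid_proj (scale_set (1 - xi i t.+1) (X i))
    (x t i - alpha i t.+1 *: (slope f i t *: u t i + dotv (slopes i t) (qtilde W q t.+1 i) *: u t i)).
Proof. by move=> t0; rewrite -grad2g_tr_mulmx; exact: (run_x run). Qed.

Lemma q_next i t : (0 < t)%N ->
  q t.+1 i = pospart ((1 - gamma i t.+1 * beta i t.+1) *: qtilde W q t.+1 i +
    gamma i t.+1 *: (dotv (u t i) (x t.+1 i - x t i) *: slopes i t + g i t x (x t i))).
Proof. by move=> t0; rewrite -grad2g_mulmx; exact: (run_q run). Qed.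

Lemma slopes_norm i t : (0 < t)%N -> enorm (slopes i t) <= Num.sqrt m%:R * ((p i)%:R * Gg i).
Proof.
move=> t0; apply: enorm_bounded_coord => [|j]; first by rewrite mulr_ge0 // ltW // Gg_gt0.
by rewrite mxE; exact: slope_le (B_g assB i j) t0.
Qed.

Lemma g_norm i t y : (0 < t)%N -> X i y -> enorm (g i t x y) <= Num.sqrt m%:R * Fg i.
Proof.
move=> t0 Xy; apply: enorm_bounded_coord => [|j]; first by rewrite ltW // Fg_gt0.
by have := regular_bounded (B_g assB i j) t0 x_feasible Xy.
Qed.

Lemma q_ge0 t i j : (0 < t)%N -> 0 <= q t i j 0.
Proof.
case: t => [|[|t]] // _; first by rewrite (run_q1 run) mxE.
by rewrite (run_q run) //; exact: pospart_ge0.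
Qed.

Lemma qtilde_ge0 t i j : (1 < t)%N -> 0 <= qtilde W q t i j 0.
Proof.
case: t => [|[|t]] // _; rewrite /qtilde summxE; apply: sumr_ge0 => l _.
by rewrite mxE mulr_ge0 ?q_ge0 //; have [h0 _ _] := stochW (t := t.+1) isT.
Qed.

Lemma qtildeE t i : qtilde W q t.+1 i = vmix (W t) (q t) i.
Proof. by []. Qed.

Let ptot : R := (\sum_(i < n) p i)%:R.
Let Rmax := \big[Num.max/0]_(i < n) Rd i.
Let Fgmax := \big[Num.max/0]_(i < n) Fg i.
Let Ggmax := \big[Num.max/0]_(i < n) Gg i.
Let sm : R := Num.sqrt m%:R.
Let B1 := sm * Fgmax + sm * ptot * Ggmax * Rmax.

Lemma sm_ge0 : 0 <= sm. Proof. exact: sqrtr_ge0. Qed.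

Lemma Fg_le_max i : Fg i <= Fgmax.
Proof. exact: (@le_bigmax _ _ _ 0 Fg i). Qed.

Lemma B1_ge i : sm * (Fg i + (p i)%:R * Gg i * Rd i) <= B1.
Proof.
rewrite /B1 -!mulrA -mulrDr; apply: ler_wpM2l; first exact: sm_ge0.
apply: lerD; first exact: Fg_le_max.
apply: ler_pM => //; first by rewrite mulr_ge0 // ltW ?Gg_gt0 ?Rd_gt0.
  by rewrite ler_nat (bigD1 i) //= leq_addr.
by apply: ler_pM; rewrite ?(ltW (Gg_gt0 i)) ?(ltW (Rd_gt0 i)) //; exact: le_bigmax.
Qed.

Lemma GR_le_B1 i : sm * Gg i * Rd i <= B1.
Proof.
apply: le_trans (B1_ge i); rewrite -mulrA; apply: ler_wpM2l; first exact: sm_ge0.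
have h : 0 <= Gg i * Rd i by rewrite mulr_ge0 // ltW ?Gg_gt0 ?Rd_gt0.
have : 1 * (Gg i * Rd i) <= (p i)%:R * (Gg i * Rd i) by rewrite ler_wpM2r // ler1n dim_gt0.
by have := Fg_gt0 i; lra.
Qed.

Lemma B1_ge0 (i : 'I_n) : 0 <= B1.
Proof. by apply: le_trans (GR_le_B1 i); rewrite !mulr_ge0 ?sm_ge0 // ltW ?Gg_gt0 ?Rd_gt0. Qed.

Lemma gammaE i t : gamma i t = t%:R `^ (kappa - 1).
Proof. by rewrite /gamma div1r -powRN opprB. Qed.

Lemma betaE i t : beta i t = t%:R `^ ((1 - kappa) - 1).
Proof. by rewrite /beta div1r -powRN addrAC subrr add0r. Qed.

Lemma gamma_gt0 i t : (0 < t)%N -> 0 < gamma i t.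
Proof. by move=> t0; rewrite gammaE powR_gt0 ?ltr0n. Qed.

Lemma beta_gt0 i t : (0 < t)%N -> 0 < beta i t.
Proof. by move=> t0; rewrite betaE powR_gt0 ?ltr0n. Qed.

Lemma gamma_beta i t : (0 < t)%N -> gamma i t * beta i t = t%:R^-1.
Proof.
move=> t0; rewrite gammaE betaE -powRD; last by rewrite pnatr_eq0 -lt0n t0 implybT.
by rewrite (_ : _ + _ = -1) ?powR_inv1 //; ring.
Qed.

Lemma displacement_le i t : (0 < t)%N ->
  enorm (x t.+1 i - x t i) <= 2 * Rd i * (t.+1%:R / (t.+1%:R + 1)).
Proof.
move=> t0; apply: le_trans (enormB _ _) _.
have hx s : (0 < s)%N -> enorm (x s i) <= (1 - xi i s) * Rd i.
  move=> s0; apply: (scale_set_norm (B_outer assB (i := i)) _ (x_shrunk i s0)).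
  by have /andP[] := xi_bounds i s0; lra.
have h1 := hx t t0; have h2 := hx t.+1 isT.
have tp : 0 < t%:R :> R by rewrite ltr0n.
have E1 : 1 - xi i t.+1 = t.+1%:R / (t.+1%:R + 1).
  by rewrite /xi -natr1; field; lra.
have E2 : 1 - xi i t <= t.+1%:R / (t.+1%:R + 1).
  rewrite -E1 lerD2l lerN2 /xi !div1r lef_pV2 ?posrE; rewrite -?natr1; lra.
have := ler_wpM2r (ltW (Rd_gt0 i)) E2.
by move: h1 h2; rewrite E1; lra.
Qed.

(** Both decisions have norm at most [Rd i * (t.+1 / (t.+1 + 1))], slightly less than
    [Rd i]; [rest_bound] uses this margin. *)
Lemma cvec_le i t : (0 < t)%N ->
  enorm (cvec g delta u x t.+1 i) <= 2 * B1 * (t.+1%:R / (t.+1%:R + 1)).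
Proof.
move=> t0; have tp : 1 <= t%:R :> R by rewrite ler1n.
set s := t.+1%:R / _; have s2 : 1 <= 2 * s.
  by rewrite /s mulrA ler_pdivlMr -?natr1; lra.
rewrite /cvec /= grad2g_mulmx; apply: le_trans (enormD _ _) _.
rewrite enormZ.
have h1 : `|dotv (u t i) (x t.+1 i - x t i)| <= 2 * Rd i * s.
  by apply: le_trans (cauchy_schwarz _ _) _; rewrite unit_u // mul1r; exact: displacement_le.
have h2 := slopes_norm i t0; have h3 := g_norm t0 (x_in i t0).
have h4 : `|dotv (u t i) (x t.+1 i - x t i)| * enorm (slopes i t) <=
    2 * Rd i * s * (sm * ((p i)%:R * Gg i)) by exact: ler_pM.
have h5 : sm * Fg i <= 2 * s * (sm * Fg i).
  by rewrite -[leLHS]mul1r ler_wpM2r // mulr_ge0 ?sm_ge0 // ltW // Fg_gt0.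
have h6 : 2 * s * (sm * (Fg i + (p i)%:R * Gg i * Rd i)) <= 2 * s * B1.
  by rewrite ler_wpM2l ?B1_ge //; lra.
by rewrite -/sm in h3; lra.
Qed.

Lemma cvec_le2 i t : (0 < t)%N -> enorm (cvec g delta u x t.+1 i) <= 2 * B1.
Proof.
move=> t0; apply: le_trans (cvec_le i t0) _; rewrite -[leRHS]mulr1.
apply: ler_wpM2l; first by rewrite mulr_ge0 // (B1_ge0 i).
by rewrite ler_pdivrMr ?mul1r -?natr1; have : 0 <= t%:R :> R by []; lra.
Qed.

Lemma vmix_norm_le t (v : 'I_n -> 'cV[R]_m) (b : R) i : (0 < t)%N ->
  (forall j, enorm (v j) <= b) -> enorm (vmix (W t) v i) <= b.
Proof.
move=> t0 h; have [h0 hr _] := stochW t0.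
apply: le_trans (enorm_sum _ _ _) _.
apply: (@le_trans _ _ (\sum_j W t i j * b)); last by rewrite -mulr_suml hr mul1r.
by apply: ler_sum => j _; rewrite enormZ ger0_norm // ler_wpM2l.
Qed.

(** Since [gamma i t * beta i t = t^-1] and [gamma i t = t `^ kappa / t], each step is
    a convex combination of the bound for the mixed multiplier and of
    [2 * B1 * t `^ kappa]. *)
Lemma q_norm_le t i : (0 < t)%N -> enorm (q t i) <= 2 * B1 * t%:R `^ kappa.
Proof.
have /andP[k0 k1] := kappa01.
elim: t i => // -[|t] IH i _.
  by rewrite (run_q1 run) enorm0 powR1 mulr1 mulr_ge0 // (B1_ge0 i).
rewrite (run_q run) //; apply: le_trans (enorm_pospart_le _) _.
apply: le_trans (enormD _ _) _; rewrite !enormZ (gtr0_norm (gamma_gt0 i _)) //.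
rewrite gamma_beta // ger0_norm; last by rewrite subr_ge0 invf_le1 ?ltr0n // ler1n.
have h1 : enorm (qtilde W q t.+2 i) <= 2 * B1 * t.+2%:R `^ kappa.
  rewrite qtildeE; apply: vmix_norm_le => // j; apply: le_trans (IH j isT) _.
  apply: ler_wpM2l; first by rewrite mulr_ge0 // (B1_ge0 i).
  by rewrite ge0_ler_powR ?nnegrE ?ler_nat // ltW.
have a0 : 0 <= 1 - t.+2%:R^-1 :> R by rewrite subr_ge0 invf_le1 ?ltr0n // ler1n.
have g0 := ltW (gamma_gt0 i (ltn0Sn t.+1)).
apply: le_trans (lerD (ler_wpM2l a0 h1) (ler_wpM2l g0 (cvec_le2 i (ltn0Sn t)))) _.
have -> : gamma i t.+2 = t.+2%:R^-1 * t.+2%:R `^ kappa.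
  rewrite -(gamma_beta i (ltn0Sn _)) /beta div1r mulfVK //.
by rewrite le_eqVlt; apply/orP; left; apply/eqP; ring.
Qed.

(** The mixed multipliers are nonnegative, hence equal to their positive part, and
    the positive part is nonexpansive. *)
Lemma q_perturbation_le t i : (0 < t)%N ->
  enorm (q t.+1 i - vmix (W t) (q t) i) <= 4 * B1 * t.+1%:R `^ (kappa - 1).
Proof.
move=> t0; have /andP[k0 k1] := kappa01.
have vpos : vmix (W t) (q t) i = pospart (vmix (W t) (q t) i).
  by rewrite pospart_id // => j; exact: (@qtilde_ge0 t.+1).
rewrite vpos (run_q run) ?ltnS //; apply: le_trans (pospart_lipschitz _ _) _.
rewrite qtildeE; set v := vmix _ _ _; set c := cvec _ _ _ _ _ _.
have -> : (1 - gamma i t.+1 * beta i t.+1) *: v + gamma i t.+1 *: c - v =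
    gamma i t.+1 *: (c - beta i t.+1 *: v).
  by apply/colP => j; rewrite !mxE; ring.
rewrite enormZ (gtr0_norm (gamma_gt0 i _)) // mulrC -(gammaE i); apply: ler_wpM2r.
  by rewrite ltW // gamma_gt0.
apply: le_trans (enormB _ _) _; rewrite enormZ (gtr0_norm (beta_gt0 i _)) //.
have h1 : enorm c <= 2 * B1 by exact: cvec_le2.
have h2 : enorm v <= 2 * B1 * t.+1%:R `^ kappa.
  apply: vmix_norm_le => // j; apply: le_trans (q_norm_le j t0) _.
  apply: ler_wpM2l; first by rewrite mulr_ge0 // (B1_ge0 i).
  by rewrite ge0_ler_powR ?nnegrE ?ler_nat // ltW.
have : beta i t.+1 * enorm v <= beta i t.+1 * (2 * B1 * t.+1%:R `^ kappa).
  by rewrite ler_wpM2l // ltW // beta_gt0.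
have -> : beta i t.+1 * (2 * B1 * t.+1%:R `^ kappa) = 2 * B1.
  by rewrite /beta; field; rewrite gt_eqF // powR_gt0 ?ltr0n.
by lra.
Qed.

(** The smoothing error per unit of slope, [r i / (t + 1)], plus the cost of
    shrinking the comparator, [Rd i / (t + 1)]. *)
Definition shrink_err i t : R := (r i + Rd i) / (t%:R + 1).

(** By how much the estimated first-order decrease of [phi] towards [z] exceeds
    the true gap between the decision and [y], up to the smoothing error. *)
Definition est_gap (phi : strategy R p R) (G : R) i t (z y : 'cV[R]_(p i)) : R :=
  slope phi i t * dotv (u t i) (x t i - z) - (phi i t x (x t i) - phi i t x y)
  + G * shrink_err i t.

(** The comparator is moved into the shrunk set of round [t] with the factor of that
    round. Since the sets grow, it is also admissible for the projection of round
    [t.+1], and the balls of radius [delta i t] around it stay in [X i]. *)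
Definition shrunk (y : trajectory R p) i t : 'cV[R]_(p i) := (1 - xi i t) *: y t i.

Definition total_gap (y : trajectory R p) i t : R :=
  est_gap f (Gf i) t (shrunk y i t) (y t i) +
  \sum_j vmix (W t) (q t) i j 0 *
    est_gap (constr_component g j) (Gg i) t (shrunk y i t) (y t i).

Lemma shrunk_in (y : trajectory R p) i t : (0 < t)%N -> X i (y t i) ->
  scale_set (1 - xi i t) (X i) (shrunk y i t).
Proof. by move=> t0 Xy; exists (y t i). Qed.

Lemma shrunk_norm (y : trajectory R p) i t : (0 < t)%N -> X i (y t i) ->
  enorm (shrunk y i t) <= Rd i.
Proof. by move=> t0 Xy; apply: X_norm; exact: shrunk_sub (shrunk_in t0 Xy). Qed.

(** [one_step] with the estimated gradients replaced by the function values for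
    which they stand; the differences are collected in [total_gap]. What remains of
    the multiplier [qt] is bounded by [rest_bound]. *)
Lemma step_ineq (y : trajectory R p) (qq : 'cV[R]_m) i t :
  (0 < t)%N -> X i (y t i) -> (forall j, 0 <= qq j 0) ->
  enorm (q t.+1 i - qq) ^+ 2 / (2 * gamma i t.+1) + total_gap y i t
    + (f i t x (x t i) - f i t x (y t i)) + dotv qq (g i t x (x t i))
  <= (1 - gamma i t.+1 * beta i t.+1) / (2 * gamma i t.+1)
        * enorm (vmix (W t) (q t) i - qq) ^+ 2
     + (enorm (x t i - shrunk y i t) ^+ 2 - enorm (x t.+1 i - shrunk y i t) ^+ 2)
        / (2 * alpha i t.+1)
     + alpha i t.+1 * ((p i)%:R ^+ 2 * Gf i ^+ 2 + m%:R * (p i)%:R ^+ 2 * Gg i ^+ 2 * enorm qq ^+ 2)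
     + beta i t.+1 / 2 * enorm qq ^+ 2
     + Gf i * shrink_err i t
     + dotv (vmix (W t) (q t) i) (g i t x (y t i))
     + (2 * gamma i t.+1 * B1 ^+ 2
        + 2 * B1 * (sm * Gg i * Rd i) * (if t == 1%N then 0 else 3 * gamma i t.+1 / t%:R)).
Proof.
move=> t0 Xy qq0; set z := shrunk y i t.
have zK : scale_set (1 - xi i t.+1) (X i) z.
  have /andP[h1 h2] := xi_bounds i t0.
  apply: (scale_set_mono (B_convex assB (i := i)) (ltW (r_gt0 i)) (B_inner assB (i := i)) _ _ (shrunk_in t0 Xy)); first by lra.
  rewrite lerD2l lerN2 /xi !div1r lef_pV2 ?posrE; rewrite -?natr1; have : 0 <= t%:R :> R by []; lra.
set qt := vmix (W t) (q t) i.
have a0 : 0 < alpha i t.+1 by rewrite /alpha divr_gt0 // powR_gt0 ltr0n.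
have g0 : 0 < gamma i t.+1 by exact: gamma_gt0.
have t1 : (1 < t.+1)%N by [].
have key := one_step a0 g0 (erefl (1 - gamma i t.+1 * beta i t.+1))
  (convex_scale_set (B_convex assB (i := i))) (nearest_x i t1) zK
  (erefl (cvec g delta u x t.+1 i)) (run_q run i t1) qq0.
rewrite /= qtildeE -/qt in key.
set c := cvec _ _ _ _ _ _ in key.
have hf : enorm (grad2f f delta u x i t) ^+ 2 <= (p i)%:R ^+ 2 * Gf i ^+ 2.
  rewrite grad2fE enormZ unit_u // mulr1 -exprMn ler_pXn2r ?nnegrE //.
    exact: slope_le (B_f assB i) t0.
  by rewrite mulr_ge0 // ltW // Gf_gt0.
have hA : enorm ((grad2g g delta u x i t)^T *m qq) ^+ 2 <=
    m%:R * (p i)%:R ^+ 2 * Gg i ^+ 2 * enorm qq ^+ 2.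
  rewrite grad2g_tr_mulmx enormZ unit_u // mulr1.
  have -> : m%:R * (p i)%:R ^+ 2 * Gg i ^+ 2 * enorm qq ^+ 2 =
      (sm * ((p i)%:R * Gg i) * enorm qq) ^+ 2.
    by rewrite -[m%:R in LHS](sqr_sqrtr (ler0n R m)) -/sm; ring.
  have h0 : 0 <= sm * ((p i)%:R * Gg i) * enorm qq.
    by rewrite mulr_ge0 // mulr_ge0 ?sm_ge0 // mulr_ge0 // ltW // Gg_gt0.
  rewrite ler_pXn2r ?nnegrE //; apply: le_trans (cauchy_schwarz _ _) _.
  by rewrite ler_wpM2r // slopes_norm.
have hal : alpha i t.+1 * (enorm (grad2f f delta u x i t) ^+ 2 +
      enorm ((grad2g g delta u x i t)^T *m qq) ^+ 2) <=
    alpha i t.+1 * ((p i)%:R ^+ 2 * Gf i ^+ 2 + m%:R * (p i)%:R ^+ 2 * Gg i ^+ 2 * enorm qq ^+ 2).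
  by rewrite ler_pM2l // lerD.
have e0 : 0 <= shrink_err i t.
  by rewrite divr_ge0 // addr_ge0 // ltW ?r_gt0 ?Rd_gt0.
have hM : total_gap y i t = dotv (grad2f f delta u x i t) (x t i - z)
    - (f i t x (x t i) - f i t x (y t i)) + Gf i * shrink_err i t
    + dotv qt (grad2g g delta u x i t *m (x t i - z) - g i t x (x t i))
    + dotv qt (g i t x (y t i)) + (\sum_j qt j 0) * (Gg i * shrink_err i t).
  rewrite grad2fE dotvZl grad2g_mulmx /total_gap -/z -/qt.
  have -> : \sum_j qt j 0 * est_gap (constr_component g j) (Gg i) t z (y t i) =
      dotv qt (dotv (u t i) (x t i - z) *: slopes i t - g i t x (x t i))
      + dotv qt (g i t x (y t i)) + (\sum_j qt j 0) * (Gg i * shrink_err i t).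
    rewrite -(dotvDr qt) [dotv qt _]/dotv mulr_suml -big_split; apply: eq_bigr => j _ /=.
    by rewrite !mxE /est_gap /slope /constr_component; ring.
  by rewrite /est_gap; ring.
have hqs : (\sum_j qt j 0) * (Gg i * shrink_err i t) <= sm * Gg i * shrink_err i t * enorm qt.
  have h : \sum_j qt j 0 <= sm * enorm qt.
    apply: le_trans (dotv_abs_sum_le qt); apply: ler_sum => j _; exact: ler_norm.
  have h0 : 0 <= Gg i * shrink_err i t by rewrite mulr_ge0 // ltW // Gg_gt0.
  by have := ler_wpM2r h0 h; rewrite mulrA; lra.
have hrest := @rest_bound R t t.+1%:R (gamma i t.+1) (beta i t.+1) (1 - gamma i t.+1 * beta i t.+1)
  B1 (sm * Gg i * Rd i) (enorm qt) (enorm c) (sm * Gg i * shrink_err i t) t0 erefl g0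
  (gamma_beta i (ltn0Sn t)) erefl.
have {}hrest := hrest ltac:(by rewrite !mulr_ge0 ?sm_ge0 // ltW ?Gg_gt0 ?Rd_gt0)
  (GR_le_B1 i) (enorm_ge0 _) (enorm_ge0 _) (cvec_le i t0).
have {}hrest := hrest _ _.
have hqc : - (gamma i t.+1 * beta i t.+1 * dotv qt c) <=
    gamma i t.+1 * beta i t.+1 * (enorm qt * enorm c).
  rewrite -mulrN ler_wpM2l //; first by rewrite gamma_beta // invr_ge0.
  by have := cauchy_schwarz qt c; rewrite ler_norml => /andP[h _]; lra.
rewrite hM.
have {}hrest : - ((1 - gamma i t.+1 * beta i t.+1) * beta i t.+1 / 2) * enorm qt ^+ 2 +
     gamma i t.+1 * beta i t.+1 * (enorm qt * enorm c) +
     gamma i t.+1 / 2 * enorm c ^+ 2 + sm * Gg i * shrink_err i t * enorm qt <=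
     2 * gamma i t.+1 * B1 ^+ 2 +
     2 * B1 * (sm * Gg i * Rd i) * (if t == 1%N then 0 else 3 * gamma i t.+1 / t%:R).
  apply: hrest.
    have c0 : 0 <= sm * Gg i / (t%:R + 1).
      by rewrite divr_ge0 // mulr_ge0 ?sm_ge0 // ltW // Gg_gt0.
    have hr : r i + Rd i <= 2 * Rd i by have := r_le_Rd i; lra.
    by rewrite /shrink_err -[t.+1%:R]natr1; have := ler_wpM2l c0 hr; lra.
  move=> tE; rewrite /qt /vmix big1 ?enorm0 // => j _.
  by rewrite tE (run_q1 run) scaler0.
by lra.
Qed.

Variables (E : nat -> rel 'I_n) (w : R) (iota : nat).
Hypotheses (n_gt0 : (0 < n)%N) (mixW : mixing_matrices E W) (assA : assumptionA E W w iota).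

Let i0 : 'I_n := Ordinal n_gt0.

(** With the weight [t `^ (1 - kappa) / 2] the dual part of one round telescopes:
    [(1 - gamma * beta) / (2 * gamma)] at round [t.+1] is at most this weight. *)
Definition dual_dist (qq : 'cV[R]_m) (t : nat) : R :=
  t%:R `^ (1 - kappa) / 2 * \sum_i enorm (q t i - qq) ^+ 2.

Lemma powR_kappa_split t : (0 < t)%N -> t%:R `^ kappa * t%:R `^ (1 - kappa) = t%:R :> R.
Proof.
move=> t0; rewrite -powRD ?pnatr_eq0 -?lt0n ?t0 ?implybT //.
by rewrite addrC subrK powRr1.
Qed.

(** With one common nonnegative multiplier the sum would be nonpositive, because
    the comparator satisfies the summed constraint. What exceeds this is due to the
    distance of the multipliers from their mean. *)
Lemma coupling_le (y : trajectory R p) t : (0 < t)%N ->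
  (forall i, X i (y t i)) -> (forall j, round_sum g t x (y t) j 0 <= 0) ->
  \sum_i dotv (vmix (W t) (q t) i) (g i t x (y t i)) <=
  sm * Fgmax * \sum_i enorm (vmix (W t) (q t) i - vmean (q t)).
Proof.
move=> t0 Xy gy.
have hm j : 0 <= vmean (q t) j 0.
  rewrite /vmean mxE summxE mulr_ge0 ?invr_ge0 //.
  by apply: sumr_ge0 => i _; exact: q_ge0.
have h0 : \sum_i dotv (vmean (q t)) (g i t x (y t i)) <= 0.
  rewrite -dotv_sumr -oppr_ge0 -sumrN; apply: sumr_ge0 => j _.
  by rewrite -mulrN mulr_ge0 // oppr_ge0; exact: gy.
rewrite mulr_sumr.
apply: (@le_trans _ _ (\sum_i dotv (vmix (W t) (q t) i - vmean (q t)) (g i t x (y t i)))).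
  under [leRHS]eq_bigr do rewrite dotvBl.
  by rewrite sumrB; lra.
apply: ler_sum => i _; apply: le_trans (dotv_le _ _) _; rewrite mulrC.
apply: ler_wpM2r => //; apply: le_trans (g_norm t0 (Xy i)) _.
by apply: ler_wpM2l; [exact: sm_ge0|exact: Fg_le_max].
Qed.

(** [step_ineq] summed over the learners, with the dual distances mixed by convexity
    and the comparator terms bounded by [coupling_le]. *)
Lemma round_ineq (y : trajectory R p) (qq : 'cV[R]_m) t :
  (0 < t)%N -> (forall i, X i (y t i)) -> (forall j, round_sum g t x (y t) j 0 <= 0) ->
  (forall j, 0 <= qq j 0) ->
  dual_dist qq t.+1 + \sum_i total_gap y i t
    + (round_sum f t x (x t) - round_sum f t x (y t)) + dotv qq (round_sum g t x (x t))
  <= dual_dist qq t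
     + \sum_i (t.+1%:R `^ kappa / 2 *
         (enorm (x t i - shrunk y i t) ^+ 2 - enorm (x t.+1 i - shrunk y i t) ^+ 2))
     + t.+1%:R `^ (- kappa) * \sum_i ((p i)%:R ^+ 2 * Gf i ^+ 2)
     + t.+1%:R `^ (- kappa) * (\sum_i (m%:R * (p i)%:R ^+ 2 * Gg i ^+ 2 + 2^-1)) * enorm qq ^+ 2
     + (t%:R + 1)^-1 * \sum_i (Gf i * (r i + Rd i))
     + sm * Fgmax * \sum_i enorm (vmix (W t) (q t) i - vmean (q t))
     + t.+1%:R `^ (kappa - 1) * (2 * n%:R * B1 ^+ 2)
     + (if t == 1%N then 0 else 3 * t.+1%:R `^ (kappa - 1) / t%:R)
         * \sum_i (2 * sm * B1 * Gg i * Rd i).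
Proof.
move=> t0 Xy gy qq0.
have hk0 : 0 < t.+1%:R `^ kappa :> R by rewrite powR_gt0.
have hk1 : 0 < t.+1%:R `^ (1 - kappa) :> R by rewrite powR_gt0.
have hkk := powR_kappa_split (ltn0Sn t).
set e := t.+1%:R `^ (1 - kappa) in hk1 hkk *; set wk := t.+1%:R `^ kappa in hk0 hkk *.
have tS0 : 0 < t.+1%:R :> R by [].
set N := enorm qq ^+ 2; set b := t.+1%:R `^ (- kappa).
set ga := t.+1%:R `^ (kappa - 1).
have gaE : ga = e^-1 by rewrite /ga -(opprB 1) powRN.
have bE : b = wk^-1 by rewrite /b powRN.
set v := if t == 1%N then 0 else _.
have step i : e / 2 * enorm (q t.+1 i - qq) ^+ 2 + total_gap y i t
    + (f i t x (x t i) - f i t x (y t i)) + dotv qq (g i t x (x t i))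
  <= t%:R * b / 2 * enorm (vmix (W t) (q t) i - qq) ^+ 2
     + wk / 2 * (enorm (x t i - shrunk y i t) ^+ 2 - enorm (x t.+1 i - shrunk y i t) ^+ 2)
     + b * ((p i)%:R ^+ 2 * Gf i ^+ 2)
     + b * (m%:R * (p i)%:R ^+ 2 * Gg i ^+ 2 + 2^-1) * N
     + (t%:R + 1)^-1 * (Gf i * (r i + Rd i))
     + dotv (vmix (W t) (q t) i) (g i t x (y t i))
     + ga * (2 * B1 ^+ 2)
     + v * (2 * sm * B1 * Gg i * Rd i).
  have := step_ineq t0 (Xy i) qq0.
  have -> : (if t == 1%N then 0 else 3 * gamma i t.+1 / t%:R) = v by rewrite gammaE.
  rewrite gammaE -/ga (_ : beta i t.+1 = b) ?/beta ?div1r ?bE // (_ : alpha i t.+1 = b) ?/alpha ?div1r ?bE //.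
  have -> : 1 - ga / wk = t%:R / t.+1%:R.
    have -> : t%:R = t.+1%:R - 1 :> R by rewrite -[t.+1%:R]natr1 addrK.
    by rewrite -hkk gaE; field; rewrite !gt_eqF.
  have -> : enorm (q t.+1 i - qq) ^+ 2 / (2 * ga) = e / 2 * enorm (q t.+1 i - qq) ^+ 2.
    by rewrite gaE; field; rewrite gt_eqF.
  have -> : t%:R / t.+1%:R / (2 * ga) = t%:R / wk / 2.
    by rewrite gaE -hkk; field; rewrite !gt_eqF.
  have h1 a : a / (2 / wk) = wk / 2 * a by field; rewrite gt_eqF.
  rewrite h1 /shrink_err -/N; lra.
move: step; move: (total_gap y) => Mt step.
have h := ler_sum (index_enum 'I_n) (fun i (_ : true) => step i).
rewrite !big_split /= in h.
have hmix : t%:R * b / 2 * \sum_i enorm (vmix (W t) (q t) i - qq) ^+ 2 <= dual_dist qq t.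
  rewrite /dual_dist; apply: ler_pM.
  - by rewrite !mulr_ge0 ?powR_ge0.
  - by apply: sumr_ge0 => i _; rewrite exprn_ge0.
  - rewrite ler_pM2r ?invr_gt0 //.
    have tb : t%:R * b = t%:R `^ kappa * b * t%:R `^ (1 - kappa).
      by rewrite -{1}(powR_kappa_split t0); ring.
    rewrite tb -[leRHS]mul1r; apply: ler_wpM2r; first exact: powR_ge0.
    have /andP[k0 _] := kappa01.
    by rewrite bE ler_pdivrMr // mul1r ge0_ler_powR ?nnegrE ?ler_nat // ltW.
  - exact: sum_dist_mix_le n_gt0 (stochW t0).
have hc := coupling_le t0 Xy gy.
have hn : \sum_(i < n) ga * (2 * B1 ^+ 2) = ga * (2 * n%:R * B1 ^+ 2).
  by rewrite sum_cst_ord; ring.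
rewrite hn -mulr_suml -!mulr_sumr sumrN in h.
rewrite [dual_dist qq t.+1]/dual_dist /round_sum dotv_sumr -/e -!mulr_sumr.
lra.
Qed.

Let tau := (1 - w / (2 * n%:R ^+ 2)) ^- 2.
Let lambda := (1 - w / (2 * n%:R ^+ 2)) `^ (1 / iota%:R).
Let C0 := 6 * n%:R ^+ 2 * sm * tau * B1 * Fgmax / (1 - lambda) + 2 * n%:R * B1 ^+ 2.
Let C3 := \sum_(i < n) (2 * Gf i * (r i + Rd i) + 8 * Rd i ^+ 2
                          + 2 * sm * B1 * Gg i * Rd i / kappa
                          + (p i)%:R ^+ 2 * Gf i ^+ 2 / (1 - kappa))
            + C0 / kappa.
Let C41 := \sum_(i < n)
    2 * ((2 * m%:R * (p i)%:R ^+ 2 * Gg i ^+ 2 + 1) / (1 - kappa) + 1).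

Lemma mixing_rate_bounds : 0 < w / (2 * n%:R ^+ 2) < 1.
Proof.
have /andP[w0 w1] := A_w assA.
have n1 : 1 <= n%:R ^+ 2 :> R by rewrite exprn_ege1 // ler1n.
have n20 : 0 < 2 * n%:R ^+ 2 :> R by lra.
by rewrite divr_gt0 //= ltr_pdivrMr // mul1r; lra.
Qed.

Lemma lambda_bounds : 0 < lambda < 1.
Proof.
have /andP[a0 a1] := mixing_rate_bounds.
rewrite powR_gt0 /=; last by lra.
have h1 : 1 = 1 `^ (1 / iota%:R) :> R by rewrite powR1.
rewrite [ltRHS]h1 gt0_ltr_powR ?nnegrE //; try lra.
by rewrite div1r invr_gt0 ltr0n; exact: A_iota assA.
Qed.

(** Factoring [1 - lambda ^+ iota = w / (2 * n ^+ 2)] by [1 - lambda] bounds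
    [1 - lambda] from above; [tau] compensates for the powers of [lambda]. *)
Lemma mixing_time : iota%:R * (2 * n%:R ^+ 2 / w) <= tau / (1 - lambda).
Proof.
have /andP[w0 w1] := A_w assA; have /andP[l0 l1] := lambda_bounds.
have /andP[] := mixing_rate_bounds.
rewrite /tau; set a := w / (2 * n%:R ^+ 2) => a0 a1.
have lE : lambda ^+ iota = 1 - a.
  have in0 : iota%:R != 0 :> R by rewrite pnatr_eq0 -lt0n; exact: A_iota assA.
  rewrite -(powR_mulrn iota (ltW l0)) /lambda -/a -powRrM div1r mulVf // powRr1 //.
  by rewrite subr_ge0 ltW.
have hle : (1 - lambda) * (iota%:R * (1 - a)) <= a.
  have hS : (1 - lambda) * \sum_(k < iota) lambda ^+ k = a.
    by have := subrX1 lambda iota; rewrite lE; lra.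
  rewrite -[leRHS]hS ler_pM2l ?subr_gt0 // -lE -(sum_cst_ord iota); apply: ler_sum => k _.
  by apply: ler_wiXn2l; [exact: ltW|exact: ltW|exact: ltnW].
have -> : 2 * n%:R ^+ 2 / w = a^-1 by rewrite /a invf_div.
have h1a : 0 < 1 - a by rewrite subr_gt0.
have h2 : (1 - lambda) * (iota%:R * (1 - a)) * (1 - a) <= a * 1.
  by apply: ler_pM => //; [rewrite !mulr_ge0 //; lra|lra|lra].
rewrite ler_pdivlMr ?subr_gt0 // -[leRHS]mul1r ler_pdivlMr ?exprn_gt0 //.
have -> : iota%:R * a^-1 * (1 - lambda) * (1 - a) ^+ 2 =
    (1 - lambda) * (iota%:R * (1 - a)) * (1 - a) / a by field; rewrite gt_eqF.
by rewrite ler_pdivrMr // mul1r; lra.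
Qed.

(** The shrunk comparator also moves because the shrinking factor changes. *)
Lemma shrunk_step (y : trajectory R p) i t : (0 < t)%N -> X i (y t i) ->
  enorm (shrunk y i t.+1 - shrunk y i t) <=
  enorm (y t.+1 i - y t i) + Rd i * (xi i t - xi i t.+1).
Proof.
move=> t0 Xy; have /andP[h1 h2] := xi_bounds i (ltn0Sn t).
have hmono : 0 <= xi i t - xi i t.+1.
  by rewrite subr_ge0 /xi !div1r lef_pV2 ?posrE ?ltr_wpDl // lerD2r ler_nat.
have -> : shrunk y i t.+1 - shrunk y i t =
    (1 - xi i t.+1) *: (y t.+1 i - y t i) + (xi i t - xi i t.+1) *: y t i.
  by apply/colP => j; rewrite !mxE; ring.
apply: le_trans (enormD _ _) _; rewrite !enormZ; apply: lerD.
  rewrite ger0_norm; last by lra.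
  by rewrite -[leRHS]mul1r ler_wpM2r //; lra.
by rewrite ger0_norm // mulrC ler_wpM2r //; exact: X_norm.
Qed.

(** [primal_telescope] for the shrunk comparator; the movement due to the changing
    shrinking factors telescopes to at most [Rd i / 2]. *)
Lemma primal_sum_le (y : trajectory R p) i T : (0 < T)%N ->
  (forall t, (0 < t <= T)%N -> X i (y t i)) ->
  \sum_(1 <= t < T.+1) t.+1%:R `^ kappa / 2 *
    (enorm (x t i - shrunk y i t) ^+ 2 - enorm (x t.+1 i - shrunk y i t) ^+ 2)
  <= T%:R `^ kappa * (8 * Rd i ^+ 2)
     + 2 * Rd i * T%:R `^ kappa * \sum_(1 <= t < T) enorm (y t.+1 i - y t i).
Proof.
move=> T0 Xy; have /andP[k0 k1] := kappa01.
have R0 := ltW (Rd_gt0 i).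
have pmono s t : (s <= t)%N -> s%:R `^ kappa <= t%:R `^ kappa :> R.
  by move=> st; rewrite ge0_ler_powR ?nnegrE ?ler_nat // ltW.
have := @primal_telescope R (p i) (x ^~ i) (shrunk y i) (fun t => t.+1%:R `^ kappa / 2) (Rd i) T T0.
move=> /(_ _ _ _ _)/wrap[].
- by move=> t t0; apply: X_norm; exact: x_in.
- by move=> t tT; apply: shrunk_norm; [case/andP: tT|exact: Xy].
- by move=> t; rewrite divr_ge0 // powR_ge0.
- by move=> t; rewrite ler_pM2r ?invr_gt0 // pmono.
move=> h; apply: le_trans h _.
have hT : T.+1%:R `^ kappa <= 2 * T%:R `^ kappa.
  apply: (@le_trans _ _ ((2 * T%:R) `^ kappa)).
    apply: ge0_ler_powR; rewrite ?nnegrE ?mulr_ge0 //; first exact: ltW.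
    by rewrite -natrM ler_nat mul2n -addnn -addn1 leq_add2l.
  rewrite powRM // ler_wpM2r ?powR_ge0 //.
  by rewrite -[leRHS]powRr1 // ler_powR ?ler1n // ltW.
have hsum : \sum_(1 <= t < T) 4 * Rd i * (t.+1%:R `^ kappa / 2 * enorm (shrunk y i t.+1 - shrunk y i t))
   <= 2 * Rd i * T%:R `^ kappa * \sum_(1 <= t < T)
        (enorm (y t.+1 i - y t i) + Rd i * (xi i t - xi i t.+1)).
  rewrite mulr_sumr !big_nat; apply: ler_sum => t /andP[t0 tT].
  have hs := shrunk_step t0 (Xy t ltac:(by rewrite t0 ltnW)).
  have : t.+1%:R `^ kappa * enorm (shrunk y i t.+1 - shrunk y i t) <=
    T%:R `^ kappa * (enorm (y t.+1 i - y t i) + Rd i * (xi i t - xi i t.+1)).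
    by apply: ler_pM => //; exact: pmono.
  by move=> /(ler_wpM2l R0); lra.
have htel : \sum_(1 <= t < T) Rd i * (xi i t - xi i t.+1) <= Rd i / 2.
  rewrite -mulr_sumr ler_wpM2l //.
  rewrite (eq_bigr (fun t => - xi i t.+1 - (- xi i t))); last by move=> t _; rewrite opprK addrC.
  rewrite telescope_sumr // opprK.
  have /andP[h1 _] := xi_bounds i T0; have /andP[_ h2] := xi_bounds i (ltn0Sn 0).
  by lra.
rewrite big_split /= in hsum.
have := ler_wpM2l (mulr_ge0 (mulr_ge0 (ler0n R 2) R0) (powR_ge0 T%:R kappa)) htel.
have := ler_wpM2r (exprn_ge0 2 R0) hT.
have : 0 <= T%:R `^ kappa * Rd i ^+ 2 by rewrite mulr_ge0 ?powR_ge0 // sqr_ge0.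
by lra.
Qed.

Let mx := Num.max kappa (1 - kappa).

Lemma powR_nat_le (T : nat) (a b : R) : (0 < T)%N -> a <= b -> T%:R `^ a <= T%:R `^ b.
Proof. by move=> T0 ab; rewrite ler_powR // ler1n. Qed.

Lemma sum_harmonic_le T : (0 < T)%N ->
  \sum_(1 <= t < T.+1) (t%:R + 1)^-1 <= 2 * T%:R `^ mx.
Proof.
move=> T0; have /andP[k0 k1] := kappa01.
have m0 : 2^-1 <= mx by rewrite /mx le_max; apply/orP; have [h|h] := leP 2^-1 kappa; [left|right; lra].
have m1 : mx <= 1 by rewrite /mx ge_max; lra.
apply: (@le_trans _ _ (T%:R `^ mx / mx)).
  apply: le_trans (sum_powRS T _ m1); last by lra.
  apply: ler_sum => t _; rewrite natr1 -powR_inv1 // ler_powR ?ler1n //; lra.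
rewrite mulrC ler_wpM2r ?powR_ge0 // -[leRHS]invrK lef_pV2 ?posrE //; lra.
Qed.

(** The multipliers follow the mixing up to perturbations of size
    [4 * B1 * t `^ (kappa - 1)]. *)
Lemma consensus_sum_le T :
  sm * Fgmax * \sum_(1 <= t < T.+1) \sum_i enorm (vmix (W t) (q t) i - vmean (q t))
  <= 6 * n%:R ^+ 2 * sm * tau * B1 * Fgmax / (1 - lambda) * (T%:R `^ kappa / kappa).
Proof.
have /andP[k0 k1] := kappa01; have /andP[w0 w1] := A_w assA.
have B0 := B1_ge0 i0; have s0 := sm_ge0.
have F0 : 0 <= Fgmax by apply: le_trans (Fg_le_max i0); rewrite ltW // Fg_gt0.
have nR : 0 < n%:R :> R by rewrite ltr0n.
have hcons := @perturbed_consensus R n m E W w iota n_gt0 mixW assA q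
  (fun t => 4 * B1 * t%:R `^ (kappa - 1)) T (run_q1 run)
  (fun t => mulr_ge0 (mulr_ge0 (ler0n R 4) B0) (powR_ge0 _ _))
  (fun t i t0 => q_perturbation_le i t0).
have hsum : \sum_(1 <= t < T.+1) 4 * B1 * t.+1%:R `^ (kappa - 1) <= 4 * B1 * (T%:R `^ kappa / kappa).
  by rewrite -mulr_sumr ler_wpM2l ?mulr_ge0 // sum_powRS // ltW.
set Z := iota%:R * (2 * n%:R ^+ 2 / w).
have Z0 : 0 <= Z by apply: mulr_ge0 => //; apply: divr_ge0; [rewrite mulr_ge0 // exprn_ge0|exact: ltW].
have hn : n%:R * (iota%:R * (n%:R ^+ 3 / w)) = n%:R ^+ 2 / 2 * Z.
  by rewrite /Z; field; rewrite gt_eqF.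
set K := T%:R `^ kappa / kappa in hsum *.
have K0 : 0 <= K by rewrite divr_ge0 ?powR_ge0 // ltW.
have hZ : Z <= tau / (1 - lambda) by exact: mixing_time.
rewrite hn in hcons.
have c0 : 0 <= n%:R ^+ 2 / 2 * Z by rewrite mulr_ge0 // divr_ge0 // exprn_ge0.
have h1 := le_trans hcons (ler_wpM2l c0 hsum).
have h2 := ler_wpM2l (mulr_ge0 s0 F0) h1.
apply: le_trans h2 _; clearbody K Z.
have D0 : 0 <= 6 * n%:R ^+ 2 * sm * B1 * Fgmax * K by rewrite !mulr_ge0 ?exprn_ge0.
have h3 := ler_wpM2l D0 hZ.
have D1 : 0 <= n%:R ^+ 2 * sm * B1 * Fgmax * K * Z by rewrite !mulr_ge0 ?exprn_ge0.
by lra.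
Qed.

(** The sum of [round_ineq] over the rounds: the dual distances telescope, the primal
    ones are bounded by [primal_sum_le], and the step sizes by sums of powers. *)
Lemma pathwise (y : trajectory R p) (qq : 'cV[R]_m) T : (0 < T)%N ->
  (forall t i, (0 < t <= T)%N -> X i (y t i)) ->
  (forall t j, (0 < t <= T)%N -> round_sum g t x (y t) j 0 <= 0) ->
  (forall j, 0 <= qq j 0) ->
  \sum_(1 <= t < T.+1) \sum_i total_gap y i t + regret f T x y
    + dotv qq (\sum_(1 <= t < T.+1) round_sum g t x (x t))
  <= C41 / 4 * T%:R `^ (1 - kappa) * enorm qq ^+ 2
     + (C3 * T%:R `^ mx + 2 * Rmax * T%:R `^ kappa * path_length T y).
Proof.
move=> T0 Xy gy qq0; have /andP[k0 k1] := kappa01.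
have B0 := B1_ge0 i0; have s0 := sm_ge0.
set N := enorm qq ^+ 2; have N0 : 0 <= N by rewrite exprn_ge0.
have hsumt : \sum_(1 <= t < T.+1) (dual_dist qq t.+1 + \sum_i total_gap y i t
    + (round_sum f t x (x t) - round_sum f t x (y t)) + dotv qq (round_sum g t x (x t))) <=
  \sum_(1 <= t < T.+1) (dual_dist qq t
     + \sum_i (t.+1%:R `^ kappa / 2 *
         (enorm (x t i - shrunk y i t) ^+ 2 - enorm (x t.+1 i - shrunk y i t) ^+ 2))
     + t.+1%:R `^ (- kappa) * \sum_i ((p i)%:R ^+ 2 * Gf i ^+ 2)
     + t.+1%:R `^ (- kappa) * (\sum_i (m%:R * (p i)%:R ^+ 2 * Gg i ^+ 2 + 2^-1)) * N
     + (t%:R + 1)^-1 * \sum_i (Gf i * (r i + Rd i))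
     + sm * Fgmax * \sum_i enorm (vmix (W t) (q t) i - vmean (q t))
     + t.+1%:R `^ (kappa - 1) * (2 * n%:R * B1 ^+ 2)
     + (if t == 1%N then 0 else 3 * t.+1%:R `^ (kappa - 1) / t%:R)
         * \sum_i (2 * sm * B1 * Gg i * Rd i)).
  rewrite !big_nat; apply: ler_sum => t /andP[t0 tT].
  have ht : (0 < t <= T)%N by rewrite t0.
  by apply: round_ineq => // [i|j]; [exact: Xy|exact: gy].
rewrite /regret dotv_sumr.
move: hsumt; move: (total_gap y) => Mt.
have htel : \sum_(1 <= t < T.+1) dual_dist qq t.+1 =
    \sum_(1 <= t < T.+1) dual_dist qq t + (dual_dist qq T.+1 - dual_dist qq 1).
  by rewrite -telescope_sumr // -big_split; apply: eq_bigr => t _ /=; rewrite addrC subrK.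
have hD1 : dual_dist qq 1 = n%:R / 2 * N.
  rewrite /dual_dist powR1 (eq_bigr (fun=> N)) ?sum_cst_ord; last first.
    by move=> i _; rewrite (run_q1 run) sub0r enormN.
  by ring.
have hDT : 0 <= dual_dist qq T.+1.
  by rewrite mulr_ge0 ?divr_ge0 ?powR_ge0 //; apply: sumr_ge0 => i _; rewrite exprn_ge0.
move: htel hD1 hDT; move: (dual_dist qq) => Dq htel hD1 hDT hsumt.
rewrite !big_split /= sumrN in hsumt.
rewrite -!mulr_suml -mulr_sumr htel hD1 sum_cst_ord in hsumt.
set Sb := \sum_(1 <= t < T.+1) _ `^ (- kappa) in hsumt.
set Se := \sum_(1 <= t < T.+1) (_ + 1)^-1 in hsumt.
set Sg := \sum_(1 <= t < T.+1) _ `^ (kappa - 1) in hsumt.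
set Sv := \sum_(1 <= t < T.+1) (if _ then _ else _) in hsumt.
set A1 := \sum_i Gf i * _ in hsumt.
set A3 := \sum_i 2 * sm * _ * _ * _ in hsumt.
set A4 := \sum_i (p i)%:R ^+ 2 * _ in hsumt.
set A5 := \sum_i m%:R * _ * _ in hsumt.
have hcons := consensus_sum_le T.
set Cs := \sum_(1 <= t < T.+1) \sum_i enorm (vmix _ _ _ - _) in hcons hsumt.
set Pr := \sum_(1 <= t < T.+1) \sum_i (_ / 2 * (_ - _)) in hsumt.
have hPr : Pr <= T%:R `^ kappa * (8 * \sum_i Rd i ^+ 2) + 2 * Rmax * T%:R `^ kappa * path_length T y.
  rewrite /Pr [leLHS]exchange_big /path_length /=.
  apply: (@le_trans _ _ (\sum_i (T%:R `^ kappa * (8 * Rd i ^+ 2)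
      + 2 * Rmax * T%:R `^ kappa * \sum_(1 <= t < T) enorm (y t.+1 i - y t i)))); last first.
    by rewrite big_split /= -!mulr_sumr [X in _ <= _ + _ * X]exchange_big.
  apply: ler_sum => i _; have := @primal_sum_le y i T T0 (fun t ht => Xy t i ht).
  move=> /le_trans; apply; rewrite lerD2l ler_wpM2r ?sumr_ge0 //.
  by rewrite ler_wpM2r ?powR_ge0 // ler_wpM2l //; exact: (@le_bigmax _ _ _ 0 Rd i).
have C41E : C41 = 2 * ((2 * A5 + n%:R) / (1 - kappa) + n%:R).
  rewrite /C41 -mulr_sumr big_split /= sum_cst_ord mulr1 -mulr_suml big_split /= sum_cst_ord mulr1.
  congr (2 * ((_ + _) / _ + _)); rewrite /A5 mulr_sumr; apply: eq_bigr => i _; ring.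
have C3E : C3 = 2 * A1 + 8 * (\sum_i Rd i ^+ 2) + A3 / kappa + A4 / (1 - kappa) + C0 / kappa.
  rewrite /C3 !big_split /= -!mulr_suml -mulr_sumr; congr (_ + _ + _ / _ + _ + _).
  by rewrite /A1 mulr_sumr; apply: eq_bigr => i _; ring.
have pos1 : 0 <= A1.
  by apply: sumr_ge0 => i _; rewrite mulr_ge0 ?addr_ge0 // ltW ?Gf_gt0 ?r_gt0 ?Rd_gt0.
have pos3 : 0 <= A3.
  by apply: sumr_ge0 => i _; exact: (mulr_ge0 (mulr_ge0 (mulr_ge0 (mulr_ge0 (ler0n R 2) s0) B0) (ltW (Gg_gt0 i))) (ltW (Rd_gt0 i))).
have pos4 : 0 <= A4 by apply: sumr_ge0 => i _; rewrite mulr_ge0 ?sqr_ge0.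
have pos5 : 0 <= A5 by apply: sumr_ge0 => i _; apply: mulr_ge0; [apply: mulr_ge0; [exact: ler0n|exact: sqr_ge0]|exact: sqr_ge0].
have posR : 0 <= \sum_i Rd i ^+ 2 by apply: sumr_ge0 => i _; rewrite sqr_ge0.
have hSb : Sb <= T%:R `^ (1 - kappa) / (1 - kappa).
  have := @sum_powRS R (1 - kappa) T ltac:(lra) ltac:(lra).
  by rewrite (_ : 1 - kappa - 1 = - kappa) //; ring.
have hSg : Sg <= T%:R `^ kappa / kappa by apply: sum_powRS => //; exact: ltW.
have hSv : Sv <= T%:R `^ kappa / kappa by apply: sum_powRS_div => //; exact: ltW.
have hSe : Se <= 2 * T%:R `^ mx by exact: sum_harmonic_le.
have hk : T%:R `^ kappa <= T%:R `^ mx by apply: powR_nat_le => //; rewrite le_max lexx.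
have hk' : T%:R `^ (1 - kappa) <= T%:R `^ mx.
  by apply: powR_nat_le => //; rewrite le_max lexx orbT.
have h1 : 1 <= T%:R `^ (1 - kappa).
  by rewrite -[leLHS](powRr0 T%:R); apply: powR_nat_le => //; lra.
rewrite C41E C3E.
set S2 := \sum_i Rd i ^+ 2 in posR hPr *.
set Tk := T%:R `^ kappa in hcons hPr hSg hSv hk *; set Tb := T%:R `^ (1 - kappa) in hSb hk' h1 *.
set Tm := T%:R `^ mx in hSe hk hk' *.
have ki0 : 0 < kappa^-1 by rewrite invr_gt0.
have li0 : 0 < (1 - kappa)^-1 by rewrite invr_gt0 subr_gt0.
have b1 : Sb * A4 <= Tm * (1 - kappa)^-1 * A4.
  by rewrite ler_wpM2r //; apply: le_trans hSb _; rewrite ler_pM2r.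
have b2 : Sb * (A5 + n%:R * 2^-1) * N <= Tb * (1 - kappa)^-1 * (A5 + n%:R * 2^-1) * N.
  by rewrite ler_wpM2r // ler_wpM2r // addr_ge0 // mulr_ge0 // invr_ge0.
have b3 : n%:R / 2 * N <= Tb * (n%:R / 2 * N).
  by rewrite -[leLHS]mul1r ler_wpM2r // mulr_ge0 // divr_ge0.
have b4 : Se * A1 <= 2 * Tm * A1 by rewrite ler_wpM2r.
have C0E : C0 = 6 * n%:R ^+ 2 * sm * tau * B1 * Fgmax / (1 - lambda) + 2 * n%:R * B1 ^+ 2 by [].
set Ca := _ / (1 - lambda) in hcons C0E.
have Ca0 : 0 <= Ca.
  have F0 : 0 <= Fgmax by apply: le_trans (Fg_le_max i0); rewrite ltW // Fg_gt0.
  have /andP[l0 l1] := lambda_bounds.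
  have tau0 : 0 <= tau.
    rewrite /tau invr_ge0 exprn_ge0 // subr_ge0.
    by have /andP[_ /ltW] := mixing_rate_bounds.
  apply: divr_ge0; last by rewrite subr_ge0 ltW.
  exact: (mulr_ge0 (mulr_ge0 (mulr_ge0 (mulr_ge0 (mulr_ge0 (ler0n R 6) (sqr_ge0 _)) s0) tau0) B0) F0).
have hTkm : Tk / kappa <= Tm / kappa by rewrite ler_pM2r.
have b5 : Ca * (Tk / kappa) <= Ca * (Tm / kappa) by exact: (ler_wpM2l Ca0 hTkm).
have nB0 : 0 <= 2 * n%:R * B1 ^+ 2.
  exact: (mulr_ge0 (mulr_ge0 (ler0n R 2) (ler0n R n)) (sqr_ge0 B1)).
have b6 : Sg * (2 * n%:R * B1 ^+ 2) <= Tm / kappa * (2 * n%:R * B1 ^+ 2).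
  by rewrite ler_wpM2r // (le_trans hSg).
have b7 : Sv * A3 <= Tm / kappa * A3 by rewrite ler_wpM2r // (le_trans hSv).
have b8 : Tk * (8 * S2) <= Tm * (8 * S2) by rewrite ler_wpM2r // mulr_ge0.
rewrite C0E.
by lra.
Qed.

End Run.

(** * Measurability of vector-valued functions *)

Section VectorMeasurability.
Context {R : realType}.

Lemma measurable_fun_gt d (T : measurableType d) (h : T -> R) :
  (forall y, measurable [set a | y < h a]) -> measurable_fun setT h.
Proof.
move=> mh; apply: (measurability _ (measurable_realfun.RGenOInfty.measurableE R)).
move=> _ [_ [y ->] <-]; rewrite setTI (_ : _ @^-1` _ = [set a | y < h a]) //.
by apply/seteqP; split => a /=; rewrite in_itv /= andbT.
Qed.

Lemma measurable_gt d (T : measurableType d) (h : T -> R) y :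
  measurable_fun setT h -> measurable [set a | y < h a].
Proof.
move=> mh; have := mh measurableT `]y, +oo[%classic (measurable_itv _).
rewrite setTI (_ : _ @^-1` _ = [set a | y < h a]) //.
by apply/seteqP; split => a /=; rewrite in_itv /= andbT.
Qed.

Lemma measurable_lt d (T : measurableType d) (h : T -> R) y :
  measurable_fun setT h -> measurable [set a | h a < y].
Proof.
move=> mh; have := mh measurableT `]-oo, y[%classic (measurable_itv _).
rewrite setTI (_ : _ @^-1` _ = [set a | h a < y]) //.
Qed.

(** Measurability for the Borel sets of the vector space, stated by coordinates; the
    equivalence is [borel_mvec] and [mvec_borel]. *)
Definition mvec d (T : measurableType d) k (V : T -> 'cV[R]_k) :=
  forall j, measurable_fun setT (fun a => V a j 0).

Lemma preimage_sigma d (T : measurableType d) (S : Type) (G : set (set S)) (V : T -> S) :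
  (forall A, G A -> measurable (V @^-1` A)) ->
  forall A, <<s G >> A -> measurable (V @^-1` A).
Proof.
move=> hG; suff : <<s G >> `<=` [set A | measurable (V @^-1` A)] by [].
apply: smallest_sub.
  split => /= [|A mA|F mF].
  - by rewrite preimage_set0.
  - by rewrite setTD preimage_setC; exact: measurableC.
  - by rewrite preimage_bigcup; exact: bigcupT_measurable.
by move=> A /hG.
Qed.

Lemma borel_mvec d (T : measurableType d) k (V : T -> 'cV[R]_k) :
  (forall A, borel A -> measurable (V @^-1` A)) -> mvec V.
Proof.
move=> hV j; apply: measurable_fun_gt => y.
have oA : open [set v : 'cV[R]_k | y < v j 0].
  have -> : [set v : 'cV[R]_k | y < v j 0] = (fun v : 'cV[R]_k => v j 0) @^-1` `]y, +oo[%classic.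
    by apply/seteqP; split => v /=; rewrite in_itv /= andbT.
  by apply: open_comp => [v _|]; [exact: coord_continuous|exact: interval_open].
by apply: (hV [set v | y < v j 0]); exact: sub_sigma_algebra.
Qed.

(** Boxes with rational centers and radii [1 / (i.2 + 1)]: a countable base. *)
Definition box k (i : 'cV[rat]_k * nat) : set 'cV[R]_k :=
  [set v | forall j, `|v j 0 - ratr (i.1 j 0)| < i.2.+1%:R^-1].

Lemma box_exists k (v : 'cV[R]_k) (e : nat) : exists c : 'cV[rat]_k, box (c, e) v.
Proof.
have h j : exists c : rat, `|v j 0 - ratr c| < e.+1%:R^-1.
  have e0 : 0 < e.+1%:R^-1 :> R by rewrite invr_gt0.
  have : v j 0 < v j 0 + e.+1%:R^-1 by rewrite ltrDl.
  move=> /rat_in_itvoo[c]; rewrite in_itv /= => /andP[h1 h2]; exists c.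
  rewrite ltr_norml; move: e0 h1 h2; move: (ratr c : R) (e.+1%:R^-1 : R) => z e1 e0 h1 h2.
  by apply/andP; split; lra.
exists (\col_j projT1 (cid (h j))) => j /=; rewrite mxE.
by case: cid.
Qed.

Lemma mvec_box d (T : measurableType d) k (V : T -> 'cV[R]_k) i :
  mvec V -> measurable (V @^-1` box i).
Proof.
move=> mV; rewrite (_ : _ @^-1` _ = \bigcap_(j in [set: 'I_k])
    ([set a | ratr (i.1 j 0) - i.2.+1%:R^-1 < V a j 0] `&`
     [set a | V a j 0 < ratr (i.1 j 0) + i.2.+1%:R^-1])).
  apply: fin_bigcap_measurable => // j _.
  by apply: measurableI; [exact: measurable_gt|exact: measurable_lt].
apply/seteqP; split => [a /= h j _|a /= h j].
  have := h j; rewrite ltr_norml => /andP[].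
  by rewrite /mkset /=; move: (ratr _ : R) (_.+1%:R^-1 : R) => y z h1 h2; split => /=; lra.
have [] := h j I => /=; move: (ratr _ : R) (_.+1%:R^-1 : R) => y z h1 h2.
by rewrite ltr_norml; apply/andP; split; lra.
Qed.

(** An open set is a countable union of rational boxes. *)
Lemma mvec_borel d (T : measurableType d) k (V : T -> 'cV[R]_k) :
  mvec V -> forall A, borel A -> measurable (V @^-1` A).
Proof.
move=> mV; apply: preimage_sigma => O oO.
rewrite (_ : _ @^-1` _ = \bigcup_(i : 'cV[rat]_k * nat)
    (if `[< box i `<=` O >] then V @^-1` box i else set0)).
  apply: countable_bigcupT_measurable; first exact: countableP.
  by move=> i; case: ifP => // _; exact: mvec_box.
apply/seteqP; split => [a /= Oa|a [i _]]; last by case: ifP => // /asboolP h /h.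
have /nbhs_ballP[e /= e0 he] : nbhs (V a) O by exact: open_nbhs_nbhs.
have [N hN] : exists N : nat, 2 / e < N.+1%:R.
  exists (Num.truncn (2 / e)); apply: truncnS_gt.
have [c hc] := box_exists (V a) N.
exists (c, N) => //; case: ifP => [_ //|/asboolP []] v hv; apply: he.
split => // j j'; rewrite (ord1 j').
have h1 := hc j; have h2 := hv j; rewrite /= in h1 h2.
rewrite -ball_normE /=.
apply: le_lt_trans (ler_distD (ratr (c j 0)) _ _) _.
have h3 : 2 * N.+1%:R^-1 < e.
  by rewrite ltr_pdivrMr // mulrC -ltr_pdivrMr.
by rewrite [X in _ + X]distrC; move: h1 h2; try move: h3; move: (_.+1%:R^-1 : R) => z; lra.
Qed.

Lemma measurable_enorm d (T : measurableType d) k (V : T -> 'cV[R]_k) :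
  mvec V -> measurable_fun setT (fun a => enorm (V a)).
Proof.
move=> mV; apply: measurableT_comp.
  by apply: continuous_measurable_fun; exact: sqrt_continuous.
by apply: measurable_sum => j; exact: measurable_funX.
Qed.

Lemma mvec_cst d (T : measurableType d) k (c : 'cV[R]_k) : mvec (fun _ : T => c).
Proof. by move=> j; exact: measurable_cst. Qed.

Lemma mvecD d (T : measurableType d) k (V V' : T -> 'cV[R]_k) :
  mvec V -> mvec V' -> mvec (fun a => V a + V' a).
Proof.
move=> mV mV' j; under eq_fun do rewrite mxE; exact: measurable_funD.
Qed.

Lemma mvecZ d (T : measurableType d) k (h : T -> R) (V : T -> 'cV[R]_k) :
  measurable_fun setT h -> mvec V -> mvec (fun a => h a *: V a).
Proof.
move=> mh mV j; under eq_fun do rewrite mxE; exact: measurable_funM.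
Qed.

Lemma mvecB d (T : measurableType d) k (V V' : T -> 'cV[R]_k) :
  mvec V -> mvec V' -> mvec (fun a => V a - V' a).
Proof.
move=> mV mV' j; under eq_fun do rewrite !mxE; exact: measurable_funB.
Qed.

Lemma mvec_sum d (T : measurableType d) k (I : Type) (s : seq I) (V : I -> T -> 'cV[R]_k) :
  (forall i, mvec (V i)) -> mvec (fun a => \sum_(i <- s) V i a).
Proof.
by move=> mV j; under eq_fun do rewrite summxE; apply: measurable_sum => i; exact: mV.
Qed.

Lemma measurable_dotv d (T : measurableType d) k (V V' : T -> 'cV[R]_k) :
  mvec V -> mvec V' -> measurable_fun setT (fun a => dotv (V a) (V' a)).
Proof. by move=> mV mV'; apply: measurable_sum => j; exact: measurable_funM. Qed.

(** A function that is [G]-Lipschitz on [K] is the supremum of the cones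
    [c |-> phi c - G * enorm (v - c)] over a countable dense set of centers
    [c] of [K], so that measurability at fixed centers is enough. *)
Lemma measurable_caratheodory d (T : measurableType d) k (K : set 'cV[R]_k)
    (Phi : T -> 'cV[R]_k -> R) (V : T -> 'cV[R]_k) (G : R) :
  mvec V -> (forall a, K (V a)) ->
  (forall c, K c -> measurable_fun setT (Phi^~ c)) ->
  (forall a x y, K x -> K y -> `|Phi a x - Phi a y| <= G * enorm (x - y)) ->
  measurable_fun setT (fun a => Phi a (V a)).
Proof.
move=> mV KV mPhi lip; apply: measurable_fun_gt => y.
(* A point of [K] in each box that meets [K]; the other boxes are discarded by [F]. *)
pose pt (i : 'cV[rat]_k * nat) : 'cV[R]_k := xget 0 (K `&` box i).
pose F i := if `[< K (pt i) >] then
    [set a | y < Phi a (pt i) - `|G| * enorm (V a - pt i)] else set0.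
rewrite (_ : mkset _ = \bigcup_i F i).
  apply: countable_bigcupT_measurable; first exact: countableP.
  move=> i; rewrite /F; case: ifP => // /asboolP Ki; apply: measurable_gt.
  apply: measurable_funB; first exact: mPhi.
  apply: measurable_funM => //; apply: measurable_enorm; apply: mvecB => //.
apply/seteqP; split => [a /= ya|a [i _]]; last first.
  rewrite /F; case: ifP => // /asboolP Ki /= h; apply: lt_le_trans h _.
  have := lip a _ _ Ki (KV a); rewrite ler_norml enormBC => /andP[_ h].
  have : G * enorm (V a - pt i) <= `|G| * enorm (V a - pt i) by rewrite ler_wpM2r // ler_norm.
  by lra.
pose C := 2 * `|G| * (Num.sqrt k%:R * 2).
have C0 : 0 <= C by rewrite !mulr_ge0 ?sqrtr_ge0.
have gap0 : 0 < Phi a (V a) - y by rewrite subr_gt0.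
have [N hN] : exists N : nat, C / (Phi a (V a) - y) < N.+1%:R.
  exists (Num.truncn (C / (Phi a (V a) - y))); apply: truncnS_gt.
have [c hc] := box_exists (V a) N.
have ptP : (K `&` box (c, N)) (pt (c, N)) by apply: (@xgetI _ 0 _ (V a)); split.
exists (c, N) => //; rewrite /F; case: ifP => [_|/asboolP[]]; last exact: ptP.1.
rewrite /=; set b := pt (c, N).
have hb : enorm (V a - b) <= Num.sqrt k%:R * (2 * N.+1%:R^-1).
  apply: enorm_bounded_coord => [|j]; first by rewrite mulr_ge0 // invr_ge0.
  have h1 := hc j; have h2 := ptP.2 j; rewrite /= in h1 h2; rewrite !mxE.
  apply: le_trans (ler_distD (ratr (c j 0)) _ _) _.
  by rewrite [X in _ + X]distrC; move: h1 h2; try move: h3; move: (_.+1%:R^-1 : R) => z; lra.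
have h3 : C * N.+1%:R^-1 < Phi a (V a) - y.
  by rewrite ltr_pdivrMr // mulrC -ltr_pdivrMr.
have := lip a _ _ (KV a) ptP.1; rewrite -/b ler_norml => /andP[_ h4].
have h5 : G * enorm (V a - b) <= `|G| * enorm (V a - b) by rewrite ler_wpM2r // ler_norm.
have h6 := ler_wpM2l (normr_ge0 G) hb.
by move: h3 h6; rewrite /C; move: (_.+1%:R^-1 : R) => z; lra.
Qed.

End VectorMeasurability.

(** * Expectation of bounded functions *)

Section Expectation.
Context {R : realType} d {T : measurableType d} (P : probability T R).
Implicit Types h : T -> R.

(** Bounded measurable functions: closed under the operations below and always
    integrable, so that the expectation is linear and monotone without side
    conditions on infinite values. *)
Definition bmeas h := measurable_fun setT h /\ exists M, forall a, `|h a| <= M.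

Definition Ex h : R := \int[P]_a h a.

Lemma bmeas_integrable h : bmeas h -> P.-integrable setT (EFin \o h).
Proof.
move=> [mh [M hM]]; apply: measurable_bounded_integrable => //.
  by rewrite (le_lt_trans (probability_le1 P measurableT)) // ltry.
exists M; split; first exact: num_real.
by move=> x Mx a _; apply: le_trans (hM a) (ltW Mx).
Qed.

Lemma bmeas_cst c : bmeas (fun=> c).
Proof. by split; [exact: measurable_cst|exists `|c|]. Qed.

Lemma bmeasD h h' : bmeas h -> bmeas h' -> bmeas (fun a => h a + h' a).
Proof.
move=> [mh [M hM]] [mh' [M' hM']]; split; first exact: measurable_funD.
by exists (M + M') => a; apply: le_trans (ler_normD _ _) _; exact: lerD.
Qed.

Lemma bmeasM h h' : bmeas h -> bmeas h' -> bmeas (fun a => h a * h' a).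
Proof.
move=> [mh [M hM]] [mh' [M' hM']]; split; first exact: measurable_funM.
by exists (M * M') => a; rewrite normrM; exact: ler_pM.
Qed.

Lemma bmeasZ c h : bmeas h -> bmeas (fun a => c * h a).
Proof. by move=> bh; apply: bmeasM => //; exact: bmeas_cst. Qed.

Lemma bmeasB h h' : bmeas h -> bmeas h' -> bmeas (fun a => h a - h' a).
Proof.
move=> bh bh'; have := bmeasD bh (bmeasZ (-1) bh').
by under eq_fun do rewrite mulN1r.
Qed.

Lemma bmeas_sum (I : Type) (s : seq I) (h : I -> T -> R) :
  (forall i, bmeas (h i)) -> bmeas (fun a => \sum_(i <- s) h i a).
Proof.
move=> bh; elim: s => [|i s IH].
  by under eq_fun do rewrite big_nil; exact: bmeas_cst.
by under eq_fun do rewrite big_cons; exact: bmeasD.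
Qed.

Lemma Ex_cst c : Ex (fun=> c) = c.
Proof.
have := expectation_cst P c; rewrite unlock /cst => h.
by rewrite /Ex /Rintegral [X in fine X]h.
Qed.

Lemma ExD h h' : bmeas h -> bmeas h' -> Ex (fun a => h a + h' a) = Ex h + Ex h'.
Proof. by move=> bh bh'; rewrite /Ex RintegralD //; exact: bmeas_integrable. Qed.

Lemma ExB h h' : bmeas h -> bmeas h' -> Ex (fun a => h a - h' a) = Ex h - Ex h'.
Proof. by move=> bh bh'; rewrite /Ex RintegralB //; exact: bmeas_integrable. Qed.

Lemma ExZ c h : bmeas h -> Ex (fun a => c * h a) = c * Ex h.
Proof. by move=> bh; rewrite /Ex RintegralZl //; exact: bmeas_integrable. Qed.

Lemma Ex_sum (I : Type) (s : seq I) (h : I -> T -> R) :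
  (forall i, bmeas (h i)) -> Ex (fun a => \sum_(i <- s) h i a) = \sum_(i <- s) Ex (h i).
Proof.
move=> bh; elim: s => [|i s IH].
  by rewrite big_nil; under eq_fun do rewrite big_nil; rewrite Ex_cst.
rewrite big_cons -IH -ExD //; last exact: bmeas_sum.
by congr Ex; apply/funext => a; rewrite big_cons.
Qed.

Lemma Ex_le h h' : bmeas h -> bmeas h' -> (forall a, h a <= h' a) -> Ex h <= Ex h'.
Proof.
by move=> bh bh' hh'; apply: le_Rintegral => //; exact: bmeas_integrable.
Qed.

Lemma Ex_abs_le h M : bmeas h -> (forall a, `|h a| <= M) -> `|Ex h| <= M.
Proof.
move=> bh hM; rewrite ler_norml; apply/andP; split.
  rewrite -[leLHS]Ex_cst; apply: Ex_le => //; first exact: bmeas_cst.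
  by move=> a; have := hM a; rewrite ler_norml => /andP[].
rewrite -[leRHS]Ex_cst; apply: Ex_le => //; first exact: bmeas_cst.
by move=> a; have := hM a; rewrite ler_norml => /andP[].
Qed.

Lemma expectation_Ex h : bmeas h -> ('E_P[h] = (Ex h)%:E)%E.
Proof.
move=> bh; rewrite unlock /Ex /Rintegral fineK //.
exact: integrable_fin_num (bmeas_integrable bh).
Qed.

(** The excess [Num.max 0 (h - h')] vanishes almost everywhere, hence has expectation
    0, and [h <= h' + excess] holds everywhere. *)
Lemma Ex_ae_le h h' : bmeas h -> bmeas h' -> {ae P, forall a, h a <= h' a} -> Ex h <= Ex h'.
Proof.
move=> bh bh' hh'; pose e a := Num.max 0 (h a - h' a).
have be : bmeas e.
  have [mD [M hM]] := bmeasB bh bh'; split; first exact: measurable_maxr.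
  exists M => a; have := hM a; rewrite /e.
  by case: (leP 0 (h a - h' a)) => // _; rewrite normr0; exact: le_trans.
have e0 : Ex e = 0.
  rewrite /Ex /Rintegral (ae_eq_integral (cst 0%E)) ?integral0 //.
  - by apply/measurable_EFinP; exact: be.1.
  - apply: filterS hh' => a ha _ /=; congr (_%:E).
    by rewrite /e; apply/max_idPl; rewrite subr_le0.
rewrite -[leRHS]addr0 -e0 -ExD //; apply: Ex_le => //; first exact: bmeasD.
by move=> a; rewrite -lerBlDl /e le_max lexx orbT.
Qed.

End Expectation.

(** * Differentiation under the expectation and along curves *)

Section Derivation.
Context {R : realType}.

(** A derivative is the pointwise limit of difference quotients along a sequence. *)
Lemma measurable_derivative d (T : measurableType d) (F : R -> T -> R) (F' : T -> R) (a e : R) :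
  0 < e -> (forall h, `|h - a| < e -> measurable_fun setT (F h)) ->
  (forall o, is_derive a 1 (F^~ o) (F' o)) -> measurable_fun setT F'.
Proof.
move=> e0 mF dF.
pose t (k : nat) : R := e / 2 / k.+1%:R.
have t0 k : 0 < t k by rewrite !divr_gt0.
have te k : t k < e.
  rewrite /t ltr_pdivrMr //; have : 1 <= k.+1%:R :> R by rewrite ler1n.
  by move=> /(ler_wpM2l (ltW e0)); lra.
apply: (@measurable_fun_cvg _ _ _ _ (fun k o => (t k)^-1 * (F (t k + a) o - F a o))).
  move=> k; apply: measurable_funM => //; apply: measurable_funB; apply: mF.
    by rewrite addrK gtr0_norm.
  by rewrite subrr normr0.
move=> o _; have [df vf] := dF o.
have cvt : t k @[k --> \oo] --> 0.
  rewrite -[0](mulr0 (e / 2)); apply: cvgM; first exact: cvg_cst.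
  exact: cvg_harmonic.
have := df; rewrite /derivable => /cvg_ex[l hl].
have El : l = F' o by rewrite -vf; apply/esym/cvg_lim.
rewrite -El; move: hl.
under eq_fun do rewrite scaler1.
move=> /cvgr_dnbhsP /(_ t) h; apply: h; split => // k.
by rewrite gt_eqF.
Qed.

(** Dominated convergence, with the constant [M] as the dominating function. *)
Lemma Ex_derive d (T : measurableType d) (P : probability T R) (F F' : R -> T -> R) (a u v M : R) :
  u < a < v ->
  (forall h, u < h < v -> bmeas (F h)) ->
  (forall h o, u < h < v -> is_derive h 1 (F^~ o) (F' h o)) ->
  (forall h o, u < h < v -> `|F' h o| <= M) ->
  bmeas (F' a) /\ is_derive a 1 (fun h => Ex P (F h)) (Ex P (F' a)).
Proof.
move=> /andP[ua av] bF dF bF'.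
have auv : u < a < v by rewrite ua.
split.
  split; last by exists M => o; exact: bF'.
  pose e := Num.min (a - u) (v - a).
  apply: (@measurable_derivative _ _ F _ a e).
  - by rewrite /e lt_min !subr_gt0 ua.
  - move=> h; rewrite /e lt_min !ltr_norml => /andP[/andP[h1 h2] /andP[h3 h4]].
    by apply: (bF h _).1; apply/andP; split; lra.
  - by move=> o; exact: dF.
have Ia : `]u, v[%classic a by rewrite /= in_itv.
have M0 (o : T) : 0 <= M by apply: le_trans (normr_ge0 _) (bF' a o auv).
have intF h : `]u, v[%classic h -> P.-integrable setT (EFin \o F h).
  by rewrite /= in_itv /= => /bF; exact: bmeas_integrable.
have derF h o : `]u, v[%classic h -> setT o -> derivable (F^~ o) h 1.
  by rewrite /= in_itv /= => hh _; have [] := dF h o hh.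
have hd h o : u < h < v -> partial1of2 F h o = F' h o.
  by move=> hh; rewrite partial1of2E; have [_ ->] := dF h o hh.
have ubF h o : `]u, v[%classic h -> setT o -> `|partial1of2 F h o| <= `|M|.
  by rewrite /= in_itv /= => hh _; rewrite hd // (ger0_norm (M0 o)); exact: bF'.
have intM : P.-integrable setT (EFin \o (fun _ : T => `|M|)).
  exact: finite_measure_integrable_cst.
have dd := @derivable_under_integral R d T P F setT measurableT a u v Ia intF derF
   (fun _ => `|M|) (fun _ => normr_ge0 _) intM ubF.
have ddE := @differentiation_under_integral R d T P F setT measurableT a u v Ia intF derF
   (fun _ => `|M|) (fun _ => normr_ge0 _) intM ubF.
apply: DeriveDef => //; rewrite -derive1E ddE.
by congr Ex; apply/funext => o; rewrite hd.
Qed.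

End Derivation.

Section ChainRule.
Context {R : realType} {k : nat}.

(** The gradient only controls increments inside [K], which is enough along a
    curve that stays in [K]. *)
Lemma gradient_chain (K : set 'cV[R]_k) (phi : 'cV[R]_k -> R) (c : R -> 'cV[R]_k)
    (c' v : 'cV[R]_k) (a : R) :
  is_gradient K phi (c a) v -> (\forall h \near a, K (c h)) ->
  (forall j, is_derive a 1 (fun h => c h j 0) (c' j 0)) ->
  is_derive a 1 (fun h => phi (c h)) (dotv v c').
Proof.
move=> gr Kc dc.
(* A local Lipschitz constant of the curve at [a]. *)
pose L := Num.sqrt k%:R * (\sum_j `|c' j 0| + 1).
have S0 : 0 <= \sum_j `|c' j 0| by apply: sumr_ge0.
have L0 : 0 <= L by rewrite mulr_ge0 ?sqrtr_ge0 // addr_ge0.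
have dcvg j : h^-1 * (c (h + a) j 0 - c a j 0) @[h --> 0^'] --> c' j 0.
  have [dj vj] := dc j; have := dj; rewrite /derivable => /cvg_ex[l hl].
  have <- : l = c' j 0 by rewrite -vj; apply/esym/cvg_lim.
  by move: hl; under eq_fun do rewrite scaler1.
have lip : \forall h \near 0^', enorm (c (h + a) - c a) <= L * `|h|.
  have hj j : \forall h \near 0^', `|c (h + a) j 0 - c a j 0| <= (\sum_j `|c' j 0| + 1) * `|h|.
    have /cvgrPdist_le/(_ _ ltr01) := dcvg j; apply: filter_app.
    near=> h => hh.
    have h0 : h != 0 by near: h; exact: nbhs_dnbhs_neq.
    have hh' : `|h^-1 * (c (h + a) j 0 - c a j 0)| <= \sum_j `|c' j 0| + 1.
      rewrite -[X in `|X|](subrK (c' j 0)) addrC; apply: le_trans (ler_normD _ _) _.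
      rewrite lerD // 1?distrC // (bigD1 j) //= lerDl; exact: sumr_ge0.
    rewrite -ler_pdivrMr ?normr_gt0 //; apply: le_trans hh'.
    by rewrite normrM normfV mulrC.
  have : \forall h \near 0^', forall j, `|c (h + a) j 0 - c a j 0| <= (\sum_j `|c' j 0| + 1) * `|h|.
    exact: filter_forall.
  apply: filterS => h hh; rewrite /L -mulrA; apply: enorm_bounded_coord.
    by rewrite mulr_ge0 // addr_ge0.
  by move=> j; rewrite !mxE.
have Kc' : \forall h \near 0^', K (c (h + a)).
  have /nbhs_ballP[e /= e0 he] := Kc.
  have : \forall h \near (0 : R)^', `|h| < e by exact: dnbhs0_lt.
  apply: filterS => h hh; apply: (he (h + a)) => /=.
  by rewrite -ball_normE /= opprD addrCA subrr addr0 normrN.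
have dotcvg : dotv v (h^-1 *: (c (h + a) - c a)) @[h --> 0^'] --> dotv v c'.
  apply: cvg_big => [|j _]; first exact: add_continuous.
  apply: cvgM; first exact: cvg_cst.
  by under eq_fun do rewrite !mxE; exact: dcvg.
have main : h^-1 * (phi (c (h + a)) - phi (c a)) @[h --> 0^'] --> dotv v c'.
  apply/cvgrPdist_le => e e0.
  have L1 : 0 < L + 1 by rewrite ltr_wpDl.
  have e1 : 0 < e / 2 / (L + 1) by rewrite !divr_gt0.
  have e2 : 0 < e / 2 by rewrite divr_gt0.
  have [s s0 hs] := is_gradientE gr e1.
  have sL : 0 < s / (L + 1) by rewrite divr_gt0.
  have /cvgrPdist_le/(_ _ e2) := dotcvg; apply: filter_app.
  have : \forall h \near (0 : R)^', `|h| < s / (L + 1) by exact: dnbhs0_lt.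
  apply: filter_app.
  move: Kc'; apply: filter_app; move: lip; apply: filter_app.
  near=> h => hl hK hsm hdot.
  have h0 : h != 0 by near: h; exact: nbhs_dnbhs_neq.
  have h0' : 0 < `|h| by rewrite normr_gt0.
  have hL : L * `|h| <= (L + 1) * `|h| by rewrite ler_wpM2r // lerDl.
  have hlt : enorm (c (h + a) - c a) < s.
    apply: le_lt_trans hl _; apply: le_lt_trans hL _.
    by rewrite mulrC -ltr_pdivlMr.
  have := hs _ hK hlt.
  set D := c (h + a) - c a in hl hdot *; set dphi := _ - phi (c a) => hrem.
  have hrem2 : `|dphi - dotv v D| <= e / 2 * `|h|.
    apply: le_trans hrem _; have -> : e / 2 * `|h| = e / 2 / (L + 1) * ((L + 1) * `|h|).
      by rewrite mulrA divfK // gt_eqF.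
    by rewrite ler_pM2l //; exact: le_trans hl hL.
  have hrem3 : `|h^-1 * dphi - dotv v (h^-1 *: D)| <= e / 2.
    by rewrite dotvZr -mulrBr normrM normfV mulrC ler_pdivrMr.
  rewrite distrC in hrem3.
  apply: le_trans (ler_distD (dotv v (h^-1 *: D)) _ _) _.
  by move: hdot hrem3; lra.
have dE : (fun h => h^-1 *: ((fun h => phi (c h)) (h *: 1 + a) - phi (c a))) =
    (fun h : R => h^-1 * (phi (c (h + a)) - phi (c a))).
  by apply/funext => h; rewrite scaler1.
apply: DeriveDef; first by apply/cvg_ex; exists (dotv v c'); rewrite dE.
by rewrite /derive dE; apply/cvg_lim.
Unshelve. all: end_near. Qed.

End ChainRule.

(** * Plane rotations and the uniform law on the sphere *)

Section Rotation.
Context {R : realType} {k : nat}.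

(** The projection onto the plane of the coordinates [j] and [l], when they differ. *)
Definition plane_mx (j l : 'I_k) : 'M[R]_k := delta_mx j j + delta_mx l l.
(** The quarter turn in that plane, and 0 on its orthogonal complement. *)
Definition turn_mx (j l : 'I_k) : 'M[R]_k := delta_mx l j - delta_mx j l.

(** The rotation by the angle [h] in the plane of the coordinates [j] and [l]. *)
Definition rot_mx (j l : 'I_k) (h : R) : 'M[R]_k :=
  1%:M + (cos h - 1) *: plane_mx j l + sin h *: turn_mx j l.

Lemma rot_mx_orthogonal j l h : j != l -> (rot_mx j l h)^T *m rot_mx j l h = 1%:M.
Proof.
move=> jl; have lj : l != j by rewrite eq_sym.
have e := (eqxx, negPf jl, negPf lj).
have SS : plane_mx j l *m plane_mx j l = plane_mx j l.
  by rewrite mulmxDl !mulmxDr !mul_delta_mx_cond !e !mulr0n !mulr1n addr0 add0r.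
have AA : turn_mx j l *m turn_mx j l = - plane_mx j l.
  rewrite mulmxBl !mulmxBr !mul_delta_mx_cond !e !mulr0n !mulr1n.
  by rewrite /plane_mx sub0r subr0 -opprD addrC.
have SA : plane_mx j l *m turn_mx j l = turn_mx j l.
  by rewrite mulmxDl !mulmxBr !mul_delta_mx_cond !e !mulr0n !mulr1n /turn_mx sub0r subr0 addrC.
have AS : turn_mx j l *m plane_mx j l = turn_mx j l.
  by rewrite mulmxBl !mulmxDr !mul_delta_mx_cond !e !mulr0n !mulr1n /turn_mx addr0 add0r.
have trS : (plane_mx j l)^T = plane_mx j l by rewrite /plane_mx linearD /= !trmx_delta.
have trA : (turn_mx j l)^T = - turn_mx j l by rewrite /turn_mx linearB /= !trmx_delta opprB.
have cs := cos2Dsin2 h.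
rewrite /rot_mx; move: (plane_mx j l) (turn_mx j l) SS AA SA AS trS trA => S A SS AA SA AS trS trA.
rewrite !(linearD, linearZ) /= trS trA trmx1.
rewrite !(mulmxDl, mulmxDr) !mul1mx !mulmx1.
rewrite -!scalemxAl !mulNmx SS SA AS AA.
apply/matrixP => a b; rewrite !mxE.
set s := S a b; set t := A a b; set dd := (_ == _)%:R.
rewrite [LHS](_ : _ = dd + s * (cos h ^+ 2 + sin h ^+ 2 - 1)); last by ring.
by rewrite cs subrr mulr0 addr0.
Qed.

Lemma rot_mx_coord j l h (v : 'cV[R]_k) a :
  (rot_mx j l h *m v) a 0 =
  v a 0 + (cos h - 1) * (plane_mx j l *m v) a 0 + sin h * (turn_mx j l *m v) a 0.
Proof.
rewrite /rot_mx; move: (plane_mx j l) (turn_mx j l) => S A.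
by rewrite !mulmxDl mul1mx -!scalemxAl !mxE.
Qed.

Lemma plane_mx_coord j l (v : 'cV[R]_k) a :
  (plane_mx j l *m v) a 0 = (a == j)%:R * v j 0 + (a == l)%:R * v l 0.
Proof.
rewrite /plane_mx mulmxDl !mxE; congr (_ + _).
  rewrite (bigD1 j) //= big1 ?mxE ?eqxx ?andbT ?addr0 // => b bj.
  by rewrite mxE (negPf bj) andbF mul0r.
rewrite (bigD1 l) //= big1 ?mxE ?eqxx ?andbT ?addr0 // => b bl.
by rewrite mxE (negPf bl) andbF mul0r.
Qed.

Lemma turn_mx_coord j l (v : 'cV[R]_k) a :
  (turn_mx j l *m v) a 0 = (a == l)%:R * v j 0 - (a == j)%:R * v l 0.
Proof.
rewrite /turn_mx mulmxBl !mxE; congr (_ - _).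
  rewrite (bigD1 j) //= big1 ?mxE ?eqxx ?andbT ?addr0 // => b bj.
  by rewrite mxE (negPf bj) andbF mul0r.
rewrite (bigD1 l) //= big1 ?mxE ?eqxx ?andbT ?addr0 // => b bl.
by rewrite mxE (negPf bl) andbF mul0r.
Qed.

(** The velocity of [rot_mx j l h *m v] as a function of the angle [h]. *)
Definition turn_rate (j l : 'I_k) (h : R) (v : 'cV[R]_k) : 'cV[R]_k :=
  - sin h *: (plane_mx j l *m v) + cos h *: (turn_mx j l *m v).

Lemma is_derive_rot (j l : 'I_k) (h : R) (v : 'cV[R]_k) a :
  is_derive h 1 (fun h : R => (rot_mx j l h *m v) a 0) (turn_rate j l h v a 0).
Proof.
under eq_fun do rewrite rot_mx_coord.
rewrite /turn_rate; move: (plane_mx _ _ *m _) (turn_mx _ _ *m _) => S A.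
apply: is_derive_eq; rewrite !mxE /GRing.scale /=; ring.
Qed.

Lemma rot_mx_enorm (j l : 'I_k) (h : R) (v : 'cV[R]_k) : j != l -> enorm (rot_mx j l h *m v) = enorm v.
Proof.
move=> jl; rewrite !enormE dotv_mulmx mulmxA rot_mx_orthogonal // mul1mx.
by [].
Qed.

Lemma turn_rate_enorm (j l : 'I_k) (h : R) (v : 'cV[R]_k) : enorm v = 1 -> enorm (turn_rate j l h v) <= 4.
Proof.
move=> v1.
have hc := cos_max h; have hs := sin_max h.
have vj a : `|v a 0| <= 1 by rewrite -v1; exact: coord_le_enorm.
have hd a : enorm (delta_mx a 0 : 'cV[R]_k) = 1.
  rewrite enormE /dotv (bigD1 a) //= big1 ?addr0 ?mxE ?eqxx ?mulr1 ?sqrtr1 // => b ba.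
  by rewrite mxE (negPf ba) mul0r.
have hp : enorm (plane_mx j l *m v) <= 2.
  have -> : plane_mx j l *m v = v j 0 *: delta_mx j 0 + v l 0 *: delta_mx l 0.
    by apply/colP => a; rewrite plane_mx_coord !mxE !eqxx !andbT; ring.
  apply: le_trans (enormD _ _) _; rewrite !enormZ !hd !mulr1.
  by have := vj j; have := vj l; lra.
have ht : enorm (turn_mx j l *m v) <= 2.
  have -> : turn_mx j l *m v = v j 0 *: delta_mx l 0 - v l 0 *: delta_mx j 0.
    by apply/colP => a; rewrite turn_mx_coord !mxE !eqxx !andbT; ring.
  apply: le_trans (enormB _ _) _; rewrite !enormZ !hd !mulr1.
  by have := vj j; have := vj l; lra.
apply: le_trans (enormD _ _) _; rewrite !enormZ normrN.
have := ler_pM (normr_ge0 _) (enorm_ge0 _) hc ht.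
by have := ler_pM (normr_ge0 _) (enorm_ge0 _) hs hp; lra.
Qed.

End Rotation.

Section SphereLaw.
Context {R : realType} d {Om : measurableType d} (P : probability Om R) {k : nat}.
Variable U : Om -> 'cV[R]_k.
Hypothesis sphU : uniform_on_sphere P U.

Lemma mvec_id : @mvec R _ (borel_space R k) k id.
Proof. exact: borel_mvec. Qed.

Lemma sphere_mvec : mvec U.
Proof. by have [mU _ _] := sphU; exact: borel_mvec. Qed.

Lemma sphere_unit o : enorm (U o) = 1.
Proof. by have [_ h _] := sphU. Qed.

Lemma Ex_law (V : Om -> 'cV[R]_k) (F : 'cV[R]_k -> R) :
  mvec V -> measurable_fun [set: borel_space R k] F ->
  bmeas (fun o => F (V o)) ->
  Ex P (fun o => F (V o)) =
  fine (\int[pushforward P (V : Om -> borel_space R k)]_v (F v)%:E).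
Proof.
move=> mV mF bF; rewrite /Ex /Rintegral; congr fine; rewrite integral_pushforward //.
- by move=> _ A mA; rewrite setTI; exact: mvec_borel.
- exact/measurable_EFinP.
- by rewrite preimage_setT; exact: bmeas_integrable.
Qed.

End SphereLaw.

(** * The two-point gradient estimate of a convex function *)

Section SphereIntegrals.
Context {R : realType} d {Om : measurableType d} (P : probability Om R) {k : nat}.
Variable U : Om -> 'cV[R]_k.
Hypothesis sphU : uniform_on_sphere P U.

Lemma mvec_mulmx (A : 'M[R]_k) : mvec (fun o => A *m U o).
Proof.
move=> j; under eq_fun do rewrite mxE.
apply: measurable_sum => l; apply: measurable_funM => //.
exact: (sphere_mvec sphU).
Qed.

(** [Q U] and [U] have the same law on the Borel sets. *)
Lemma Ex_orthogonal (Q : 'M[R]_k) (F : 'cV[R]_k -> R) (M : R) :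
  Q^T *m Q = 1%:M -> measurable_fun [set: borel_space R k] F -> (forall v, `|F v| <= M) ->
  Ex P (fun o => F (Q *m U o)) = Ex P (fun o => F (U o)).
Proof.
move=> QQ mF FM; have mU := sphere_mvec sphU; have mQ := mvec_mulmx Q.
have mcomp (V : Om -> 'cV[R]_k) : mvec V -> bmeas (fun o => F (V o)).
  move=> mV; split; last by exists M.
  move=> _ B mB; rewrite setTI; have := mF measurableT B mB; rewrite setTI => h.
  exact: (mvec_borel mV h).
rewrite (Ex_law P mQ mF (mcomp _ mQ)) (Ex_law P mU mF (mcomp _ mU)).
have mV (V : Om -> 'cV[R]_k) : mvec V -> measurable_fun setT (V : Om -> (borel_space R k)).
  by move=> hV _ A mA; rewrite setTI; exact: mvec_borel.
congr fine; apply: eq_measure_integral; [exact: mV|exact: mV|move=> h0 h1 A mA sA].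
by have [_ _ inv] := sphU; exact: inv.
Qed.

(** The identity inside the unit ball; makes the integrands below measurable on
    the whole space although [phi] is only controlled on [K]. *)
Definition clip (v : 'cV[R]_k) : 'cV[R]_k := (if enorm v <= 1 then 1 else 0) *: v.

Lemma clip_norm v : enorm (clip v) <= 1.
Proof.
rewrite /clip; case: ifP => [h|_]; first by rewrite scale1r.
by rewrite scale0r enorm0.
Qed.

Lemma clip_unit v : enorm v = 1 -> clip v = v.
Proof. by rewrite /clip => ->; rewrite lexx scale1r. Qed.

Lemma mvec_clip : @mvec R _ (borel_space R k) k clip.
Proof.
apply: (@mvecZ _ _ (borel_space R k) k (fun v => if enorm v <= 1 then 1 else 0) id); last exact: mvec_id.
apply: measurable_fun_ifT => //; apply: measurable_fun_ler => //.
by apply: measurable_enorm; exact: mvec_id.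
Qed.

End SphereIntegrals.

(** The hypothesis on [psi'] says that [s^k' psi s - c s^(k'+1) / (k'+1) +
    G s^(k'+2) / (k'+2)] is nondecreasing. *)
Lemma growth_bound {R : realType} (k' : nat) (psi psi' : R -> R) (L c G dl : R) :
  0 < dl -> 0 <= G ->
  (forall s, 0 < s < dl -> is_derive s 1 psi (psi' s)) ->
  (forall s s', 0 <= s <= dl -> 0 <= s' <= dl -> `|psi s - psi s'| <= L * `|s - s'|) ->
  psi 0 = 0 ->
  (forall s, 0 < s < dl -> s * (c - G * s) <= k'%:R * psi s + s * psi' s) ->
  c - G * dl <= k'.+1%:R / dl * psi dl.
Proof.
move=> dl0 G0 dpsi lpsi psi0 hpsi.
pose F s := s ^+ k' * psi s - c / k'.+1%:R * s ^+ k'.+1 + G / k'.+2%:R * s ^+ k'.+2.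
pose F' s := k'%:R * s ^+ k'.-1 * psi s + s ^+ k' * psi' s - c * s ^+ k' + G * s ^+ k'.+1.
have L0 : 0 <= L * dl.
  have := lpsi dl 0; rewrite subr0 (gtr0_norm dl0) => h; apply: le_trans (h _ _) => //.
    by rewrite lexx ltW.
  by rewrite lexx ltW.
have {}L0 : 0 <= L by rewrite -(pmulr_lge0 _ dl0).
have dF s : s \in `]0, dl[ -> is_derive s 1 F (F' s).
  rewrite in_itv /= => hs; have ds := dpsi s hs.
  have k1 : (k'.+1%:R : R) != 0 by rewrite pnatr_eq0.
  have k2 : (k'.+2%:R : R) != 0 by rewrite pnatr_eq0.
  have dX j : is_derive s 1 (fun y : R => y ^+ j) (j%:R * s ^+ j.-1).
    apply: DeriveDef; first exact: exprn_derivable.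
    by rewrite exp_derive /GRing.scale /= mulr1.
  have d1 := dX k'; have d2 := dX k'.+1; have d3 := dX k'.+2.
  rewrite /F; apply: is_derive_eq; rewrite /F' /GRing.scale /=.
  move: k1 k2; move: (k'.+1%:R : R) (k'.+2%:R : R) => a b a0 b0.
  by field; rewrite a0 b0.
have cF : {within `[0, dl], continuous F}.
  apply/subspace_continuousP => s; rewrite /= in_itv /= => hs.
  have cX j : (fun x : R => x ^+ j) x @[x --> within `[0, dl] (nbhs s)] --> s ^+ j.
    by apply: cvg_within_filter; apply: exprn_continuous.
  have cpsi : psi x @[x --> within `[0, dl] (nbhs s)] --> psi s.
    apply/cvgrPdist_le => e e0; near=> x.
    have hx : 0 <= x <= dl.
      have : `[0, dl]%classic x by near: x; exact: withinT.
      by rewrite /= in_itv.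
    apply: le_trans (lpsi _ _ hs hx) _.
    have : `|s - x| <= e / (L + 1).
      near: x; rewrite near_withinE.
      have : \forall y \near s, `|s - y| <= e / (L + 1).
        apply/nbhs_normP; exists (e / (L + 1)); first by rewrite /= divr_gt0 //; lra.
        by move=> y /ltW.
      by apply: filterS.
    rewrite ler_pdivlMr; last by lra.
    have := normr_ge0 (s - x); move: (`|s - x|) => y y0 h; nra.
  apply: cvgD; last by apply: cvgM; [exact: cvg_cst|exact: cX].
  apply: cvgB; first by apply: cvgM; [exact: cX|exact: cpsi].
  by apply: cvgM; [exact: cvg_cst|exact: cX].
have [s] := MVT dl0 dF cF; rewrite in_itv /= => hs.
have /andP[s0 sd] := hs.
have F'0 : 0 <= F' s.
  have h := hpsi s hs; rewrite -(pmulr_rge0 _ s0).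
  have -> : s * F' s = s ^+ k' * (k'%:R * psi s + s * psi' s - s * (c - G * s)).
    rewrite /F'; case: (k') => [|j] /=; rewrite ?expr0 ?mul0r !exprS; ring.
  by rewrite mulr_ge0 ?exprn_ge0 ?subr_ge0 // ltW.
have -> : F 0 = 0 by rewrite /F psi0 !exprS !mul0r !mulr0 subr0 addr0.
rewrite !subr0 => FE; have : 0 <= F dl by rewrite FE mulr_ge0 // ltW.
have -> : F dl = dl ^+ k'.+1 / k'.+1%:R * (k'.+1%:R / dl * psi dl - c + G * dl * (k'.+1%:R / k'.+2%:R)).
  have k1 : (k'.+1%:R : R) != 0 by rewrite pnatr_eq0.
  have k2 : (k'.+2%:R : R) != 0 by rewrite pnatr_eq0.
  rewrite /F !exprS; move: k1 k2; move: (k'.+1%:R : R) (k'.+2%:R : R) => a b a0 b0.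
  by field; rewrite a0 b0 gt_eqF.
rewrite pmulr_rge0 ?divr_gt0 ?exprn_gt0 // => h.
have : G * dl * (k'.+1%:R / k'.+2%:R) <= G * dl.
  rewrite -[leRHS]mulr1; apply: ler_wpM2l; first by rewrite mulr_ge0 // ltW.
  by rewrite ler_pdivrMr ?ltr0n // mul1r ler_nat.
by move: h; move: (G * dl * _) (_ / dl * _) => a b; lra.
Unshelve. all: by end_near.
Qed.

Section Smoothing.
Context {R : realType} d {Om : measurableType d} (P : probability Om R) {k : nat}.
Variable U : Om -> 'cV[R]_k.
Hypothesis sphU : uniform_on_sphere P U.
Variables (K : set 'cV[R]_k) (phi : 'cV[R]_k -> R) (G dl : R) (x z : 'cV[R]_k).
Hypotheses (cK : convex_set (K : set (convex_lmodType 'cV[R]_k)))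
  (cphi : convex_function (K : set (convex_lmodType 'cV[R]_k)) phi)
  (dphi : differentiable_on K phi) (bphi : gradient_bounded K phi G)
  (dl0 : 0 < dl) (k_gt0 : (0 < k)%N)
  (xK : forall v, enorm v <= dl -> K (x + v)) (zK : forall v, enorm v <= dl -> K (z + v)).

Let lip := convex_lipschitz cK cphi dphi bphi.
Let unitU o : enorm (U o) = 1 := sphere_unit sphU o.
Let mU : mvec U := sphere_mvec sphU.

(** At boundary points of [K] gradients need not be unique; any one will do. *)
Definition grad (y : 'cV[R]_k) : 'cV[R]_k := xget 0 [set v | is_gradient K phi y v].

Lemma gradP y : K y -> is_gradient K phi y (grad y).
Proof. by move=> /dphi[v hv]; exact: (@xgetI _ 0 _ v hv). Qed.

Lemma grad_norm y : K y -> enorm (grad y) <= G.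
Proof. by move=> Ky; apply: (bphi Ky); exact: gradP. Qed.

Lemma KxU s v : 0 <= s <= dl -> enorm v <= 1 -> K (x + s *: v).
Proof.
move=> /andP[s0 sd] v1; apply: xK; rewrite enormZ ger0_norm //.
by apply: le_trans sd; rewrite -[leRHS]mulr1 ler_wpM2l.
Qed.

Let Kx : K x. Proof. by rewrite -[x]addr0; apply: xK; rewrite enorm0 ltW. Qed.
Let Kz : K z. Proof. by rewrite -[z]addr0; apply: zK; rewrite enorm0 ltW. Qed.

Let G0 : 0 <= G. Proof. exact: le_trans (enorm_ge0 _) (grad_norm Kx). Qed.

Lemma phi_bound s v : 0 <= s <= dl -> enorm v <= 1 -> `|phi (x + s *: v)| <= `|phi x| + G * dl.
Proof.
move=> hs v1; have /andP[s0 sd] := hs.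
have := lip (KxU hs v1) Kx; rewrite addrAC subrr add0r enormZ (ger0_norm s0) => h.
have : G * (s * enorm v) <= G * (dl * 1) by rewrite ler_wpM2l // ler_pM.
rewrite mulr1 => h2; rewrite -[X in `|X|](subrK (phi x)) addrC.
by apply: le_trans (ler_normD _ _) _; lra.
Qed.

Lemma bmeas_phi s : 0 <= s <= dl -> bmeas (fun o => phi (x + s *: U o)).
Proof.
move=> hs; split; last by exists (`|phi x| + G * dl) => o; rewrite phi_bound // unitU.
apply: (@measurable_caratheodory _ _ _ _ K (fun _ => phi) (fun o => x + s *: U o) G) => //.
- by apply: mvecD; [move=> j; exact: measurable_cst|exact: mvecZ].
- by move=> o; apply: KxU => //; rewrite unitU.
Qed.

Lemma bmeas_coord j : bmeas (fun o => U o j 0).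
Proof. by split; [exact: mU|exists 1 => o; rewrite -(unitU o) coord_le_enorm]. Qed.

Lemma bmeas_dotU v : bmeas (fun o => dotv (U o) v).
Proof. by apply: bmeas_sum => j; apply: bmeasM; [exact: bmeas_coord|exact: bmeas_cst]. Qed.

(** The map [v |-> - v] is orthogonal, so [U] and [- U] have the same law. *)
Lemma Ex_dotU v : Ex P (fun o => dotv (U o) v) = 0.
Proof.
pose F w := dotv (clip w) v.
have FE w : enorm w = 1 -> F w = dotv w v by move=> w1; rewrite /F clip_unit.
have orth : (- 1%:M : 'M[R]_k)^T *m (- 1%:M) = 1%:M.
  by rewrite -raddfN /= tr_scalar_mx -scalar_mxM mulrNN mulr1.
have := Ex_orthogonal sphU (F := F) (M := enorm v) orth; move=> /(_ _)/wrap[].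
  apply: measurable_dotv; first exact: mvec_clip.
  by move=> j; exact: measurable_cst.
move=> /(_ _)/wrap[].
  move=> w; apply: le_trans (cauchy_schwarz _ _) _.
  by rewrite -[leRHS]mul1r ler_wpM2r // clip_norm.
rewrite (_ : (fun o => F (- 1%:M *m U o)) = fun o => -1 * dotv (U o) v); last first.
  by apply/funext => o; rewrite mulNmx mul1mx FE ?enormN ?unitU // dotvNl mulN1r.
rewrite (_ : (fun o => F (U o)) = fun o => dotv (U o) v); last first.
  by apply/funext => o; rewrite FE ?unitU.
by rewrite ExZ; [lra|exact: bmeas_dotU].
Qed.

Let eta := x - z.

Definition radial s o := dotv (U o) eta * phi (x + s *: U o).
Definition radial_rate s o := dotv (U o) eta * dotv (grad (x + s *: U o)) (U o).

Lemma Ex_radial_derive s : 0 < s < dl ->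
  bmeas (radial_rate s) /\
  is_derive s 1 (fun s => Ex P (radial s)) (Ex P (radial_rate s)).
Proof.
move=> hs; apply: (@Ex_derive _ _ _ _ radial radial_rate s 0 dl (enorm eta * G)) => //.
- move=> h /andP[h0 hd]; apply: bmeasM; first exact: bmeas_dotU.
  by apply: bmeas_phi; rewrite !ltW.
- move=> h o hh; have /andP[h0 hd] := hh.
  have Kh : K (x + h *: U o) by apply: KxU; rewrite ?unitU // !ltW.
  have dc : is_derive h 1 (fun h => phi (x + h *: U o)) (dotv (grad (x + h *: U o)) (U o)).
    apply: (@gradient_chain _ _ K phi (fun h => x + h *: U o)); first exact: gradP.
      have : (`]0, dl[%classic : set R) h by rewrite /= in_itv.
      move=> /near_in_itvoo; apply: filterS => h'; rewrite /= in_itv /= => /andP[h1 h2].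
      by apply: KxU; rewrite ?unitU // !ltW.
    move=> j; under eq_fun do rewrite !mxE.
    by apply: is_derive_eq; rewrite /GRing.scale /=; ring.
  by apply: is_derive_eq; rewrite /radial_rate /GRing.scale /=; ring.
move=> h o /andP[h0 hd]; rewrite /radial_rate normrM; apply: ler_pM => //.
  by apply: le_trans (cauchy_schwarz _ _) _; rewrite unitU mul1r.
apply: le_trans (cauchy_schwarz _ _) _; rewrite unitU mulr1 grad_norm //.
by apply: KxU; rewrite ?unitU // !ltW.
Qed.

(** Derivative at [h = 0] of [(Q U)_l phi (x + s Q U)] when [Q] is the rotation
    of angle [h] in the plane of the coordinates [j] and [l]. *)
Definition twist s (j l : 'I_k) o := let g := grad (x + s *: U o) in
  U o j 0 * phi (x + s *: U o) + s * (U o l 0 * (U o j 0 * g l 0 - U o l 0 * g j 0)).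

Lemma Ex_rotated s (Q : 'M[R]_k) l : 0 <= s <= dl -> Q^T *m Q = 1%:M ->
  Ex P (fun o => (Q *m U o) l 0 * phi (x + s *: (Q *m U o))) =
  Ex P (fun o => U o l 0 * phi (x + s *: U o)).
Proof.
move=> hs QQ; pose F v := clip v l 0 * phi (x + s *: clip v).
have Q1 o : enorm (Q *m U o) = 1.
  by rewrite -(unitU o) !enormE dotv_mulmx mulmxA QQ mul1mx.
have := Ex_orthogonal sphU (F := F) (M := `|phi x| + G * dl) QQ.
move=> /(_ _)/wrap[].
  apply: measurable_funM; first exact: mvec_clip.
  apply: (@measurable_caratheodory _ _ (borel_space R k) _ K (fun _ => phi) (fun v => x + s *: clip v) G) => //.
  - by apply: mvecD; [move=> j; exact: measurable_cst|apply: mvecZ => //; exact: mvec_clip].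
  - by move=> v; apply: KxU => //; exact: clip_norm.
move=> /(_ _)/wrap[].
  move=> v; rewrite normrM -[leRHS]mul1r; apply: ler_pM => //.
    exact: le_trans (coord_le_enorm _ _) (clip_norm _).
  by apply: phi_bound => //; exact: clip_norm.
rewrite /F; under eq_fun do rewrite clip_unit //.
by under [in RHS]eq_fun do rewrite clip_unit //.
Qed.

(** The expectation of the rotated expression does not depend on the angle. *)
Lemma Ex_twist s j l : 0 < s < dl -> j != l ->
  bmeas (twist s j l) /\ Ex P (twist s j l) = 0.
Proof.
move=> hs jl; have /andP[s0 sd] := hs.
have hs' : 0 <= s <= dl by rewrite !ltW.
pose V h o := rot_mx j l h *m U o.
have V1 h o : enorm (V h o) = 1 by rewrite rot_mx_enorm.
have KV h o : K (x + s *: V h o) by apply: KxU; rewrite ?V1.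
pose F h o := V h o l 0 * phi (x + s *: V h o).
pose F' h o := turn_rate j l h (U o) l 0 * phi (x + s *: V h o)
  + V h o l 0 * dotv (grad (x + s *: V h o)) (s *: turn_rate j l h (U o)).
have := @Ex_derive _ _ _ P F F' 0 (-1) 1 (4 * (`|phi x| + G * dl) + 1 * (G * (dl * 4))).
move=> /(_ _)/wrap[]; first by rewrite ltrN10 ltr01.
move=> /(_ _)/wrap[].
  move=> h _; apply: bmeasM.
    split; first exact: (mvec_mulmx sphU (rot_mx j l h) l).
    by exists 1 => o; rewrite -(V1 h o) coord_le_enorm.
  split; last by exists (`|phi x| + G * dl) => o; rewrite phi_bound // V1.
  apply: (@measurable_caratheodory _ _ _ _ K (fun _ => phi) (fun o => x + s *: V h o) G) => //.
  by apply: mvecD; [move=> ?; exact: measurable_cst|apply: mvecZ => //; exact: (mvec_mulmx sphU)].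
move=> /(_ _)/wrap[].
  move=> h o _.
  have dc : is_derive h 1 (fun h => phi (x + s *: V h o))
      (dotv (grad (x + s *: V h o)) (s *: turn_rate j l h (U o))).
    apply: (@gradient_chain _ _ K phi (fun h => x + s *: V h o)); first exact: gradP.
      by near=> h'; exact: KV.
    move=> a; under eq_fun do rewrite mxE [X in _ + X]mxE.
    have da := is_derive_rot j l h (U o) a.
    by apply: is_derive_eq; rewrite !mxE /GRing.scale /=; ring.
  have dl' := is_derive_rot j l h (U o) l.
  by apply: is_derive_eq; rewrite /F' /GRing.scale /=; ring.
move=> /(_ _)/wrap[].
  move=> h o _; apply: le_trans (ler_normD _ _) _; rewrite !normrM; apply: lerD.
    apply: ler_pM => //; last by rewrite phi_bound // V1.
    by apply: le_trans (coord_le_enorm _ _) _; rewrite turn_rate_enorm.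
  apply: ler_pM => //; first by rewrite -(V1 h o) coord_le_enorm.
  apply: le_trans (cauchy_schwarz _ _) _; apply: ler_pM => //; first exact: grad_norm.
  rewrite enormZ (ger0_norm (ltW s0)); apply: ler_pM => //; first exact: ltW.
    exact: ltW.
  exact: turn_rate_enorm.
have V0 o : V 0 o = U o.
  by apply/colP => a; rewrite /V rot_mx_coord cos0 sin0 subrr !mul0r !addr0.
have -> : F' 0 = twist s j l.
  apply/funext => o; rewrite /F' /twist V0.
  have -> : turn_rate j l 0 (U o) = turn_mx j l *m U o.
    by apply/colP => a; rewrite /turn_rate cos0 sin0 oppr0 scale0r add0r scale1r.
  have -> : dotv (grad (x + s *: U o)) (s *: (turn_mx j l *m U o)) =
      s * (U o j 0 * grad (x + s *: U o) l 0 - U o l 0 * grad (x + s *: U o) j 0).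
    rewrite dotvZr; congr (_ * _); rewrite /dotv.
    under eq_bigr do rewrite turn_mx_coord mulrBr !mulrA.
    rewrite sumrB; congr (_ - _).
      rewrite (bigD1 l) //= big1 ?addr0 ?eqxx ?mulr1 => [|a al]; first by rewrite mulrC.
      by rewrite (negPf al) mulr0 mul0r.
    rewrite (bigD1 j) //= big1 ?addr0 ?eqxx ?mulr1 => [|a al]; first by rewrite mulrC.
    by rewrite (negPf al) mulr0 mul0r.
  by rewrite turn_mx_coord eqxx eq_sym (negPf jl) /=; ring.
move=> [bt dE]; split => //.
have cE : (fun h => Ex P (F h)) = cst (Ex P (fun o => U o l 0 * phi (x + s *: U o))).
  by apply/funext => h; apply: Ex_rotated => //; exact: rot_mx_orthogonal.
rewrite cE in dE; have := @derive_val _ _ _ _ _ _ _ dE.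
by rewrite derive_cst => <-.
Unshelve. all: by end_near.
Qed.

(** Weighting the identities of [Ex_twist] by the coordinates of [eta] and summing
    them gives
    [(k - 1) * Ex (radial s) + s * Ex (radial_rate s) = s * Ex (dotv (grad (x + s U)) eta)]
    because [U] has norm 1. By convexity [dotv (grad (x + s U)) eta] is at least
    [phi (x + s U) - phi (z + s U)], hence at least
    [phi x + s * dotv (grad x) U - phi z - G * s], and [Ex_dotU] removes the linear
    term. *)
Lemma radial_growth s : 0 < s < dl ->
  s * (phi x - phi z - G * s) <=
  (k%:R - 1) * Ex P (radial s) + s * Ex P (radial_rate s).
Proof.
move=> hs; have /andP[s0 sd] := hs; have hs' : 0 <= s <= dl by rewrite !ltW.
have [brr _] := Ex_radial_derive hs.
have br : bmeas (radial s) by apply: bmeasM; [exact: bmeas_dotU|exact: bmeas_phi].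
(* Rotations exist for [j != l] only. *)
pose tw j l o := if l == j then 0 else eta j 0 * twist s j l o.
have btw j l : bmeas (tw j l) /\ Ex P (tw j l) = 0.
  rewrite /tw; have [_|lj] := eqVneq l j; first by split; [exact: bmeas_cst|exact: Ex_cst].
  have jl : j != l by rewrite eq_sym.
  have [bt e0] := Ex_twist hs jl.
  by split; [exact: bmeasZ|rewrite ExZ // e0 mulr0].
pose S o := \sum_j \sum_l tw j l o.
have bS : bmeas S by apply: bmeas_sum => j; apply: bmeas_sum => l; case: (btw j l).
have ES : Ex P S = 0.
  rewrite /S Ex_sum; last by move=> j; apply: bmeas_sum => l; case: (btw j l).
  rewrite big1 // => j _; rewrite Ex_sum ?big1 //; last by move=> l; case: (btw j l).
  by move=> l _; case: (btw j l).
pose L o := s * (phi x - phi z - G * s) + s * s * dotv (U o) (grad x).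
have bL : bmeas L by apply: bmeasD; [exact: bmeas_cst|apply: bmeasZ; exact: bmeas_dotU].
have EL : Ex P L = s * (phi x - phi z - G * s).
  rewrite ExD ?Ex_cst; [|exact: bmeas_cst|by apply: bmeasZ; exact: bmeas_dotU].
  by rewrite ExZ ?Ex_dotU ?mulr0 ?addr0 //; exact: bmeas_dotU.
rewrite -EL.
have -> : (k%:R - 1) * Ex P (radial s) + s * Ex P (radial_rate s) =
    Ex P (fun o => ((k%:R - 1) * radial s o + s * radial_rate s o) - S o).
  rewrite ExB //; last by apply: bmeasD; exact: bmeasZ.
  by rewrite ES subr0 ExD ?ExZ //; exact: bmeasZ.
apply: Ex_le => //.
  by apply: bmeasB => //; apply: bmeasD; exact: bmeasZ.
move=> o; set gr := grad (x + s *: U o).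
have -> : (k%:R - 1) * radial s o + s * radial_rate s o - S o = s * dotv gr eta.
  have -> : S o = k%:R * (dotv (U o) eta * phi (x + s *: U o))
      + s * (dotv (U o) eta * dotv gr (U o) - dotv gr eta * dotv (U o) (U o))
      - dotv (U o) eta * phi (x + s *: U o).
    have inner j : \sum_l tw j l o = eta j 0 * (k%:R * (U o j 0 * phi (x + s *: U o))
        + s * (U o j 0 * dotv gr (U o) - dotv (U o) (U o) * gr j 0)
        - U o j 0 * phi (x + s *: U o)).
      have -> : \sum_l tw j l o =
          \sum_l eta j 0 * twist s j l o - eta j 0 * (U o j 0 * phi (x + s *: U o)).
        rewrite (bigD1 j) //= [in RHS](bigD1 j) //= /tw eqxx add0r.
        rewrite [X in _ = X + _ - _](_ : _ = eta j 0 * (U o j 0 * phi (x + s *: U o))); last first.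
          by rewrite /twist /=; ring.
        rewrite addrAC subrr add0r; apply: eq_bigr => l lj; by rewrite (negPf lj).
      rewrite -mulr_sumr -mulrBr; congr (_ * (_ - _)); rewrite /twist /= -/gr big_split /=.
      congr (_ + _).
        by rewrite sumr_const card_ord mulr_natl.
      rewrite -mulr_sumr; congr (_ * _); rewrite /dotv mulr_sumr mulr_suml -sumrB.
      by apply: eq_bigr => l _; ring.
    rewrite /S (eq_bigr _ (fun j _ => inner j)).
    rewrite [dotv (U o) eta]/dotv [dotv gr eta]/dotv.
    rewrite !mulr_suml !mulr_sumr -!sumrB ?mulr_sumr -?big_split /= -?sumrB.
    by apply: eq_bigr => j _; ring.
  have -> : dotv (U o) (U o) = 1 by rewrite -sqr_enorm unitU expr1n.
  by rewrite /radial /radial_rate -/gr; ring.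
have U1 : enorm (U o) <= 1 by rewrite unitU.
have KsU := KxU hs' U1.
have KzU : K (z + s *: U o).
  by apply: zK; rewrite enormZ unitU mulr1 ger0_norm // ltW.
have h1 := gradient_ineq cK cphi KsU KzU (gradP KsU).
have h2 := gradient_ineq cK cphi Kx KsU (gradP Kx).
have h3 := lip KzU Kz.
move: h3; rewrite [_ - z]addrAC subrr add0r enormZ unitU mulr1 (ger0_norm (ltW s0)) => h3.
move: h2; rewrite [_ - x]addrAC subrr add0r dotvZr [dotv (grad x) _]dotvC => h2.
move: h1; rewrite -/gr (_ : z + s *: U o - (x + s *: U o) = - eta); last first.
  by rewrite opprD addrACA subrr addr0 opprB.
rewrite dotvNr => h1.
rewrite /L -mulrA -mulrDr ler_wpM2l ?(ltW s0) //.
move: h3; rewrite ler_norml => /andP[_ h3]; lra.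
Qed.

(** [growth_bound] applied to [psi s = Ex (radial s)]; subtracting [phi x] inside the
    expectation changes nothing, by [Ex_dotU]. *)
Lemma two_point_estimate :
  phi x - phi z - G * dl <=
  Ex P (fun o => k%:R / dl * (phi (x + dl *: U o) - phi x) * dotv (U o) (x - z)).
Proof.
have hdl : 0 <= dl <= dl by rewrite lexx ltW.
have br s : 0 <= s <= dl -> bmeas (radial s).
  by move=> hs; apply: bmeasM; [exact: bmeas_dotU|exact: bmeas_phi].
have -> : (fun o => k%:R / dl * (phi (x + dl *: U o) - phi x) * dotv (U o) (x - z)) =
    (fun o => k%:R / dl * radial dl o - (k%:R / dl * phi x) * dotv (U o) eta).
  by apply/funext => o; rewrite /radial -/eta; ring.
have bd := bmeas_dotU eta; have brd := br _ hdl.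
rewrite ExB ?ExZ ?Ex_dotU ?mulr0 ?subr0 //; try exact: bmeasZ.
have kE : (k.-1%:R : R) = k%:R - 1 by rewrite -subn1 natrB.
have := @growth_bound _ k.-1 (fun s => Ex P (radial s)) (fun s => Ex P (radial_rate s))
  (enorm eta * G) (phi x - phi z) G dl dl0 G0.
rewrite prednK //; apply.
- by move=> s hs; case: (Ex_radial_derive hs).
- move=> s s' hs hs'; rewrite -ExB; try exact: br.
  apply: Ex_abs_le; first by apply: bmeasB; exact: br.
  move=> o; rewrite /radial -mulrBr normrM -mulrA; apply: ler_pM => //.
    by apply: le_trans (cauchy_schwarz _ _) _; rewrite unitU mul1r.
  have := lip (KxU hs (v := U o) _) (KxU hs' (v := U o) _); rewrite unitU.
  move=> /(_ (lexx _) (lexx _)) h; apply: le_trans h _.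
  by rewrite opprD addrACA subrr add0r -scalerBl enormZ unitU mulr1.
- rewrite (_ : radial 0 = fun o => phi x * dotv (U o) eta); last first.
    by apply/funext => o; rewrite /radial scale0r addr0 mulrC.
  by rewrite ExZ // Ex_dotU mulr0.
- by move=> s hs; rewrite kE; exact: radial_growth.
Qed.

End Smoothing.

(** * Independence from the past *)

Section Independence.
Context {R : realType} d {Om : measurableType d} (P : probability Om R) {n : nat} {p : 'I_n -> nat}.
Variable u : Om -> trajectory R p.
Hypothesis mu : forall i s, (0 < s)%N -> random_vector (fun o => u o s i).
Hypothesis indep : mutually_independent P u.

(** Events on finitely many directions drawn before round [t]: a pi-system that
    generates the history of round [t]. *)
Definition cylinder (t : nat) : set (set Om) := [set C |
  exists (F : seq ('I_n * nat)) (A : forall k : 'I_n * nat, set 'cV[R]_(p k.1)),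
  [/\ uniq F, {in F, forall k, (0 < k.2 < t)%N}, forall k, borel (A k)
    & C = [set o | forall k, k \in F -> A k (u o k.2 k.1)]]].

Local Notation hist t := (g_sigma_algebraType (cylinder t)).

Lemma borelT k : borel [set: 'cV[R]_k].
Proof. exact: (@measurableT _ (borel_space R k)). Qed.

Lemma borelI k (A B : set 'cV[R]_k) : borel A -> borel B -> borel (A `&` B).
Proof. exact: (@measurableI _ (borel_space R k)). Qed.

Lemma cylinderI t : setI_closed (cylinder t).
Proof.
move=> _ _ [F [A [uF tF bA ->]]] [F' [A' [uF' tF' bA' ->]]].
exists (undup (F ++ F')), (fun k => (if k \in F then A k else setT) `&`
  (if k \in F' then A' k else setT)); split.
- exact: undup_uniq.
- by move=> k; rewrite mem_undup mem_cat => /orP[/tF|/tF'].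
- by move=> k; apply: borelI; case: ifP => // _; exact: borelT.
apply/seteqP; split => [a /= [h h'] k _|a /= h].
  by split; case: ifP => // kF; [exact: h|exact: h'].
split=> k kF; have := h k; rewrite mem_undup mem_cat kF ?orbT => /(_ isT)[] //.
Qed.

Lemma cylinder_measurable t : cylinder t `<=` measurable.
Proof.
move=> _ [F [A [uF tF bA ->]]].
rewrite (_ : [set o | _] = \bigcap_(k in [set` F]) ((fun o => u o k.2 k.1) @^-1` A k)).
  by apply: fin_bigcap_measurable => // k /= /tF /andP[k0 _]; exact: mu.
by apply/seteqP; split.
Qed.

Lemma hist_sub t (A : set Om) : <<s cylinder t >> A -> measurable A.
Proof. exact: (smallest_sub (@sigma_algebra_measurable _ Om) (@cylinder_measurable t)). Qed.

Lemma cylinder_mono s t : (s <= t)%N -> cylinder s `<=` cylinder t.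
Proof.
move=> st _ [F [A [uF tF bA ->]]]; exists F, A; split => // k /tF /andP[-> /= ks].
exact: leq_trans ks st.
Qed.

Lemma hist_mono s t (A : set Om) : (s <= t)%N -> <<s cylinder s >> A -> <<s cylinder t >> A.
Proof. by move=> st; apply: sub_sigma_algebra2; exact: cylinder_mono. Qed.

Lemma hist_direction i s t : (0 < s < t)%N -> @mvec R _ (hist t) _ (fun o => u o s i).
Proof.
move=> st; apply: borel_mvec => B bB; apply: sub_sigma_algebra.
exists [:: (i, s)], (@eqtype.dfwith _ (fun k : 'I_n * nat => set 'cV[R]_(p k.1)) (fun=> setT) (i, s) B).
split => //.
- by move=> k; rewrite inE => /eqP ->.
- by move=> k; case: eqtype.dfwithP => // *; exact: borelT.
apply/seteqP; split => o /=.
  by move=> h k; rewrite inE => /eqP ->; rewrite eqtype.dfwith_in.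
by move=> /(_ (i, s)); rewrite eqtype.dfwith_in; apply; rewrite mem_seq1.
Qed.

(** For cylinders this is mutual independence applied to one more direction, that
    of round [t]; it extends to the generated sigma-algebra because both sides are
    finite measures in [A]. *)
Lemma history_independent i t (A : set Om) (B : set 'cV[R]_(p i)) : (0 < t)%N ->
  <<s cylinder t >> A -> borel B ->
  P (A `&` (fun o => u o t i) @^-1` B) = (P A * P ((fun o => u o t i) @^-1` B))%E.
Proof.
move=> t0 hA bB; set C := _ @^-1` B.
have mC : measurable C by exact: mu.
have fC : P C \is a fin_num by exact: fin_num_measure.
pose c : {nonneg R} := NngNum (fine_ge0 (measure_ge0 P C)).
have cE : (c%:num)%:E = P C by rewrite /= fineK.
suff : mrestr P mC A = mscale c P A.
  by rewrite /mrestr /mscale cE muleC.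
apply: (@g_sigma_algebra_measure_unique _ _ _ (cylinder t) _ (fun=> setT)) hA.
- exact: cylinder_measurable.
- move=> _; exists [::], (fun=> setT); split => //; first by move=> k; exact: borelT.
  by apply/seteqP; split.
- by rewrite bigcup_const.
- exact: cylinderI.
- move=> _ [F [A' [uF tF bA ->]]]; set D0 := [set o | _].
  suff : P (D0 `&` C) = (P D0 * P C)%E by rewrite muleC -cE.
  rewrite {}/D0.
  (* The event for the direction of round [t], added to those of the cylinder. *)
  pose D := @eqtype.dfwith _ (fun k : 'I_n * nat => set 'cV[R]_(p k.1)) A' (i, t) B.
  have tF' : (i, t) \notin F by apply/negP => /tF /=; rewrite ltnn andbF.
  have DF k : k \in F -> D k = A' k.
    by move=> kF; rewrite /D eqtype.dfwith_out //; apply: contraNneq tF' => ->.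
  have hF : {in F, forall k, (0 < k.2)%N} by move=> k /tF /andP[].
  have := @indep ((i, t) :: F) D; rewrite /= tF' uF => /(_ isT)/wrap[].
  move=> /(_ _)/wrap[]; first by move=> k; rewrite inE => /orP[/eqP -> //|/hF].
  move=> /(_ _)/wrap[]; first by move=> k _; rewrite /D; case: eqtype.dfwithP.
  have DB : D (i, t) = B by rewrite /D eqtype.dfwith_in.
  rewrite big_cons DB.
  rewrite (eq_big_seq (fun k => P [set o | A' k (u o k.2 k.1)])); last first.
    by move=> k kF; rewrite DF.
  rewrite -(@indep F A' uF hF) // => eP.
  rewrite muleC -eP; congr (P _); apply/seteqP; split => o /=.
    move=> [h hB] k; rewrite inE => /orP[/eqP ->|kF]; first by rewrite /D eqtype.dfwith_in.
    by rewrite DF //; exact: h.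
  move=> h; split; first by move=> k kF; rewrite -DF //; apply: h; rewrite inE kF orbT.
  by have := h (i, t); rewrite /D eqtype.dfwith_in inE eqxx; exact.
- by move=> k; rewrite [ltLHS](_ : _ = P (setT `&` C)) // setTI (le_lt_trans (probability_le1 P mC)) // ltry.
Qed.

End Independence.

Section Freezing.
Context {R : realType} d d1 d2 {Om : measurableType d} {T1 : measurableType d1} {T2 : measurableType d2}.
Variables (P : probability Om R) (X : Om -> T1) (Y : Om -> T2).
Hypotheses (mX : measurable_fun setT X) (mY : measurable_fun setT Y).
Hypothesis XY : forall A B, measurable A -> measurable B ->
  P (X @^-1` A `&` Y @^-1` B) = (P (X @^-1` A) * P (Y @^-1` B))%E.

Let X' : {mfun Om >-> T1} := HB.pack X (isMeasurableFun.Build _ _ _ _ _ mX).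
Let Y' : {mfun Om >-> T2} := HB.pack Y (isMeasurableFun.Build _ _ _ _ _ mY).
Let XY' : {mfun Om >-> (T1 * T2)%type} :=
  HB.pack (fun o => (X o, Y o)) (isMeasurableFun.Build _ _ _ _ _ (measurable_fun_pair mX mY)).

(** The joint law of [X] and [Y] is the product of their laws, so that the
    expectation can be computed by integrating over [Y] first. Adding the constant
    [M] makes the integrand nonnegative, as iterated integration requires. *)
Lemma freezing_ge0 (Z : T1 * T2 -> R) (M : R) :
  measurable_fun setT Z -> (forall z, `|Z z| <= M) ->
  (forall a, 0 <= Ex P (fun o => Z (a, Y o))) -> 0 <= Ex P (fun o => Z (X o, Y o)).
Proof.
move=> mZ ZM hZ.
pose F z := (Z z + M)%:E : \bar R.
have F0 z : (0 <= F z)%E by rewrite lee_fin; have := ZM z; rewrite ler_norml => /andP[]; lra.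
have mF : measurable_fun setT F by apply/measurable_EFinP; exact: measurable_funD.
have bXY : bmeas (fun o => Z (X o, Y o)).
  by split; [exact: (measurableT_comp mZ (measurable_fun_pair mX mY))|exists M => o; exact: ZM].
have bY a : bmeas (fun o => Z (a, Y o)).
  split; last by exists M => o; exact: ZM.
  by apply: (measurableT_comp mZ); apply: measurable_fun_pair => //; exact: measurable_cst.
have ExM h : bmeas h -> (forall o, 0 <= h o + M) -> ((Ex P h + M)%:E = \int[P]_o (h o + M)%:E)%E.
  move=> bh h0; have bM := bmeasD bh (bmeas_cst M).
  rewrite -[X in _ + X](Ex_cst P M) -ExD //; last exact: bmeas_cst.
  rewrite /Ex /Rintegral fineK //; exact: (integrable_fin_num measurableT (bmeas_integrable P bM)).
have pos z : 0 <= Z z + M by have := F0 z; rewrite lee_fin.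
suff : (M%:E <= (Ex P (fun o => Z (X o, Y o)) + M)%:E)%E by rewrite lee_fin; lra.
rewrite ExM //.
have -> : (\int[P]_o (Z (X o, Y o) + M)%:E = \int[distribution P XY']_z F z)%E.
  by rewrite ge0_integral_distribution.
rewrite (eq_measure_integral (distribution P X' \x distribution P Y')%E); last first.
  move=> A mA _; apply/esym; apply: (@product_measure_unique _ _ _ _ _ (distribution P X') (distribution P Y') (distribution P XY')) => //.
rewrite fubini_tonelli1 //.
have M0 : 0 <= M by exact: le_trans (normr_ge0 _) (ZM (X point, Y point)).
apply: (@le_trans _ _ (\int[distribution P X']_a M%:E)%E).
  rewrite integral_cst // [X in (_ * X)%E](_ : _ = 1%E) ?mule1 //; exact: (@probability_setT _ _ _ (distribution P X')).
apply: ge0_le_integral => //.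
- exact: measurable_fun_fubini_tonelli_F.
- move=> a _; rewrite /fubini_F ge0_integral_distribution //; last first.
    by apply: (measurableT_comp mF); apply: measurable_fun_pair => //; exact: measurable_cst.
  rewrite -ExM //.
  by rewrite lee_fin; have := hZ a; lra.
Qed.

End Freezing.

(** * The run as a random process *)

Section StrategyMeasurability.
Context {R : realType} {n : nat} {p : 'I_n -> nat} d {T : measurableType d}.
Variables (X : forall i : 'I_n, set 'cV[R]_(p i)) (phi : strategy R p R) (F G : R).
Arguments X : clear implicits. Arguments phi : clear implicits.
Variables (h : T -> trajectory R p) (i : 'I_n) (t : nat).
Hypotheses (X0 : forall l, X l 0) (cX : convex_set (X i : set (convex_lmodType 'cV[R]_(p i))))
  (na : non_anticipating X phi) (ms : measurable_strategy X phi) (reg : regular_for X i phi F G)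
  (t_gt0 : (0 < t)%N) (fh : forall a, feasible_traj X (h a))
  (mh : forall s l, (0 < s < t)%N -> mvec (fun a => h a s l)).

(** The strategy sees the trajectory only before round [t], so the later decisions
    may be replaced by 0; the truncated trajectory is measurable as a whole. *)
Lemma measurable_strategy_fixed y : X i y -> measurable_fun setT (fun a => phi i t (h a) y).
Proof.
move=> Xy; pose h' a s l : 'cV[R]_(p l) := if (0 < s < t)%N then h a s l else 0.
have fh' a : feasible_traj X (h' a).
  by move=> s l s0; rewrite /h'; case: ifP => _ //; exact: fh.
have -> : (fun a => phi i t (h a) y) = (fun a => phi i t (h' a) y).
  apply/funext => a; apply: na => // s st; apply: functional_extensionality_dep => l.
  by rewrite /h' st.
move=> _ B mB; rewrite setTI.
have hS := @ms i t y t_gt0 Xy B mB.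
rewrite (_ : _ @^-1` B = h' @^-1` (feasible_traj X `&` [set h | B (phi i t h y)])); last first.
  by apply/seteqP; split => [a ?|a []].
apply: (preimage_sigma _ hS) => _ [s [l [C [bC ->]]]].
rewrite (_ : h' @^-1` _ = (fun a => h' a s l) @^-1` C) //; apply: mvec_borel bC.
rewrite /h'; case st: (0 < s < t)%N; first exact: mh.
exact: mvec_cst.
Qed.

Lemma measurable_strategy_at (V : T -> 'cV[R]_(p i)) :
  mvec V -> (forall a, X i (V a)) -> measurable_fun setT (fun a => phi i t (h a) (V a)).
Proof.
move=> mV XV; apply: (@measurable_caratheodory _ _ _ _ (X i) (fun a => phi i t (h a)) V G) => //.
  by move=> c; exact: measurable_strategy_fixed.
move=> a; exact: (convex_lipschitz cX (regular_convex reg t_gt0 (fh a)) (regular_diff reg t_gt0 (fh a)) (regular_grad reg t_gt0 (fh a))).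
Qed.

End StrategyMeasurability.

(** The coordinates of a projection are Lipschitz. *)
Lemma mvec_projection (R : realType) k d (T : measurableType d) (K : set 'cV[R]_k) (V : T -> 'cV[R]_k) :
  convex_set (K : set (convex_lmodType 'cV[R]_k)) ->
  (forall z, nearest K z (euclid_proj K z)) -> mvec V -> mvec (fun a => euclid_proj K (V a)).
Proof.
move=> cK hK mV j.
apply: (@measurable_caratheodory _ _ _ _ setT (fun _ v => euclid_proj K v j 0) V 1) => //.
move=> _ v v' _ _; rewrite mul1r.
have := coord_le_enorm (euclid_proj K v - euclid_proj K v') j; rewrite !mxE => h.
exact: le_trans h (nearest_nonexpansive cK (hK v) (hK v')).
Qed.

Section ExpectationSums.
Context {R : realType} d {T : measurableType d} (P : probability T R).

Lemma bmeas_sum_seq (I : eqType) (s : seq I) (h : I -> T -> R) :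
  {in s, forall i, bmeas (h i)} -> bmeas (fun a => \sum_(i <- s) h i a).
Proof.
elim: s => [|i s IH] hs; first by under eq_fun do rewrite big_nil; exact: bmeas_cst.
under eq_fun do rewrite big_cons; apply: bmeasD; first by apply: hs; rewrite inE eqxx.
by apply: IH => j js; apply: hs; rewrite inE js orbT.
Qed.

Lemma Ex_sum_ge0 (I : eqType) (s : seq I) (h : I -> T -> R) :
  {in s, forall i, bmeas (h i) /\ 0 <= Ex P (h i)} ->
  0 <= Ex P (fun a => \sum_(i <- s) h i a).
Proof.
elim: s => [|i s IH] hs; first by under [X in Ex _ X]eq_fun do rewrite big_nil; rewrite Ex_cst.
under [X in Ex _ X]eq_fun do rewrite big_cons.
have [hi ei] : bmeas (h i) /\ 0 <= Ex P (h i) by apply: hs; rewrite inE eqxx.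
have hs' : {in s, forall i, bmeas (h i) /\ 0 <= Ex P (h i)}.
  by move=> j js; apply: hs; rewrite inE js orbT.
rewrite ExD //; last by apply: bmeas_sum_seq => j /hs'[].
by rewrite addr_ge0 // IH.
Qed.

End ExpectationSums.

Section RandomRun.
Context {R : realType} {n m : nat} {p : 'I_n -> nat} d {Om : measurableType d} (P : probability Om R).
Variables (X : forall i : 'I_n, set 'cV[R]_(p i)) (f : strategy R p R) (g : strategy R p 'cV[R]_m).
Arguments X : clear implicits. Arguments f : clear implicits. Arguments g : clear implicits.
Variables (W : nat -> 'M[R]_n) (r Rd Ff Fg Gf Gg : 'I_n -> R) (kappa : R).
Variables (u x : Om -> trajectory R p) (q : Om -> nat -> 'I_n -> 'cV[R]_m) (x1 : decision R p).

Let alpha := fun (i : 'I_n) (t : nat) => 1 / t%:R `^ kappa : R.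
Let beta := fun (i : 'I_n) (t : nat) => 1 / t%:R `^ kappa : R.
Let gamma := fun (i : 'I_n) (t : nat) => 1 / t%:R `^ (1 - kappa) : R.
Let xi := fun (i : 'I_n) (t : nat) => 1 / (t%:R + 1) : R.
Let delta := fun (i : 'I_n) (t : nat) => r i / (t%:R + 1) : R.

Hypotheses (kappa01 : 0 < kappa < 1) (assB : assumptionB X f g r Rd Ff Fg Gf Gg).
Hypothesis adm : admissible_adversary X f g.
Hypothesis sphU : forall i t, (0 < t)%N -> uniform_on_sphere P (fun o => u o t i).
Hypothesis indep : mutually_independent P u.
Hypothesis x1_in : forall i, scale_set (1 - xi i 1%N) (X i) (x1 i).
Hypothesis run : forall o, bandit_run X W f g alpha beta gamma xi delta (u o) (x o) (q o) x1.
Hypothesis stochW : forall t, (0 < t)%N -> doubly_stochastic (W t).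

Local Notation hist t := (g_sigma_algebraType (cylinder u t)).

Let unit_u o t i : (0 < t)%N -> enorm (u o t i) = 1.
Proof. by move=> t0; have [_ h _] := sphU i t0; exact: h. Qed.

Let mu i t : (0 < t)%N -> random_vector (fun o => u o t i).
Proof. by move=> t0; have [] := sphU i t0. Qed.

Let xX o i t : (0 < t)%N -> X i (x o t i).
Proof. exact: (x_in assB x1_in (run o)). Qed.

Let x_pert o i t : (0 < t)%N -> X i (x o t i + delta i t *: u o t i).
Proof. exact: (x_perturb_in assB (@unit_u o) x1_in (run o)). Qed.

Let X0 i : X i 0. Proof. exact: (zero_in_X assB). Qed.

Let fx o : feasible_traj X (x o). Proof. by move=> s i; exact: xX. Qed.

Lemma constr_na j : non_anticipating X (constr_component g j).
Proof.
have [_ _ na _] := adm.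
by move=> i t h h' fh fh' hh' y Xy; rewrite /constr_component (na i t h h').
Qed.

Lemma mvec_hist_mono s t k (V : Om -> 'cV[R]_k) : (s <= t)%N ->
  @mvec R _ (hist s) k V -> @mvec R _ (hist t) k V.
Proof.
move=> st hV; apply: borel_mvec => B bB; apply: (hist_mono st).
exact: (@mvec_borel R _ (hist s) k V hV).
Qed.

Lemma measurable_slope dT (T : measurableType dT) (phi : strategy R p R) (F G : R) i t
    (h uu : T -> trajectory R p) :
  regular_for X i phi F G -> non_anticipating X phi -> measurable_strategy X phi -> (0 < t)%N ->
  (forall a, feasible_traj X (h a)) ->
  (forall s l, (0 < s <= t)%N -> mvec (fun a => h a s l)) -> mvec (fun a => uu a t i) ->
  (forall a, X i (h a t i + delta i t *: uu a t i)) ->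
  measurable_fun setT (fun a => slope r (uu a) (h a) phi i t).
Proof.
move=> reg na ms t0 fh mh mu' hp.
have mh' s l : (0 < s < t)%N -> mvec (fun a => h a s l).
  by move=> /andP[s0 st]; apply: mh; rewrite s0 ltnW.
have mt : mvec (fun a => h a t i) by apply: mh; rewrite t0 leqnn.
apply: measurable_funM => //; apply: measurable_funB.
  apply: (measurable_strategy_at X0 (B_convex assB (i := i)) na ms reg) => //.
  by apply: mvecD => //; exact: mvecZ.
apply: (measurable_strategy_at X0 (B_convex assB (i := i)) na ms reg) => //.
by move=> a; exact: fh.
Qed.

(** By induction on the rounds: one step combines past quantities, the directions of
    the past, and values of the strategies at past decisions. *)
Lemma run_measurable t : (0 < t)%N ->
  forall i, @mvec R _ (hist t) _ (fun o => x o t i) /\ @mvec R _ (hist t) _ (fun o => q o t i).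
Proof.
have [naf msf nag msg] := adm.
elim/ltn_ind: t => -[|[|t]] // IH _ i.
  split.
    rewrite (_ : (fun o => x o 1%N i) = fun=> x1 i); first exact: mvec_cst.
    by apply/funext => o; rewrite (run_x1 (run o)).
  rewrite (_ : (fun o => q o 1%N i) = fun=> 0); first exact: mvec_cst.
  by apply/funext => o; rewrite (run_q1 (run o)).
have mx s l : (0 < s <= t.+1)%N -> @mvec R _ (hist t.+2) _ (fun o => x o s l).
  move=> /andP[s0 st]; apply: (@mvec_hist_mono s); first exact: leqW.
  by have [] := IH s st s0 l.
have mq l : @mvec R _ (hist t.+2) _ (fun o => q o t.+1 l).
  apply: (@mvec_hist_mono t.+1); first exact: leqW.
  by have [] := IH t.+1 (ltnSn _) isT l.
have mut : @mvec R _ (hist t.+2) _ (fun o => u o t.+1 i).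
  by apply: hist_direction; rewrite leqnn.
have mqt : @mvec R _ (hist t.+2) _ (fun o => qtilde W (q o) t.+2 i).
  by apply: mvec_sum => j; apply: mvecZ => //; exact: measurable_cst.
have mslf : @measurable_fun _ _ (hist t.+2) _ setT (fun o => slope r (u o) (x o) f i t.+1).
  apply: (@measurable_slope _ (hist t.+2) f (Ff i) (Gf i) i t.+1 x u (B_f assB i)) => // o; exact: x_pert.
have mslg : @mvec R _ (hist t.+2) _ (fun o => slopes g r (u o) (x o) i t.+1).
  move=> j; under eq_fun do rewrite mxE.
  apply: (@measurable_slope _ (hist t.+2) _ (Fg i) (Gg i) i t.+1 x u (B_g assB i j)) => //; last by move=> o; exact: x_pert.
  exact: constr_na.
have mx' : @mvec R _ (hist t.+2) _ (fun o => x o t.+2 i).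
  rewrite (_ : (fun o => x o t.+2 i) = fun o => euclid_proj (scale_set (1 - xi i t.+2) (X i))
      (x o t.+1 i - alpha i t.+2 *: (slope r (u o) (x o) f i t.+1 *: u o t.+1 i
        + dotv (slopes g r (u o) (x o) i t.+1) (qtilde W (q o) t.+2 i) *: u o t.+1 i))); last first.
    by apply/funext => o; exact: (x_next (run o) i (ltn0Sn t)).
  apply: mvec_projection.
  - exact: (convex_scale_set (B_convex assB (i := i))).
  - move=> z; apply: (nearest_scale_set (B_closed assB (i := i)) (ltW (r_gt0 assB i)) (B_inner assB (i := i)) (B_outer assB (i := i))).
    have /andP[h1 h2] : 0 < xi i t.+2 <= 2^-1 by exact: (@xi_bounds R n i t.+2).
    by move: (xi i t.+2) h1 h2 => a; lra.
  apply: mvecB; first by apply: mx; rewrite leqnn.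
  apply: mvecZ => //; apply: mvecD; apply: mvecZ => //.
  exact: measurable_dotv.
split=> //.
rewrite (_ : (fun o => q o t.+2 i) = fun o => pospart ((1 - gamma i t.+2 * beta i t.+2) *: qtilde W (q o) t.+2 i +
    gamma i t.+2 *: (dotv (u o t.+1 i) (x o t.+2 i - x o t.+1 i) *: slopes g r (u o) (x o) i t.+1
      + g i t.+1 (x o) (x o t.+1 i)))); last first.
  by apply/funext => o; exact: (q_next (run o) i (ltn0Sn t)).
have mx1 : @mvec R _ (hist t.+2) _ (fun o => x o t.+1 i) by apply: mx; rewrite leqnn.
apply: (mvec_projection (@convex_orthant _ _)); first exact: nearest_pospart.
apply: mvecD; apply: mvecZ => //; apply: mvecD.
  by apply: mvecZ => //; apply: measurable_dotv => //; exact: mvecB.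
move=> j.
apply: (@measurable_strategy_at R n p _ (hist t.+2) X (constr_component g j) (Fg i) (Gg i) x i t.+1 X0 (B_convex assB (i := i)) _ (msg j) (B_g assB i j)) => //.
- exact: constr_na.
- by move=> s l /andP[s0 st]; apply: mx; rewrite s0 ltnW.
- by move=> o; exact: xX.
Qed.

Lemma hist_measurable t : (0 < t)%N -> forall h : Om -> R,
  @measurable_fun _ _ (hist t) _ setT h -> measurable_fun setT h.
Proof.
move=> t0 h mh _ B mB; rewrite setTI; have := mh measurableT B mB; rewrite setTI.
by apply: hist_sub => // i s; exact: mu.
Qed.

(** Given the history, [two_point_estimate] bounds the expected gap from below; a
    nonnegative weight known from the history keeps the sign. *)
Lemma weighted_gap_ge0 (phi : strategy R p R) (F G M : R) i t (h : Om -> R) (z y : 'cV[R]_(p i)) :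
  regular_for X i phi F G -> non_anticipating X phi -> measurable_strategy X phi ->
  0 <= G -> (0 < t)%N -> @measurable_fun _ _ (hist t) _ setT h -> (forall o, 0 <= h o <= M) ->
  scale_set (1 - xi i t) (X i) z -> X i y -> enorm (z - y) <= xi i t * Rd i ->
  bmeas (fun o => h o * est_gap r Rd (u o) (x o) phi G t z y) /\
  0 <= Ex P (fun o => h o * est_gap r Rd (u o) (x o) phi G t z y).
Proof.
move=> reg na ms G0 t0 mh hM zX yX zy.
have d0 : 0 < delta i t by exact: (delta_gt0 assB).
pose vec := borel_space R (p i).
pose T := (hist t * vec)%type.
pose ph o := phi i t (x o).
(* The weighted gap with the direction as a separate variable; on the sphere
   clipping does not change it. *)
pose Z (a : T) := h a.1 * ((p i)%:R / delta i t *
    (ph a.1 (x a.1 t i + delta i t *: clip a.2) - ph a.1 (x a.1 t i))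
    * dotv (clip a.2) (x a.1 t i - z) - (ph a.1 (x a.1 t i) - ph a.1 y)
    + G * shrink_err r Rd i t).
have xcl o v : X i (x o t i + delta i t *: clip v).
  apply: (shrunk_perturb assB t0 (x_shrunk assB x1_in (run o) i t0)).
  rewrite enormZ ger0_norm -/(delta i t); last exact: ltW.
  by rewrite -[leRHS]mulr1 ler_wpM2l ?clip_norm // ltW.
have mx s l : (0 < s <= t)%N -> @mvec R _ T _ (fun a => x a.1 s l).
  move=> /andP[s0 st] j.
  have [hx _] := run_measurable s0 l.
  exact: (measurableT_comp (mvec_hist_mono st hx j) measurable_fst).
have mxt : @mvec R _ T _ (fun a => x a.1 t i) by apply: mx; rewrite t0 leqnn.
have mclip : @mvec R _ T _ (fun a => clip a.2).
  by move=> j; exact: (measurableT_comp (@mvec_clip R (p i) j) measurable_snd).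
have mx' s l : (0 < s < t)%N -> @mvec R _ T _ (fun a => x a.1 s l).
  by move=> /andP[s0 st]; apply: mx; rewrite s0 ltnW.
have mph V : @mvec R _ T _ V -> (forall a, X i (V a)) -> measurable_fun setT (fun a : T => ph a.1 (V a)).
  move=> mV XV.
  by apply: (@measurable_strategy_at R n p _ T X phi F G (fun a => x a.1) i t X0 (B_convex assB (i := i)) na ms reg).
have mZ : measurable_fun setT Z.
  apply: measurable_funM; first exact: (measurableT_comp mh measurable_fst).
  apply: measurable_funD => //; apply: measurable_funB; last first.
    apply: measurable_funB; first by apply: (mph (fun a => x a.1 t i)) => // a; exact: xX.
    by apply: (mph (fun=> y)) => //; exact: mvec_cst.
  apply: measurable_funM; last first.
    by apply: measurable_dotv => //; apply: mvecB => //; exact: mvec_cst.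
  apply: measurable_funM => //; apply: measurable_funB; apply: mph => //.
    by apply: mvecD => //; exact: mvecZ.
  by move=> a; exact: xX.
have zX' : X i z by exact: (shrunk_sub assB t0 zX).
have hF o v : X i v -> `|ph o v| <= F by move=> Xv; exact: (regular_bounded reg t0 (fx o) Xv).
have hFF o v v' : X i v -> X i v' -> `|ph o v - ph o v'| <= F + F.
  by move=> Xv Xv'; apply: le_trans (ler_normB _ _) _; apply: lerD; exact: hF.
have ZM a : `|Z a| <= M * ((p i)%:R / delta i t * (F + F) * (Rd i + Rd i) + (F + F) + G * shrink_err r Rd i t).
  have /andP[h0 h1] := hM a.1.
  have pd0 : 0 <= (p i)%:R / delta i t by apply: divr_ge0 => //; exact: ltW.
  have e0 : 0 <= G * shrink_err r Rd i t.
    by rewrite mulr_ge0 // divr_ge0 ?addr_ge0 // ltW // ?(r_gt0 assB) ?(Rd_gt0 assB).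
  rewrite /Z normrM (ger0_norm h0); apply: ler_pM => //.
  apply: le_trans (ler_normD _ _) _; rewrite (ger0_norm e0) lerD2r.
  apply: le_trans (ler_normB _ _) _; apply: lerD; last by apply: hFF => //; exact: xX.
  rewrite normrM; apply: ler_pM => //.
    rewrite normrM (ger0_norm pd0); apply: ler_wpM2l => //.
    by apply: hFF => //; exact: xX.
  apply: le_trans (cauchy_schwarz _ _) _; rewrite -[leRHS]mul1r; apply: ler_pM => //.
    exact: clip_norm.
  apply: le_trans (enormB _ _) _; apply: lerD; apply: (X_norm assB) => //; exact: xX.
have cu o : clip (u o t i) = u o t i by rewrite clip_unit // unit_u.
have ZE o : Z (o, u o t i) = h o * est_gap r Rd (u o) (x o) phi G t z y.
  by rewrite /Z /= cu /est_gap /slope.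
have mX : @measurable_fun _ _ Om (hist t) setT id.
  by move=> _ B hB; rewrite setTI; apply: hist_sub hB => j s; exact: mu.
have mY : @measurable_fun _ _ Om vec setT (fun o => u o t i).
  by move=> _ B hB; rewrite setTI; exact: (mu t0).
split.
  split; last by eexists => o; rewrite -ZE; exact: ZM.
  under eq_fun do rewrite -ZE.
  exact: (measurableT_comp mZ (measurable_fun_pair mX mY)).
under [X in Ex _ X]eq_fun do rewrite -ZE.
apply: (@freezing_ge0 _ _ _ _ Om (hist t) vec P id (fun o => u o t i) mX mY _ Z _ mZ ZM).
  by move=> A B mA mB; apply: (history_independent mu indep t0).
move=> o; have /andP[h0 _] := hM o.
have reg1 := regular_convex reg t0 (fx o).
have xball v : enorm v <= delta i t -> X i (x o t i + v).
  exact: (shrunk_perturb assB t0 (x_shrunk assB x1_in (run o) i t0)).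
have zball v : enorm v <= delta i t -> X i (z + v) by exact: (shrunk_perturb assB t0 zX).
have est := two_point_estimate (sphU i t0) (B_convex assB (i := i)) reg1
  (regular_diff reg t0 (fx o)) (regular_grad reg t0 (fx o)) d0
  (dim_gt0 (@unit_u o) i) xball zball.
set Wf := (fun o' => _) in est.
have bW : bmeas Wf.
  apply: bmeasM; last exact: (bmeas_dotU (sphU i t0)).
  apply: bmeasZ; apply: bmeasB; last exact: bmeas_cst.
  have dd : 0 <= delta i t <= delta i t by rewrite lexx ltW.
  exact: (bmeas_phi (sphU i t0) (B_convex assB (i := i)) reg1
    (regular_diff reg t0 (fx o)) (regular_grad reg t0 (fx o)) d0 xball dd).
have -> : (fun o' => Z (o, u o' t i)) = (fun o' => h o * (Wf o' + (- (ph o (x o t i) - ph o y) + G * shrink_err r Rd i t))).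
  by apply/funext => o'; rewrite /Z /= cu /Wf /ph addrA.
rewrite ExZ; last by apply: bmeasD => //; exact: bmeas_cst.
rewrite ExD // ?Ex_cst; last exact: bmeas_cst.
apply: mulr_ge0 => //.
have lipz := regular_lipschitz assB reg t0 (fx o) zX' yX.
have h1 : G * enorm (z - y) <= G * (xi i t * Rd i) by exact: ler_wpM2l.
have h2 : G * shrink_err r Rd i t = G * delta i t + G * (xi i t * Rd i).
  by rewrite /shrink_err /delta /xi; move: (t%:R + 1)^-1 => a; ring.
have /ler_normlP[_ h3] := lipz.
rewrite h2 /ph; move: est h1 h3; rewrite -/Wf; move: (Ex P Wf) (G * delta i t) (G * (_ * _)) => a b c.
by lra.
Qed.

(** The weights are the mixed multipliers of round [t], which depend on the
    directions before round [t] only. *)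
Lemma total_gap_ge0 (y : trajectory R p) i t : (0 < t)%N -> X i (y t i) ->
  bmeas (fun o => total_gap f g W r Rd Gf Gg (u o) (x o) (q o) y i t) /\
  0 <= Ex P (fun o => total_gap f g W r Rd Gf Gg (u o) (x o) (q o) y i t).
Proof.
move=> t0 Xy; have [naf msf nag msg] := adm.
have zX : scale_set (1 - xi i t) (X i) (shrunk y i t) by exact: shrunk_in.
have /andP[xi0 xi1] : 0 < xi i t <= 2^-1 by exact: (@xi_bounds R n i t).
have zy : enorm (shrunk y i t - y t i) <= xi i t * Rd i.
  have -> : shrunk y i t - y t i = - xi i t *: y t i.
    by apply/colP => j; rewrite !mxE /xi; ring.
  rewrite enormZ normrN gtr0_norm // ler_wpM2l ?(ltW xi0) //.
  exact: (X_norm assB).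
have gapf := weighted_gap_ge0 (h := fun=> 1) (M := 1) (B_f assB i) naf msf
  (ltW (Gf_gt0 assB i)) t0 (measurable_cst _) _ zX Xy zy.
have {}gapf : bmeas (fun o => 1 * est_gap r Rd (u o) (x o) f (Gf i) t (shrunk y i t) (y t i)) /\
    0 <= Ex P (fun o => 1 * est_gap r Rd (u o) (x o) f (Gf i) t (shrunk y i t) (y t i)).
  by apply: gapf => o; rewrite ler01 lexx.
pose v j o := vmix (W t) (q o t) i j 0.
have mv j : @measurable_fun _ _ (hist t) _ setT (v j).
  have : @mvec R _ (hist t) _ (fun o => vmix (W t) (q o t) i).
    apply: mvec_sum => l; apply: mvecZ => //.
    by have [] := run_measurable t0 l.
  by move=> h; exact: (h j).
have gapg j := weighted_gap_ge0 (h := v j) (B_g assB i j) (constr_na j) (msg j)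
  (ltW (Gg_gt0 assB i)) t0 (mv j) _ zX Xy zy.
pose c := 2 * (Num.sqrt m%:R * \big[Num.max/0]_(i0 < n) Fg i0 +
  Num.sqrt m%:R * (\sum_(i0 < n) p i0)%:R * \big[Num.max/0]_(i0 < n) Gg i0 * \big[Num.max/0]_(i0 < n) Rd i0) *
 t%:R `^ kappa.
have vb j o : 0 <= v j o <= c.
  apply/andP; split; first exact: (qtilde_ge0 (run o) stochW (t := t.+1)).
  apply: le_trans (ler_norm _) _; apply: le_trans (coord_le_enorm _ _) _.
  apply: (vmix_norm_le stochW) => // l.
  exact: (q_norm_le kappa01 assB (@unit_u o) x1_in (run o) stochW).
have {}gapg := gapg c vb.
have [bf ef] : bmeas (fun o => est_gap r Rd (u o) (x o) f (Gf i) t (shrunk y i t) (y t i)) /\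
    0 <= Ex P (fun o => est_gap r Rd (u o) (x o) f (Gf i) t (shrunk y i t) (y t i)).
  by move: gapf; under eq_fun do rewrite mul1r.
rewrite /total_gap; split.
  by apply: bmeasD => //; apply: bmeas_sum => j; case: (gapg j).
rewrite ExD //; last by apply: bmeas_sum => j; case: (gapg j).
by apply: addr_ge0 => //; apply: Ex_sum_ge0 => j _; exact: gapg.
Qed.

Lemma bmeas_strategy (phi : strategy R p R) (F G : R) i t :
  regular_for X i phi F G -> non_anticipating X phi -> measurable_strategy X phi -> (0 < t)%N ->
  bmeas (fun o => phi i t (x o) (x o t i)) /\
  forall y, X i y -> bmeas (fun o => phi i t (x o) y).
Proof.
move=> reg na ms t0.
have mx s l : (0 < s)%N -> mvec (fun o => x o s l).
  by move=> s0 j; have [h _] := run_measurable s0 l; exact: (hist_measurable s0 (h j)).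
have mx' s l : (0 < s < t)%N -> mvec (fun o => x o s l) by move=> /andP[/mx].
have mV V : mvec V -> (forall o, X i (V o)) -> bmeas (fun o => phi i t (x o) (V o)).
  move=> mV XV; split; last by exists F => o; exact: (regular_bounded reg t0 (fx o) (XV o)).
  exact: (measurable_strategy_at X0 (B_convex assB (i := i)) na ms reg).
split; first by apply: mV => [|o]; [exact: mx|exact: xX].
by move=> y Xy; apply: (mV (fun=> y)) => //; exact: mvec_cst.
Qed.

Lemma bmeas_regret (y : trajectory R p) T : (forall t i, (0 < t <= T)%N -> X i (y t i)) ->
  bmeas (fun o => regret f T (x o) y).
Proof.
move=> Xy; have [naf msf _ _] := adm.
have mem t : t \in index_iota 1 T.+1 -> (0 < t <= T)%N by rewrite mem_index_iota ltnS.
apply: bmeasB; apply: bmeas_sum_seq => t /mem tT; have /andP[t0 _] := tT;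
  apply: bmeas_sum => i; have [b1 b2] := bmeas_strategy (B_f assB i) naf msf t0 => //.
by apply: b2; exact: Xy.
Qed.

Lemma regret_ge (y : trajectory R p) T o : (forall t i, (0 < t <= T)%N -> X i (y t i)) ->
  - (2 * T%:R * \sum_i Ff i) <= regret f T (x o) y.
Proof.
move=> Xy.
have b (v : trajectory R p) : (forall t i, (0 < t <= T)%N -> X i (v t i)) ->
    `|\sum_(1 <= t < T.+1) round_sum f t (x o) (v t)| <= T%:R * \sum_i Ff i.
  move=> Xv; apply: le_trans (ler_norm_sum _ _ _) _.
  apply: (@le_trans _ _ (\sum_(1 <= t < T.+1) \sum_i Ff i)); last first.
    by rewrite sumr_const_nat subn1 mulr_natl.
  apply: ler_sum_nat => t; rewrite ltnS => tT; have /andP[t0 _] := tT.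
  apply: le_trans (ler_norm_sum _ _ _) _; apply: ler_sum => i _.
  by apply: (regular_bounded (B_f assB i) t0 (fx o)); exact: Xv.
have := b (x o) (fun t i h => xX o i (proj1 (andP h))); have := b y Xy.
rewrite /regret !ler_norml => /andP[_ h1] /andP[h2 _].
rewrite -mulrA; move: h1 h2; move: (T%:R * \sum_i Ff i) (\sum_(1 <= t < T.+1) _) (\sum_(1 <= t < T.+1) _) => c s s1; lra.
Qed.

Definition violation T o : 'cV[R]_m := \sum_(1 <= t < T.+1) round_sum g t (x o) (x o t).

Lemma bmeas_violation T : bmeas (fun o => enorm (pospart (violation T o))).
Proof.
have [_ _ nag msg] := adm.
have bS j : bmeas (fun o => violation T o j 0).
  under eq_fun do rewrite summxE; apply: bmeas_sum_seq => t.
  rewrite mem_index_iota ltnS => /andP[t0 _].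
  under eq_fun do rewrite summxE; apply: bmeas_sum => i.
  by have [] := bmeas_strategy (B_g assB i j) (constr_na j) (msg j) t0.
split.
  apply: measurable_enorm; apply: (mvec_projection (@convex_orthant _ _)).
    exact: nearest_pospart.
  by move=> j; case: (bS j).
have hM j : exists M, forall o, `|violation T o j 0| <= M by case: (bS j).
exists (Num.sqrt m%:R * \sum_j `|projT1 (cid (hM j))|) => o.
rewrite ger0_norm ?enorm_ge0 //; apply: le_trans (enorm_pospart_le _) _.
apply: enorm_bounded_coord => [|j]; first exact: sumr_ge0.
rewrite (bigD1 j) //=; case: (cid (hM j)) => M /= hMj.
apply: le_trans (hMj o) _; apply: le_trans (ler_norm _) _.
by rewrite lerDl sumr_ge0.
Qed.

End RandomRun.

(** * Regret and constraint violation *)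

(** Take expectations in [N <= N ^+ 2 / (2 * l) + l / 2]. *)
Lemma Ex_le_of_square (R : realType) d (T : measurableType d) (P : probability T R) (N : T -> R) (l : R) :
  0 < l -> bmeas N -> Ex P (fun a => N a * N a) <= l ^+ 2 -> Ex P N <= l.
Proof.
move=> l0 bN hN; have bNN := bmeasM bN bN.
have : Ex P N <= Ex P (fun a => (2 * l)^-1 * (N a * N a) + l / 2).
  apply: Ex_le => //; first by apply: bmeasD; [exact: bmeasZ|exact: bmeas_cst].
  move=> a; rewrite -subr_ge0.
  have -> : (2 * l)^-1 * (N a * N a) + l / 2 - N a = (2 * l)^-1 * (N a - l) ^+ 2.
    by field; lra.
  by rewrite mulr_ge0 ?sqr_ge0 // invr_ge0; lra.
rewrite ExD; [|exact: bmeasZ|exact: bmeas_cst].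
rewrite (@ExZ _ _ _ P _ _ bNN) Ex_cst => h; apply: le_trans h _.
have : (2 * l)^-1 * Ex P (fun a => N a * N a) <= (2 * l)^-1 * l ^+ 2.
  by rewrite ler_wpM2l // invr_ge0; lra.
have -> : (2 * l)^-1 * l ^+ 2 = l / 2 by field; lra.
lra.
Qed.

Theorem theorem2 (R : realType) (n m : nat) (p : 'I_n -> nat)
  (d : measure_display) (Om : measurableType d) (P : probability Om R)
  (X : forall i : 'I_n, set 'cV[R]_(p i))
  (f : strategy R p R) (g : strategy R p 'cV[R]_m)
  (E : nat -> rel 'I_n) (W : nat -> 'M[R]_n) (w : R) (iota : nat)
  (r Rd Ff Fg Gf Gg : 'I_n -> R) (kappa : R)
  (u : Om -> trajectory R p) (x1 : decision R p)
  (x : Om -> trajectory R p) (q : Om -> nat -> 'I_n -> 'cV[R]_m) :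
  let alpha := fun (i : 'I_n) (t : nat) => 1 / t%:R `^ kappa in
  let beta := fun (i : 'I_n) (t : nat) => 1 / t%:R `^ kappa in
  let gamma := fun (i : 'I_n) (t : nat) => 1 / t%:R `^ (1 - kappa) in
  let xi := fun (i : 'I_n) (t : nat) => 1 / (t%:R + 1) in
  let delta := fun (i : 'I_n) (t : nat) => r i / (t%:R + 1) in
  let ptot : R := (\sum_(i < n) p i)%:R in
  let Rmax := \big[Num.max/0]_(i < n) Rd i in
  let Fgmax := \big[Num.max/0]_(i < n) Fg i in
  let Ggmax := \big[Num.max/0]_(i < n) Gg i in
  let sm : R := Num.sqrt m%:R in
  let tau := (1 - w / (2 * n%:R ^+ 2)) ^- 2 in
  let lambda := (1 - w / (2 * n%:R ^+ 2)) `^ (1 / iota%:R) in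
  let B1 := sm * Fgmax + sm * ptot * Ggmax * Rmax in
  let C0 := 6 * n%:R ^+ 2 * sm * tau * B1 * Fgmax / (1 - lambda)
            + 2 * n%:R * B1 ^+ 2 in
  let C3 := \sum_(i < n) (2 * Gf i * (r i + Rd i) + 8 * Rd i ^+ 2
                          + 2 * sm * B1 * Gg i * Rd i / kappa
                          + (p i)%:R ^+ 2 * Gf i ^+ 2 / (1 - kappa))
            + C0 / kappa in
  let C41 := \sum_(i < n)
    2 * ((2 * m%:R * (p i)%:R ^+ 2 * Gg i ^+ 2 + 1) / (1 - kappa) + 1) in
  let C4 := C41 * (2 * \sum_(i < n) Ff i + C3) in
  (0 < n)%N ->
  0 < kappa < 1 ->
  mixing_matrices E W ->
  assumptionA E W w iota ->
  assumptionB X f g r Rd Ff Fg Gf Gg ->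
  admissible_adversary X f g ->
  (forall i t, (0 < t)%N -> uniform_on_sphere P (fun o => u o t i)) ->
  mutually_independent P u ->
  (forall i, scale_set (1 - xi i 1%N) (X i) (x1 i)) ->
  (forall o, bandit_run X W f g alpha beta gamma xi delta
               (u o) (x o) (q o) x1) ->
  (forall T, (0 < T)%N -> comparators X P g x T !=set0) ->
  (forall T, (0 < T)%N -> static_comparators X P g x T !=set0) ->
  forall T : nat, (0 < T)%N ->
  forall y : trajectory R p, comparators X P g x T y ->
    ('E_P[fun o => regret f T (x o) y]
       <= (C3 * T%:R `^ Num.max kappa (1 - kappa)
           + 2 * Rmax * T%:R `^ kappa * path_length T y)%:E)%E /\
    ('E_P[fun o => enorm (pospart
                     (\sum_(1 <= t < T.+1) round_sum g t (x o) (x o t)))]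
       <= (Num.sqrt C4 * T%:R `^ (1 - kappa / 2))%:E)%E.
Proof.
move=> alpha beta gamma xi delta ptot Rmax Fgmax Ggmax sm tau lambda B1 C0 C3 C41 C4.
move=> n0 kappa01 mixW assA assB adm sphU indep x1_in run _ static T T0 y [yX yg].
have stochW t : (0 < t)%N -> doubly_stochastic (W t) by exact: (A_stoch assA).
have unit_u o t i : (0 < t)%N -> enorm (u o t i) = 1.
  by move=> t0; have [_ h _] := sphU i t t0; exact: h.
pose S o := violation g x T o.
pose gap y' o := \sum_(1 <= t < T.+1) \sum_i total_gap f g W r Rd Gf Gg (u o) (x o) (q o) y' i t.
have gapP y' : (forall t i, (0 < t <= T)%N -> X i (y' t i)) -> bmeas (gap y') /\ 0 <= Ex P (gap y').
  move=> y'X.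
  have h t : t \in index_iota 1 T.+1 -> forall i, bmeas (fun o => total_gap f g W r Rd Gf Gg (u o) (x o) (q o) y' i t) /\
      0 <= Ex P (fun o => total_gap f g W r Rd Gf Gg (u o) (x o) (q o) y' i t).
    rewrite mem_index_iota ltnS => tT i; have /andP[t0 _] := tT.
    exact: (total_gap_ge0 kappa01 assB adm sphU indep x1_in run stochW t0 (y'X t i tT)).
  split; first by apply: bmeas_sum_seq => t /h ht; apply: bmeas_sum => i; case: (ht i).
  apply: Ex_sum_ge0 => t /h ht; split; first by apply: bmeas_sum => i; case: (ht i).
  by apply: Ex_sum_ge0 => i _; exact: ht.
have breg y' : (forall t i, (0 < t <= T)%N -> X i (y' t i)) -> bmeas (fun o => regret f T (x o) y').
  exact: (bmeas_regret assB adm sphU x1_in run).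
have pw o := pathwise kappa01 assB (unit_u o) x1_in (run o) stochW n0 mixW assA.
split.
  rewrite expectation_Ex ?lee_fin; last exact: breg.
  have [bg g0] := gapP y yX.
  set B := (X in _ <= X).
  suff : Ex P (fun o => gap y o + regret f T (x o) y) <= B by rewrite ExD //; [lra|exact: breg].
  rewrite -[leRHS](Ex_cst P); apply: Ex_ae_le; [by apply: bmeasD => //; exact: breg|exact: bmeas_cst|].
  apply: filterS yg => o yo.
  have := pw o y 0 T T0 yX yo; move=> /(_ _)/wrap[]; first by move=> j; rewrite mxE.
  by rewrite dotv0l addr0 enorm0 expr0n /= mulr0 add0r.
have [y' [[y'X y'g] [z y'z]]] := static T T0.
have pl0 : path_length T y' = 0.
  rewrite /path_length big_nat big1 // => t /andP[t0 tT]; rewrite big1 // => i _.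
  by rewrite !y'z ?subrr ?enorm0 ?t0 ?(ltnW tT).
have tT0 : 0 < T%:R :> R by rewrite ltr0n.
have tT1 : 1 <= T%:R :> R by rewrite ler1n.
have /andP[k0 k1] := kappa01.
pose i0 : 'I_n := Ordinal n0.
have Gg0 i : 0 <= Gg i by exact/ltW/(Gg_gt0 assB).
have Gf0 i : 0 <= Gf i by exact/ltW/(Gf_gt0 assB).
have Rd0 i : 0 <= Rd i by exact/ltW/(Rd_gt0 assB).
have r0 i : 0 <= r i by exact/ltW/(r_gt0 assB).
have C41_gt0 : 0 < C41.
  have pos i : 0 < 2 * ((2 * m%:R * (p i)%:R ^+ 2 * Gg i ^+ 2 + 1) / (1 - kappa) + 1).
    have k1' : 0 <= 1 - kappa by rewrite subr_ge0 ltW.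
    by rewrite mulr_gt0 // ltr_wpDl // divr_ge0 // addr_ge0 // !mulr_ge0 ?exprn_ge0.
  rewrite /C41 (bigD1 i0) //= ltr_pwDl ?pos // sumr_ge0 // => i _.
  exact/ltW/pos.
have B1_0 : 0 <= B1 by exact: (B1_ge0 assB (unit_u point) i0).
have Fg0 : 0 <= Fgmax by apply: le_trans (Fg_le_max Fg i0); exact/ltW/(Fg_gt0 assB).
have C3_ge0 : 0 <= C3.
  have /andP[l0 l1] := lambda_bounds n0 assA.
  have /andP[w0 w1] := mixing_rate_bounds n0 assA.
  have tau0 : 0 <= tau by rewrite invr_ge0 exprn_ge0 //; lra.
  apply: addr_ge0; last first.
    apply: divr_ge0; last exact: ltW.
    apply: addr_ge0; last by rewrite !mulr_ge0 ?exprn_ge0.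
    apply: divr_ge0; last by rewrite subr_ge0 ltW.
    by rewrite !mulr_ge0 ?exprn_ge0 ?sqrtr_ge0.
  apply: sumr_ge0 => i _; have k1' : 0 <= 1 - kappa by rewrite subr_ge0 ltW.
  have k0' := ltW k0; have rR : 0 <= r i + Rd i by rewrite addr_ge0.
  by rewrite !addr_ge0 // ?divr_ge0 // ?mulr_ge0 ?exprn_ge0 ?sqrtr_ge0.
have Ff_sum : 0 < \sum_i Ff i.
  rewrite (bigD1 i0) //= ltr_pwDl ?(Ff_gt0 assB) // sumr_ge0 // => i _.
  exact/ltW/(Ff_gt0 assB).
have C4_gt0 : 0 < C4 by rewrite mulr_gt0 // ltr_pwDl // mulr_gt0.
(* The coefficient of [enorm qq ^+ 2] in [pathwise]. *)
pose A := C41 / 4 * T%:R `^ (1 - kappa).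
have A0 : 0 < A by rewrite mulr_gt0 ?powR_gt0 // divr_gt0.
pose N o := enorm (pospart (S o)).
have bN : bmeas N by exact: (bmeas_violation assB adm sphU x1_in run).
rewrite (_ : (fun o => _) = N) // expectation_Ex // lee_fin.
apply: Ex_le_of_square => //; first by rewrite mulr_gt0 ?powR_gt0 // sqrtr_gt0.
have [bg g0] := gapP y' y'X.
have := bmeasM bN bN; set NN := (fun o => _ * _) => bNN.
pose K := 4 * A * (C3 * T%:R `^ Num.max kappa (1 - kappa) + 2 * T%:R * \sum_i Ff i).
have : Ex P (fun o => NN o + 4 * A * gap y' o) <= K.
  rewrite -[leRHS](Ex_cst P); apply: Ex_ae_le; [by apply: bmeasD => //; exact: bmeasZ|exact: bmeas_cst|].
  apply: filterS y'g => o yo.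
  (* The multiplier that maximizes [dotv qq S - A * enorm qq ^+ 2]. *)
  have := pw o y' ((2 * A)^-1 *: pospart (S o)) T T0 y'X yo; move=> /(_ _)/wrap[].
    by move=> j; rewrite mxE mulr_ge0 ?pospart_ge0 // invr_ge0 mulr_ge0 // ltW.
  rewrite pl0 mulr0 addr0 dotvZl dotv_pospart enormZ exprMn.
  have reg := regret_ge assB x1_in run o y'X.
  rewrite -/(gap y' o) -/A (_ : enorm (pospart _) = N o) //.
  have -> : A * (`|(2 * A)^-1| ^+ 2 * N o ^+ 2) = (2 * A)^-1 * NN o / 2.
    by rewrite real_normK ?num_real // /NN; field; rewrite gt_eqF.
  have -> : (2 * A)^-1 * N o ^+ 2 = (2 * A)^-1 * NN o by rewrite expr2.
  rewrite -/C3 => main; rewrite /K -[NN o](_ : 4 * A * ((2 * A)^-1 * NN o / 2) = _); last first.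
    by field; rewrite gt_eqF.
  rewrite -mulrDr; apply: ler_wpM2l; first by rewrite mulr_ge0 // ltW.
  set Y := C3 * _ in main *; clearbody Y; move: ((2 * A)^-1 * NN o) main reg => a; lra.
rewrite ExD //; last exact: bmeasZ.
rewrite ExZ // => h.
have : 0 <= 4 * A * Ex P (gap y') by rewrite mulr_ge0 // mulr_ge0 // ltW.
have : K <= (Num.sqrt C4 * T%:R `^ (1 - kappa / 2)) ^+ 2.
  have pE : T%:R `^ (1 - kappa / 2) ^+ 2 = T%:R `^ (1 - kappa) * T%:R :> R.
    rewrite expr2 -powRD; last by rewrite pnatr_eq0 -lt0n T0 implybT.
    rewrite -[X in _ = _ * X]powRr1 // -powRD; last by rewrite pnatr_eq0 -lt0n T0 implybT.
    by congr powR; lra.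
  have mx1 : T%:R `^ Num.max kappa (1 - kappa) <= T%:R :> R.
    rewrite -[leRHS]powRr1 //; apply: ler_powR => //.
    by rewrite ge_max; apply/andP; split; lra.
  rewrite exprMn sqr_sqrtr ?(ltW C4_gt0) // pE.
  have -> : C4 * (T%:R `^ (1 - kappa) * T%:R) =
      4 * A * (C3 * T%:R + 2 * T%:R * \sum_i Ff i) by rewrite /C4 /A; field.
  apply: ler_wpM2l; first by rewrite mulr_ge0 // ltW.
  by rewrite lerD2r ler_wpM2l.
by move: h; lra.
Qed.
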